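(* Suppose $d=2$. Then $\mathbb{E}_\nu N=\infty$.
   Context: Let $V(L)=[-L,L]^2\cap\mathbb{Z}^2$, and let $o$ be the origin. A sandpile on $V(L)$ is a map $\eta:V(L)\to\{0,1,2,\dots\}$, stable if all values are $<4$. If $\eta(x)\ge4$, then $x$ may topple: $\eta(x)$ decreases by $4$ and each nearest neighbour of $x$ in $V(L)$ receives one particle (particles leaving $V(L)$ are lost). Stabilization (carrying out all possible topplings) is well defined independently of the order. The sandpile Markov chain on $V(L)$ (add a particle at a uniformly chosen vertex, stabilize) has a unique stationary distribution $\nu_L$. As $L\to\infty$, $\nu_L$ converges weakly (convergence of probabilities of cylinder events) to a measure $\nu$ on $\{0,1,2,3\}^{\mathbb{Z}^2}$, the sandpile measure. For a stable sandpile $\eta$ on $\mathbb{Z}^2$, $N=N(\eta)\in\{0,1,2,\dots\}\cup\{\infty\}$ is the number of times $o$ topples when one particle is added at $o$ and topplings (a vertex with at least $4$ particles sends one to each of its $4$ neighbours) are carried out in any exhaustive sequence, i.e. a finite or infinite sequence of topplings of unstable vertices in which any vertex unstable at some point is toppled at a later time; $N$ does not depend on the sequence chosen (it is also the number of waves of the avalanche). *)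

(* Defs.v *)
From HB Require Import structures.
From mathcomp Require Import all_boot all_order all_algebra.
From mathcomp Require Import all_classical all_reals all_analysis.
From mathcomp Require Import zify.

Set Implicit Arguments.
Unset Strict Implicit.
Unset Printing Implicit Defensive.

Import Order.TTheory GRing.Theory Num.Theory.
Import numFieldNormedType.Exports.

Local Open Scope classical_set_scope.
Local Open Scope ring_scope.

Definition site : Type := (int * int)%type.

Definition origin : site := (0, 0).

Definition adj (x y : site) : bool :=
  (`|(x.1 - y.1)%R| + `|(x.2 - y.2)%R| == 1)%N.

(* Sandpiles on a graph [nbr] that is a (possibly infinite) subgraph of Z^2:
   the threshold is 4 at every vertex, so that a vertex with fewer than four
   neighbours loses the remaining particles when it topples. *)
Section Sandpile.
Variables (T : eqType) (nbr : rel T).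

Definition sandpile := T -> nat.

Definition add_particle (x : T) (eta : sandpile) : sandpile :=
  fun y => (eta y + (y == x))%N.

Definition unstable (eta : sandpile) (x : T) : bool := (4 <= eta x)%N.

Definition topple (x : T) (eta : sandpile) : sandpile :=
  fun y => if y == x then (eta y - 4)%N else (eta y + nbr x y)%N.

Inductive topples_to (eta : sandpile) : sandpile -> Prop :=
| topples_refl : topples_to eta eta
| topples_step xi x :
    topples_to eta xi -> unstable xi x -> topples_to eta (topple x xi).

Definition stabilizes_to (eta xi : sandpile) : Prop :=
  topples_to eta xi /\ forall x, ~~ unstable xi x.

(* [s k] is the vertex toppled at step [k]; a finite toppling sequence of
   length [n] is encoded by [s k = None] for all [k >= n]. *)
Fixpoint after (s : nat -> option T) (eta : sandpile) (k : nat) : sandpile :=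
  if k is k'.+1 then
    if s k' is Some x then topple x (after s eta k') else after s eta k'
  else eta.

Definition exhaustive (eta : sandpile) (s : nat -> option T) : Prop :=
  [/\ forall k, s k = None -> s k.+1 = None,
      forall k x, s k = Some x -> unstable (after s eta k) x
    & forall k x, unstable (after s eta k) x ->
        exists2 m, (k <= m)%N & s m = Some x].

End Sandpile.

Definition box (L : nat) : seq site :=
  let side := [seq i%:Z - L%:Z | i <- iota 0 (2 * L + 1)] in
  [seq (a, b) | a <- side, b <- side].

Lemma mem_box (L : nat) (x : site) :
  (x \in box L) = (- L%:Z <= x.1 <= L%:Z) && (- L%:Z <= x.2 <= L%:Z).
Proof.
have H (a : int) : (a \in [seq i%:Z - L%:Z | i <- iota 0 (2 * L + 1)])
    = (- L%:Z <= a <= L%:Z).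
  apply/mapP/idP => [[i]|/andP[h1 h2]].
    by rewrite mem_iota => hi ->; lia.
  exists (absz (a + L%:Z)); last by lia.
  by rewrite mem_iota; lia.
rewrite -!H /box; case: x => a b /=.
apply/allpairsP/andP => [[[u v] /= [hu hv [-> ->]]]|[ha hb]] //.
by exists (a, b).
Qed.

Definition V (L : nat) : finType := seq_sub (box L).

Definition adjV (L : nat) : rel (V L) := fun x y => adj (val x) (val y).

Definition stableV (L : nat) : finType := {ffun V L -> 'I_4}.

(* Probability of going from [eta] to [xi] in one step of the sandpile chain:
   the proportion of the vertices [x] such that adding a particle at [x] and
   stabilizing leads to [xi]. *)
Definition transition (R : realType) (L : nat) (eta xi : stableV L) : R :=
  #|[set x : V L | `[< stabilizes_to (@adjV L)
        (add_particle x (fun y => nat_of_ord (eta y)))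
        (fun y => nat_of_ord (xi y)) >]]%SET|%:R / #|{: V L}|%:R.

Definition stationary (R : realType) (L : nat) (p : stableV L -> R) : Prop :=
  [/\ forall eta, 0 <= p eta,
      \sum_eta p eta = 1
    & forall xi, \sum_eta p eta * transition R eta xi = p xi].

Definition config : Type := site -> 'I_4.

HB.instance Definition _ := Choice.on config.
HB.instance Definition _ := isPointed.Build config (fun=> ord0).

Definition cylinder (E : set config) : Prop :=
  exists A : seq site,
    forall eta xi : config, {in A, eta =1 xi} -> E eta -> E xi.

Definition configM : measurableType _ := g_sigma_algebraType cylinder.

(* The value 0 outside of V(L) is immaterial for the weak limit: a given
   cylinder event only depends on sites of V(L) as soon as L is large. *)
Definition extend (L : nat) (eta : stableV L) : config :=
  fun x => if (insub x : option (V L)) is Some y then eta y else ord0.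

Definition prV (R : realType) (L : nat) (p : stableV L -> R) (E : set config)
    : R :=
  \sum_(eta : stableV L | `[< E (extend eta) >]) p eta.

Definition sandpile_measure (R : realType) (nu : probability configM R)
    : Prop :=
  exists2 nuL : forall L : nat, stableV L -> R,
    forall L, stationary (nuL L)
  & forall E : set config, cylinder E ->
      (prV (nuL L) E)%:E @[L --> \oo] --> nu E.

(* The number of topplings at the origin is the same for all exhaustive
   sequences, and such a sequence always exists: the choice of a value is
   canonical and the default value 0 is never used. *)
Definition N (R : realType) (eta : config) : \bar R :=
  xget 0%E [set n | exists2 s : nat -> option site,
    exhaustive adj (add_particle origin (fun y => nat_of_ord (eta y))) s
  & n = counting [set k | s k = Some origin]].

(* Main.v *)
(* Under the stationary law of a box the sandpile is uniform on the allowed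
   (recurrent) configurations, which are equinumerous with rooted spanning
   forests: deleting one edge at a time, burning a configuration and following
   the forest path of a vertex obey the same recursion.

   The topplings following the addition of a particle at [o] split into waves,
   in each of which [o] and then every vertex set off topple once.  Removing [o]
   after the k-th wave gives a recurrent configuration with [o] as an additional
   sink, and (configuration, k) is determined by the result.  So events that are
   rare for these two-rooted forests are rare for waves, up to the ratio of the
   two numbers of configurations, an effective resistance that is at most
   logarithmic in the radius.

   The bad event is that the burning of a wave, confined to a box, differs from
   the unconfined one; in terms of forests, that a path to [o] makes a detour
   between far apart scales.  If the larger scale is a fixed power of the smaller
   one, its probability is at most a negative power of the scale, by explicit
   logarithmic barriers for discrete subharmonic functions (the plane is
   recurrent), and this beats the logarithm.  On the other hand, the mean
   of the difference between the numbers of topplings at [o] and at distance r is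
   a potential kernel, of order log r, while this difference is bounded by a
   function of r.  So a bounded number of waves, all confined to a box of fixed
   radius, already contributes an arbitrarily large mean to the topplings at [o].

   To apply this in the box V(L), burn from the outside the complement of a
   smaller box: what remains unburnt is again uniform on recurrent
   configurations.  The resulting bound is about cylinder events, hence passes
   to the limit; by the least action principle [N] dominates every finite legal
   toppling sequence. *)

From HB Require Import structures.
From mathcomp Require Import all_boot all_order all_algebra.
From mathcomp Require Import all_classical all_reals all_analysis.
From mathcomp Require Import measurable_realfun.
From mathcomp Require Import zify ring lra.
Require Import Defs.
From mathcomp Require Import fintype finset.

Set Implicit Arguments.
Unset Strict Implicit.
Unset Printing Implicit Defensive.

Import Order.TTheory GRing.Theory Num.Theory.
Import numFieldNormedType.Exports.

(** * Allowed configurations *)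

(** Graphs are directed and the sink is the complement of the vertex set. This class is stable under
    deleting an arc into the sink and under turning a vertex into sink, so the recursion never
    leaves it.

    No law is available for the state after [k] waves, only the injection of pairs (configuration,
    wave). It controls one wave in one box, and the region where toppling numbers are known exactly
    shrinks at each wave. Hence the order of choices: [M] fixes a radius [r], [r] fixes the number
    [K] of waves, and only then the base exponent [i0] grows. Along [K] boxes with exponents in
    geometric progression, the logarithm of the outer radius is at most a fixed multiple of [i0],
    while a detour costs [2^-1 ^+ i0].

    Detours are controlled through the path of one auxiliary vertex [w] at an intermediate scale. If
    it avoids [o], it is an obstacle all the way out. If it reaches [o], then either the path of [x]
    goes far before meeting it, or the two join near [o] and the path of [w] itself comes close and
    leaves again. Each time some path crosses every level of a range of scales, and at each scale a
    walk hits such a set with probability bounded below. *)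

Section Graph.
Variable T : finType.
Implicit Types (E : rel T) (A B R S : {set T}) (c : T -> nat).

Definition nb E S v := #|[set u in S | E v u]|.
Definition deg E v := nb E setT v.

Lemma nbS E S S' v : S \subset S' -> nb E S v <= nb E S' v.
Proof.
move=> sub; apply/subset_leq_card/subsetP => u.
by rewrite !inE => /andP[/(subsetP sub) -> ->].
Qed.

Lemma nb_deg E S v : nb E S v <= deg E v.
Proof. by apply: nbS; apply: subsetT. Qed.

Lemma nbU E S S' v : [disjoint S & S'] -> nb E (S :|: S') v = nb E S v + nb E S' v.
Proof.
move=> dis; rewrite /nb -cardsUI.
have -> : [set u in S | E v u] :&: [set u in S' | E v u] = set0.
  apply/setP => u; rewrite !inE; apply/negP => /andP[/andP[uS _] /andP[uS' _]].
  by move/pred0P: dis => /(_ u) /=; rewrite uS uS'.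
by rewrite cards0 addn0; congr #|pred_of_set _|; apply/setP => u; rewrite !inE andb_orl.
Qed.

Lemma nbC E S v : nb E S v + nb E (~: S) v = deg E v.
Proof.
by rewrite -nbU ?setUCr //; apply/pred0P => u /=; rewrite inE; case: (u \in S).
Qed.

Lemma nb1 E u v : nb E [set u] v = E v u.
Proof.
rewrite /nb; case: (boolP (E v u)) => Evu.
  rewrite /= -[RHS](cards1 u); congr #|pred_of_set _|; apply/setP => x; rewrite !inE.
  by case: eqP => // ->.
apply/eqP; rewrite cards_eq0; apply/eqP/setP => x; rewrite !inE.
by case: eqP => //= ->; apply/negbTE.
Qed.

Lemma nbD1 E S u v : u \in S -> nb E S v = E v u + nb E (S :\ u) v.
Proof.
move=> uS; rewrite -{1}(setD1K uS) nbU ?nb1 //.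
by rewrite disjoints1 !inE eqxx.
Qed.

Lemma nb_sum E S v : nb E S v = \sum_(u in S) E v u.
Proof.
rewrite /nb -sum1_card big_mkcond [RHS]big_mkcond; apply: eq_bigr => u _.
by rewrite inE; case: (u \in S); case: (E v u).
Qed.

(** Dhar's criterion: no nonempty subset is a forbidden subconfiguration. The complement of [A] acts
    as the sink because [nb E B v] sees only [B]. *)
Definition allowed E A c :=
  [forall B : {set T}, (B \subset A) && (B != set0) ==>
     [exists v in B, nb E B v <= c v]].

Lemma allowedP E A c :
  reflect (forall B, B \subset A -> B != set0 ->
             exists2 v, v \in B & nb E B v <= c v) (allowed E A c).
Proof.
apply: (iffP forallP) => [h B sBA B0|h B].
  have := h B; rewrite sBA B0 => /existsP[v /andP[vB le]]; by exists v.
apply/implyP => /andP[sBA B0]; have [v vB le] := h B sBA B0.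
by apply/existsP; exists v; rewrite vB.
Qed.

Lemma allowed_sub E A A' c : A' \subset A -> allowed E A c -> allowed E A' c.
Proof.
move=> sub /allowedP h; apply/allowedP => B sB; apply: h.
exact: subset_trans sub.
Qed.

Lemma allowed_le E A c c' :
  {in A, forall v, c v <= c' v} -> allowed E A c -> allowed E A c'.
Proof.
move=> le /allowedP h; apply/allowedP => B sB B0.
have [v vB hv] := h B sB B0; exists v => //.
exact: leq_trans hv (le v (subsetP sB _ vB)).
Qed.

Lemma eq_allowed E A c c' :
  {in A, c =1 c'} -> allowed E A c = allowed E A c'.
Proof.
by move=> eqc; apply/idP/idP; apply: allowed_le => v vA; rewrite eqc.
Qed.

(** A witness for [B :\ v] serves for [B]: its additional neighbour [v] is paid for by the particle
    received from [v]. The vertex [v] serves itself only when [B] is [[set v]], where it has no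
    neighbour. *)
Lemma allowed_topple E A c c' v :
  {in A &, symmetric E} -> {in A, irreflexive E} -> v \in A ->
  (forall u, u \in A -> u != v -> c' u = c u + E v u) ->
  allowed E A c -> allowed E A c'.
Proof.
move=> symE irrE vA hc' /allowedP h; apply/allowedP => B sB B0.
have sB' : B :\ v \subset A by apply: subset_trans sB; apply: subD1set.
have [B'0|B'0] := eqVneq (B :\ v) set0; last first.
  have [u uB le] := h _ sB' B'0; move: (uB); rewrite !inE => /andP[uv uB0].
  have uA := subsetP sB _ uB0.
  exists u => //; rewrite hc' //.
  have [vB|vB] := boolP (v \in B).
    by rewrite (nbD1 _ _ vB) addnC (symE v u) //; clear -le; lia.
  rewrite -(_ : B :\ v = B) 1?(leq_trans le) ?leq_addr //.
  by apply/setP => x; rewrite !inE; case: eqP => // ->; rewrite (negbTE vB).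
have [vB|vB] := boolP (v \in B); last first.
  case/set0Pn: B0 => x xB; move/setP: B'0 => /(_ x); rewrite !inE xB andbT.
  by move/negbT; rewrite negbK => /eqP xv; rewrite -xv xB in vB.
have EB : B = [set v] by rewrite -(setD1K vB) B'0 setU0.
by exists v => //; rewrite EB nb1 irrE.
Qed.

(* Two allowed stable configurations in the same Laplacian class coincide:
   where [w] attains a positive maximum, [c'] would be forbidden. *)
Lemma class_le0 E A c c' (w : T -> int) :
  (forall v, v \notin A -> w v = 0%R) ->
  {in A, forall v, c v < deg E v} -> allowed E A c' ->
  {in A, forall v, (c v)%:Z = (c' v)%:Z + (deg E v)%:Z * w v - \sum_(u | E v u) w u}%R ->
  forall v, (w v <= 0)%R.
Proof.
move=> w0 stc alc' hw v0; rewrite leNgt; apply/negP => wv0.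
have [M hM] : {M | forall v, (w v <= w M)%R}.
  have [m _ hm] := @arg_maxP _ _ _ v0 predT w isT.
  by exists m => v; apply: hm.
have wM0 : (0 < w M)%R by apply: lt_le_trans (hM v0).
pose B := [set v | w v == w M].
have sBA : B \subset A.
  apply/subsetP => v; rewrite inE => /eqP wv; apply/negPn/negP => /w0.
  by rewrite wv => z; rewrite z ltxx in wM0.
have B0 : B != set0 by apply/set0Pn; exists M; rewrite inE.
have [v vB le] := allowedP _ _ _ alc' B sBA B0.
have := stc v (subsetP sBA _ vB); have := hw v (subsetP sBA _ vB).
move: (vB); rewrite inE => /eqP ->.
have : (\sum_(u | E v u) w u <= \sum_(u | E v u) (w M - (u \notin B)%:Z))%R.
  apply: ler_sum => u _; have := hM u; rewrite inE.
  by case: eqP => [->|]; rewrite ?subr0 //=; lia.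
have -> : (\sum_(u | E v u) (w M - (u \notin B)%:Z) =
          (deg E v)%:Z * w M - (nb E (~: B) v)%:Z)%R.
  rewrite big_split /= sumr_const sumrN; congr (_ - _)%R.
    rewrite -mulr_natl natz; congr (Posz _ * _)%R.
    by apply: eq_card => u; rewrite !inE.
  rewrite nb_sum (big_morph Posz PoszD (erefl _)) big_mkcond [RHS]big_mkcond /=.
  by apply: eq_bigr => u _; rewrite in_setC; case: (u \in B); case: (E v u).
have := nbC E B v; lia.
Qed.

(** The one-sided bound is applied to [w] and to its opposite. All uniqueness and injectivity
    statements on stabilization below rest on this, with [w] a difference of toppling numbers. *)
Lemma class_eq E A c c' (w : T -> int) :
  (forall v, v \notin A -> w v = 0%R) ->
  {in A, forall v, c v < deg E v} -> {in A, forall v, c' v < deg E v} ->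
  allowed E A c -> allowed E A c' ->
  {in A, forall v, (c v)%:Z =
     (c' v)%:Z + (deg E v)%:Z * w v - \sum_(u | E v u) w u}%R ->
  (forall v, w v = 0%R) /\ {in A, c =1 c'}.
Proof.
move=> w0 stc stc' alc alc' hw.
have le0 := class_le0 w0 stc alc' hw.
have ge0 v : (0 <= w v)%R.
  rewrite -oppr_le0; apply: (class_le0 (E := E) (A := A) (c := c') (c' := c)
    (w := fun u => - w u)%R) => // [u uA|u uA]; first by rewrite w0 ?oppr0.
  by rewrite sumrN (hw u uA); ring.
have w00 v : w v = 0%R by apply/le_anti/andP.
split=> // v vA; have := hw v vA.
rewrite w00 big1 => [|u _]; [lia | exact: w00].
Qed.

End Graph.

(** * Burning and spanning forests *)

Section BurningForests.
Variable T : finType.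
Implicit Types (E : rel T) (A B R S X : {set T}) (c : T -> nat) (u v r y z : T).
Implicit Types (F : {ffun T -> T}) (n : nat).

(* [burn E A B R c] is the set of vertices of [B] that burn when fire starts from
   [R] and vertices of [A] outside [B] never burn. *)
Definition bclosed E A B R c X :=
  [forall v, [&& v \in A, v \in B & deg E v <= c v + nb E (R :|: X) v]
     ==> (v \in X)].

Definition burn E A B R c := \bigcap_(X | bclosed E A B R c X) X.

Lemma burn_min E A B R c X : bclosed E A B R c X -> burn E A B R c \subset X.
Proof. by move=> cX; apply: bigcap_inf. Qed.

Lemma bclosedP E A B R c X :
  reflect (forall v, v \in A -> v \in B ->
             deg E v <= c v + nb E (R :|: X) v -> v \in X)
          (bclosed E A B R c X).
Proof.
apply: (iffP forallP) => [h v vA vB le|h v]; last first.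
  by apply/implyP => /and3P[]; apply: h.
by have := h v; rewrite vA vB le.
Qed.

Lemma burn_closed E A B R c : bclosed E A B R c (burn E A B R c).
Proof.
apply/bclosedP => v vA vB le; apply/bigcapP => X cX.
apply: (bclosedP _ _ _ _ _ _ cX) => //; apply: leq_trans le _.
by rewrite leq_add2l; apply: nbS; apply: setUS; apply: burn_min.
Qed.

Lemma burn_sub E A B R c : burn E A B R c \subset A :&: B.
Proof.
by apply: burn_min; apply/bclosedP => v vA vB _; rewrite inE vA vB.
Qed.

(** Degrees are at most [#|T|], so this bound on heights gives one finite type for all graphs on [T]
    at once, as the induction on the graph requires. *)
Definition cfg := {ffun T -> 'I_(#|T|.+1)}.

Definition hgt (xi : cfg) : T -> nat := fun v => xi v.

(* Recurrent configurations on [A] (the other vertices form the sink, an edge to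
   it being an edge of [E] leaving [A]), extended by 0 outside [A]. *)
Definition rec E A : {set cfg} :=
  locked [set xi : cfg | [forall v, if v \in A then xi v < deg E v else xi v == 0 :> nat]
            && allowed E A (hgt xi)].

Lemma recP E A (xi : cfg) :
  reflect [/\ forall v, v \in A -> hgt xi v < deg E v,
              forall v, v \notin A -> hgt xi v = 0
            & allowed E A (hgt xi)] (xi \in rec E A).
Proof.
rewrite /rec -lock inE; apply: (iffP andP) => [[/forallP h al]|[h h0 al]]; split => //.
- by move=> v vA; have := h v; rewrite vA.
- by move=> v vA; have := h v; rewrite (negbTE vA) => /eqP.
apply/forallP => v; case: ifPn => vA; first exact: h.
by rewrite -[nat_of_ord _]/(hgt xi v) h0.
Qed.

(* Spanning forests rooted outside [A], as parent maps: [F] is the identity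
   outside [A]. *)
Definition forest E A : {set {ffun T -> T}} :=
  locked [set F : {ffun T -> T} | [forall v, if v \in A
      then E v (F v) && [exists z, (z \notin A) && fconnect F v z]
      else F v == v]].

Lemma forestP E A F :
  reflect [/\ forall v, v \in A -> E v (F v),
              forall v, v \notin A -> F v = v
            & forall v, exists2 z, z \notin A & fconnect F v z]
          (F \in forest E A).
Proof.
rewrite /forest -lock inE; apply: (iffP forallP) => [h|[h1 h2 h3] v].
  split=> v => [vA|vA|]; first by have := h v; rewrite vA => /andP[].
    by have := h v; rewrite (negbTE vA) => /eqP.
  have := h v; case: ifPn => [_ /andP[_ /existsP[z /andP[]]]|vA _]; first by exists z.
  by exists v => //; apply: connect0.
case: ifPn => vA; last by rewrite h2.
rewrite h1 //=; have [z zA vz] := h3 v.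
by apply/existsP; exists z; rewrite zA.
Qed.

(* The forest path from [y] stays in [B] until its root, which lies in [R]. *)
Definition good A B R F y :=
  [exists z, [&& z \in R, z \notin A & fconnect F y z]] &&
  [forall x, fconnect F y x && (x \in A) ==> (x \in B)].

Lemma goodP A B R F y :
  reflect ((exists z, [/\ z \in R, z \notin A & fconnect F y z]) /\
           forall x, fconnect F y x -> x \in A -> x \in B) (good A B R F y).
Proof.
apply: (iffP andP) => [[/existsP[z /and3P[? ? ?]] /forallP h]|[[z [h1 h2 h3]] h]].
  by split=> [|x yx xA]; [exists z | have := h x; rewrite yx xA].
split; first by apply/existsP; exists z; rewrite h1 h2 h3.
by apply/forallP => x; apply/implyP => /andP[]; apply: h.
Qed.

Definition upd (S' : Type) (F : {ffun T -> S'}) v (a : S') : {ffun T -> S'} :=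
  [ffun u => if u == v then a else F u].

Lemma updE (S' : Type) (F : {ffun T -> S'}) v a u :
  upd F v a u = if u == v then a else F u.
Proof. by rewrite ffunE. Qed.

Lemma upd_upd (S' : Type) (F : {ffun T -> S'}) v a b :
  upd (upd F v a) v b = upd F v b.
Proof. by apply/ffunP => u; rewrite !ffunE; case: eqP. Qed.

Lemma upd_id (S' : Type) (F : {ffun T -> S'}) v : upd F v (F v) = F.
Proof. by apply/ffunP => u; rewrite !ffunE; case: eqP => // ->. Qed.

Lemma fconnectP F y z : reflect (exists n, z = iter n F y) (fconnect F y z).
Proof.
apply: (iffP idP) => [/iter_findex <-|[n ->]]; last exact: fconnect_iter.
by eexists.
Qed.

Lemma conn_upd F v a y : ~~ fconnect F y v ->
  fconnect (upd F v a) y =1 fconnect F y.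
Proof.
move=> nc; have H n : iter n (upd F v a) y = iter n F y.
  elim: n => //= n ->; rewrite updE ifN //.
  by apply: contra nc => /eqP <-; apply: fconnect_iter.
by move=> z; apply/fconnectP/fconnectP => -[n ->]; exists n; rewrite H.
Qed.

Lemma conn_upd_to F v a y : fconnect F y v -> fconnect (upd F v a) y v.
Proof.
move=> yv; apply/negPn/negP => nc; have := conn_upd (F v) nc v.
by rewrite upd_upd upd_id yv (negbTE nc).
Qed.

Lemma conn_dead F z x : F z = z -> fconnect F z x = (x == z).
Proof.
move=> Fz; apply/fconnectP/eqP => [[n ->]|->]; last by exists 0.
by elim: n => //= n ->.
Qed.

Lemma conn_cut F v y x : fconnect F y v ->
  fconnect F y x = fconnect (upd F v v) y x || fconnect F v x.
Proof.
move=> yv; apply/idP/orP => [/fconnectP[n ->]|[]]; last exact: connect_trans.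
- have : fconnect (upd F v v) y (iter n F y) \/ fconnect F v (iter n F y).
    elim: n => [|n [IH|IH]] /=; first by left.
      have [<-|ne] := eqVneq (iter n F y) v; first by right; apply: fconnect1.
      left; apply: connect_trans IH _; rewrite -(_ : upd F v v (iter n F y) = F (iter n F y)).
        exact: fconnect1.
      by rewrite updE (negbTE ne).
    by right; apply: connect_trans IH (fconnect1 _ _).
  by case; [left|right].
move=> /fconnectP[n ->].
elim: n => //= n IH; rewrite updE; case: eqP => // _.
exact: connect_trans IH (fconnect1 _ _).
Qed.

Definition dele E v r : rel T := fun a b => E a b && ~~ ((a == v) && (b == r)).

Lemma nb_dele E v r S u :
  nb (dele E v r) S u + ((u == v) && (r \in S) && E v r) = nb E S u.
Proof.
have [->|uv] /= := eqVneq u v; last first.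
  by rewrite addn0; apply: eq_card => x; rewrite !inE /dele (negbTE uv) andbT.
case: (boolP (r \in S)) => rS /=; last first.
  rewrite addn0; apply: eq_card => x; rewrite !inE /dele eqxx /=.
  by case: eqP => [->|]; rewrite ?(negbTE rS) // andbT.
rewrite (nbD1 E v rS) addnC (nbD1 _ v rS) {1}/dele !eqxx andbF add0n; congr addn.
apply: eq_card => x; rewrite !inE /dele eqxx /=.
by case: eqP => //=; rewrite andbT.
Qed.

Lemma deg_dele E v r u : deg (dele E v r) u + ((u == v) && E v r) = deg E u.
Proof. by have := nb_dele E v r setT u; rewrite in_setT andbT. Qed.

Section Step.
Variables (E : rel T) (A B R : {set T}) (v r : T).
Hypotheses (vA : v \in A) (rA : r \notin A) (Evr : E v r).
Let E' := dele E v r.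

Lemma rec_dele : rec E' A = [set xi in rec E A | hgt xi v < (deg E v).-1].
Proof.
have dv : deg E v = (deg E' v).+1 by rewrite -(deg_dele E v r v) eqxx Evr addn1.
have du u : u != v -> deg E' u = deg E u.
  by move=> uv; rewrite -(deg_dele E v r u) (negbTE uv) addn0.
have al xi : allowed E' A (hgt xi) = allowed E A (hgt xi).
  apply: eq_forallb => S; case: (boolP (S \subset A)) => //= SA.
  congr (_ ==> _); apply: eq_existsb => u; rewrite -(nb_dele E v r).
  by rewrite (negbTE (contra (subsetP SA r) rA)) andbF addn0.
apply/setP => xi; rewrite inE; apply/recP/andP => [[h1 h2 h3]|[/recP[h1 h2 h3] hv]].
  split; last by rewrite dv; apply: h1.
  apply/recP; split => //; last by rewrite -al.
  by move=> u uA; rewrite -(deg_dele E v r u); apply: ltn_addr; apply: h1.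
split; rewrite ?al // => u uA.
have [->|uv] := eqVneq u v; first by rewrite dv in hv.
by rewrite du //; apply: h1.
Qed.

Lemma forest_dele : forest E' A = [set F in forest E A | F v != r].
Proof.
apply/setP => F; rewrite inE; apply/forestP/andP => [[h1 h2 h3]|[/forestP[h1 h2 h3] hv]].
  split; last by have /andP[_] := h1 v vA; rewrite eqxx.
  by apply/forestP; split=> // u uA; have /andP[] := h1 u uA.
split => // u uA; rewrite /E' /dele h1 //=.
by apply/negP => /andP[/eqP uv]; apply/negP; rewrite uv.
Qed.

Lemma burn_dele c : v \in B -> r \in R -> burn E' A B R c = burn E A B R c.
Proof.
move=> vB rR; rewrite /burn; apply: eq_bigl => X; apply: eq_forallb => u.
rewrite -(nb_dele E v r) -(deg_dele E v r) inE rR andbT.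
by rewrite addnA leq_add2r.
Qed.

Definition cut_cfg (xi : cfg) : cfg := upd xi v ord0.

Lemma hgt_cut xi u : hgt (cut_cfg xi) u = if u == v then 0 else hgt xi u.
Proof. by rewrite /hgt updE; case: eqP. Qed.

Lemma rec_cut xi : xi \in rec E A -> cut_cfg xi \in rec E (A :\ v).
Proof.
move=> /recP[h1 h2 h3]; apply/recP; split => [u|u|].
- by rewrite !inE => /andP[uv uA]; rewrite hgt_cut (negbTE uv); apply: h1.
- by rewrite !inE hgt_cut; case: eqP => //= _; apply: h2.
have e : {in A :\ v, hgt (cut_cfg xi) =1 hgt xi}.
  by move=> u; rewrite !inE => /andP[uv uA]; rewrite hgt_cut (negbTE uv).
by rewrite (eq_allowed _ e); apply: allowed_sub h3; apply: subD1set.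
Qed.

Definition top_ord : 'I_(#|T|.+1) := inord (deg E v).-1.

Lemma deg_le : deg E v <= #|T|.
Proof. by rewrite -cardsT; apply/subset_leq_card/subsetP => u; rewrite inE. Qed.

Lemma deg_gt0 : 0 < deg E v.
Proof. by rewrite -(nbC _ [set r]) nb1 Evr. Qed.

Lemma top_ordE : top_ord = (deg E v).-1 :> nat.
Proof. by rewrite inordK //; have := deg_le; have := deg_gt0; lia. Qed.

(** A set containing [v] is served by [v] itself: height [(deg E v).-1] suffices as soon as one arc
    leaves the set, and the arc to [r] always does. *)
Lemma rec_top xi : xi \in rec E (A :\ v) ->
  upd xi v top_ord \in rec E A /\ hgt (upd xi v top_ord) v = (deg E v).-1.
Proof.
move=> /recP[h1 h2 h3].
have hv : hgt (upd xi v top_ord) v = (deg E v).-1 by rewrite /hgt updE eqxx top_ordE.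
have hu u : u != v -> hgt (upd xi v top_ord) u = hgt xi u.
  by move=> uv; rewrite /hgt updE (negbTE uv).
split=> //; apply/recP; split => [u uA|u uA|].
- have [->|uv] := eqVneq u v; first by rewrite hv; have := deg_gt0; lia.
  by rewrite hu //; apply: h1; rewrite !inE uv.
- rewrite hu; last by apply: contraNneq uA => ->.
  by apply: h2; rewrite !inE negb_and uA orbT.
apply/allowedP => S SA S0; have [vS|vS] := boolP (v \in S).
  exists v => //; rewrite hv -ltnS prednK ?deg_gt0 //.
  rewrite -(nbC E S v) -addn1 leq_add2l.
  by rewrite (@nbD1 _ _ _ r) ?Evr // inE (contra (subsetP SA r)).
have [|u uS le] := allowedP _ _ _ h3 S _ S0.
  by apply/subsetP => u uS; rewrite !inE (subsetP SA) // andbT; apply: contraNneq vS => <-.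
by exists u => //; rewrite hu //; apply: contraNneq vS => <-.
Qed.

(** At maximal height the single burning neighbour [r] ignites [v], so [v] may be counted as a
    source of fire from the start. *)
Lemma burn_cut xi : v \in B -> r \in R -> hgt xi v = (deg E v).-1 ->
  burn E A B R (hgt xi) = v |: burn E (A :\ v) B (v |: R) (hgt (cut_cfg xi)).
Proof.
move=> vB rR xv; apply/eqP; rewrite eqEsubset; apply/andP; split.
  apply: burn_min; apply/bclosedP => u uA uB le.
  rewrite !inE; case: eqP => //= /eqP uv.
  apply: (bclosedP _ _ _ _ _ _ (burn_closed _ _ _ _ _)) => //; first by rewrite !inE uv.
  by rewrite hgt_cut (negbTE uv) -setUA setUCA.
have vb : v \in burn E A B R (hgt xi).
  apply: (bclosedP _ _ _ _ _ _ (burn_closed _ _ _ _ _)) => //.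
  rewrite xv (@nbD1 _ _ _ r) ?Evr ?inE ?rR //; have := deg_gt0; lia.
rewrite subUset sub1set vb; apply: burn_min; apply/bclosedP => u.
rewrite !inE => /andP[uv uA] uB; rewrite hgt_cut (negbTE uv) => le.
apply: (bclosedP _ _ _ _ _ _ (burn_closed _ _ _ _ _)) => //.
have e : v |: (R :|: burn E A B R (hgt xi)) = R :|: burn E A B R (hgt xi).
  by apply/setUidPr; rewrite sub1set inE vb orbT.
by rewrite -setUA e in le.
Qed.

Definition cut_forest F : {ffun T -> T} := upd F v v.

Lemma forest_cut F : F \in forest E A -> cut_forest F \in forest E (A :\ v).
Proof.
move=> /forestP[h1 h2 h3]; apply/forestP; split => u.
- by rewrite !inE => /andP[uv uA]; rewrite updE (negbTE uv); apply: h1.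
- by rewrite !inE updE; case: eqP => //= _; apply: h2.
have [uv|uv] := boolP (fconnect F u v).
  by exists v; [rewrite !inE eqxx | apply: conn_upd_to].
have [z zA uz] := h3 u; exists z; last by rewrite conn_upd.
by rewrite !inE (negbTE zA) andbF.
Qed.

Lemma forest_top F : F \in forest E (A :\ v) -> upd F v r \in forest E A.
Proof.
move=> /forestP[h1 h2 h3].
have rv : r != v by apply: contraNneq rA => ->.
have vr : fconnect (upd F v r) v r.
  by rewrite -{2}(_ : upd F v r v = r) ?fconnect1 // updE eqxx.
apply/forestP; split => u.
- by move=> uA; rewrite updE; case: eqP => [->|/eqP uv] //; apply: h1; rewrite !inE uv.
- move=> uA; rewrite updE ifN; last by apply: contraNneq uA => ->.
  by apply: h2; rewrite !inE negb_and uA orbT.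
have [uv|uv] := boolP (fconnect F u v).
  by exists r => //; apply: connect_trans vr; apply: conn_upd_to.
have [z zA uz] := h3 u; exists z; last by rewrite conn_upd.
by move: zA; rewrite !inE negb_and negbK => /orP[/eqP zv|//]; rewrite zv (negbTE uv) in uz.
Qed.

(** A path through [v] goes on to [r] and ends there, so it is good as soon as it is good up to [v];
    the other paths do not see the cut. *)
Lemma good_cut F y : v \in B -> r \in R -> F \in forest E A -> F v = r ->
  good A B R F y = good (A :\ v) B (v |: R) (cut_forest F) y.
Proof.
move=> vB rR /forestP[_ hd _] Fv.
have Fr : F r = r by apply: hd.
have vr : fconnect F v r by rewrite -Fv fconnect1.
have cv x : fconnect F v x -> x = v \/ x = r.
  by rewrite fconnect_eqVf Fv conn_dead // => /orP[/eqP|/eqP]; [left|right].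
have [yv|yv] := boolP (fconnect F y v).
  have yv' := conn_upd_to v yv.
  apply/goodP/goodP => -[_ hB]; split.
  - by exists v; rewrite !inE eqxx.
  - move=> x yx; rewrite !inE => /andP[_]; apply: hB.
    by rewrite (conn_cut x yv) yx.
  - by exists r; split=> //; apply: connect_trans vr.
  move=> x; rewrite (conn_cut x yv) => /orP[yx|/cv[->//|xr]] xA; last first.
    by rewrite xr (negbTE rA) in xA.
  have [->//|xv] := eqVneq x v; apply: hB => //; by rewrite !inE xv.
have hc := conn_upd v yv.
apply/goodP/goodP => -[[z [zR zA yz]] hB].
  split; first by exists z; rewrite !inE zR orbT (negbTE zA) andbF hc.
  by move=> x; rewrite hc => yx; rewrite !inE => /andP[_]; apply: hB.
rewrite hc in yz; have zv : z != v by apply: contraNneq yv => <-.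
split; first by exists z; move: zR zA; rewrite !inE (negbTE zv).
move=> x yx xA; apply: hB; rewrite ?hc // !inE xA andbT.
by apply: contraNneq yv => <-.
Qed.

Lemma card_rec_top (P : pred cfg) (Q : pred cfg) :
  (forall xi, xi \in rec E A -> hgt xi v = (deg E v).-1 -> P xi = Q (cut_cfg xi)) ->
  #|[set xi in rec E A | P xi & hgt xi v == (deg E v).-1]| =
  #|[set xi in rec E (A :\ v) | Q xi]|.
Proof.
move=> PQ; rewrite -(@card_in_imset _ _ cut_cfg); last first.
  move=> x1 x2; rewrite !inE => /and3P[_ _ /eqP e1] /and3P[_ _ /eqP e2] e.
  apply/ffunP => u; move/ffunP: (e) => /(_ u); rewrite !updE; case: eqP => // -> _.
  by apply: val_inj; rewrite /= -[LHS]/(hgt x1 v) e1 -e2.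
apply: eq_card => xi; apply/imsetP/idP => [[x]|].
  rewrite inE => /and3P[xr Px /eqP xv] ->; rewrite inE rec_cut //.
  by rewrite -PQ.
rewrite inE => /andP[xr Qx]; have [h1 h2] := rec_top xr.
have e : cut_cfg (upd xi v top_ord) = xi.
  rewrite /cut_cfg upd_upd; apply/ffunP => u; rewrite updE; case: eqP => // ->.
  apply: val_inj => /=; move/recP: xr => [_ h0 _].
  by rewrite -[RHS]/(hgt xi v) h0 // !inE eqxx.
by exists (upd xi v top_ord); rewrite ?e // inE h1 h2 eqxx PQ // e Qx.
Qed.

Lemma card_forest_top (P Q : pred {ffun T -> T}) :
  (forall F, F \in forest E A -> F v = r -> P F = Q (cut_forest F)) ->
  #|[set F in forest E A | P F & F v == r]| =
  #|[set F in forest E (A :\ v) | Q F]|.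
Proof.
move=> PQ; rewrite -(@card_in_imset _ _ cut_forest); last first.
  move=> x1 x2; rewrite !inE => /and3P[_ _ /eqP e1] /and3P[_ _ /eqP e2] e.
  apply/ffunP => u; move/ffunP: (e) => /(_ u); rewrite !updE; case: eqP => // -> _.
  by rewrite e1 e2.
apply: eq_card => F; apply/imsetP/idP => [[x]|].
  by rewrite inE => /and3P[xr Px /eqP xv] ->; rewrite inE forest_cut // -PQ.
rewrite inE => /andP[xr Qx]; have h1 := forest_top xr.
have e : cut_forest (upd F v r) = F.
  rewrite /cut_forest upd_upd; apply/ffunP => u; rewrite updE; case: eqP => // ->.
  by move/forestP: xr => [_ ->] //; rewrite !inE eqxx.
exists (upd F v r); rewrite ?e // inE h1 /= updE eqxx eqxx andbT PQ ?e //.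
by rewrite updE eqxx.
Qed.

End Step.

Definition edges E := [set p : T * T | E p.1 p.2].

Lemma edges_dele E v r : E v r -> #|edges (dele E v r)| < #|edges E|.
Proof.
move=> Evr; apply: proper_card; apply/properP; split.
  by apply/subsetP => p; rewrite !inE => /andP[].
by exists (v, r); rewrite !inE //= /dele !eqxx andbF.
Qed.

Lemma cardsI_split (S : finType) (D : {set S}) (P Q1 Q2 : pred S) :
  (forall x, x \in D -> Q1 x = ~~ Q2 x) ->
  #|[set x in D | P x]| = #|[set x in D | P x & Q1 x]| + #|[set x in D | P x & Q2 x]|.
Proof.
move=> Q12; rewrite -(cardsID [set x | Q1 x] [set x in D | P x]); congr (_ + _).
  by apply: eq_card => x; rewrite !inE andbA.
apply: eq_card => x; rewrite !inE; case: (boolP (x \in D)) => xD; rewrite ?andbF //=.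
by rewrite Q12 // negbK andbC.
Qed.

Lemma rec_top_split E A v xi : v \in A -> xi \in rec E A ->
  (hgt xi v < (deg E v).-1) = (hgt xi v != (deg E v).-1).
Proof. by move=> vA /recP[h _ _]; have := h v vA; lia. Qed.

Lemma forest_exit E A F v : F \in forest E A -> v \in A ->
  exists2 u, u \in A & (F u \notin A) && E u (F u).
Proof.
move=> /forestP[h1 h2 h3] vA; have [z zA /fconnectP[n zn]] := h3 v.
have : iter n F v \notin A by rewrite -zn.
elim: n {zn} => [|n IH] /=; first by rewrite vA.
by case: (boolP (iter n F v \in A)) => [xA FxA|/IH //]; exists (iter n F v); rewrite ?FxA ?h1.
Qed.

(** Both sides obey the same recursion along an arc from [A] to the sink, and [#|A| + #|edges E|]
    decreases in either branch. Without such an arc both sets are empty, or singletons when [A] is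
    empty. *)
Lemma rec_forest E A : #|rec E A| = #|forest E A|.
Proof.
have [n] := ubnP (#|A| + #|edges E|); elim: n E A => // n IH E A le.
case: (pickP [pred p : T * T | [&& p.1 \in A, p.2 \notin A & E p.1 p.2]]) => /=; last first.
  move=> no; have [->|A0] := eqVneq A set0.
    transitivity 1.
      rewrite -(cards1 ([ffun=> ord0] : cfg)); apply: eq_card => xi; rewrite [RHS]inE.
      apply/recP/eqP => [[_ h _]|->]; last first.
        split=> [v|v _|]; rewrite ?inE // /hgt ?ffunE //.
        by apply/allowedP => B; rewrite subset0 => ->.
      by apply/ffunP => v; apply: val_inj; rewrite ffunE /= -[LHS]/(hgt xi v) h ?inE.
    rewrite -(cards1 ([ffun u => u] : {ffun T -> T})); apply: esym.
    apply: eq_card => F; rewrite [RHS]inE.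
    apply/forestP/eqP => [[_ h _]|->].
      by apply/ffunP => v; rewrite ffunE h ?inE.
    split=> v; rewrite ?inE ?ffunE //.
    by exists v; rewrite ?inE ?connect0.
  transitivity 0; first apply/eqP; last apply/esym/eqP.
    rewrite cards_eq0; apply/eqP/setP => xi; rewrite in_set0; apply/recP => -[h1 _ /allowedP h].
    have [v vA le'] := h A (subxx _) A0.
    have := h1 v vA; rewrite -(nbC E A v) => lt.
    have : 0 < nb E (~: A) v by lia.
    rewrite card_gt0 => /set0Pn[r]; rewrite !inE => /andP[rA Evr].
    by have := no (v, r); rewrite /= vA rA Evr.
  rewrite cards_eq0; apply/eqP/setP => F; rewrite in_set0; apply/negP => Ff.
  case/set0Pn: A0 => v vA; have [u uA /andP[FuA Eu]] := forest_exit Ff vA.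
  by have := no (u, F u); rewrite /= uA FuA Eu.
move=> [v r] /= /and3P[vA rA Evr].
have H1 := @cardsI_split _ (rec E A) xpredT _ _ (fun xi => @rec_top_split E A v xi vA).
have H2 := @cardsI_split _ (forest E A) xpredT (fun F => F v != r) (fun F => F v == r)
  (fun _ _ => erefl).
transitivity #|[set xi in rec E A | true]|; first by apply: eq_card => x; rewrite !inE andbT.
rewrite H1; transitivity #|[set F in forest E A | true]|; last first.
  by apply: eq_card => x; rewrite !inE andbT.
rewrite H2; congr (_ + _).
  transitivity #|rec (dele E v r) A|; first by rewrite rec_dele.
  by rewrite IH ?forest_dele //; have := edges_dele Evr; lia.
rewrite (card_rec_top vA rA Evr (Q := xpredT)) //.
rewrite (card_forest_top vA rA Evr (Q := xpredT)) //.
transitivity #|rec E (A :\ v)|; first by apply: eq_card => x; rewrite !inE andbT.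
rewrite IH; last by rewrite (cardsD1 v A) vA in le; lia.
by apply: eq_card => x; rewrite !inE andbT.
Qed.

(** The recursion runs along an arc from [A :&: B] to [R]. Deleting it lowers the degree and the
    number of burning neighbours of [v] together, so the fire is unchanged; contracting it adds [v]
    to [R] on both sides. Without such an arc nothing burns and no path confined to [B] enters
    [R]. *)
Theorem card_burn_good E A B R y : R \subset ~: A -> y \in A :|: R ->
  #|[set xi in rec E A | (y \in R) || (y \in burn E A B R (hgt xi))]| =
  #|[set F in forest E A | good A B R F y]|.
Proof.
have [n] := ubnP (#|A| + #|edges E|); elim: n E A R => // n IH E A R le RA yAR.
have RA' r : r \in R -> r \notin A by move/(subsetP RA); rewrite inE.
have [yR|yR] /= := boolP (y \in R).
  transitivity #|rec E A|; first by apply: eq_card => x; rewrite !inE andbT.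
  rewrite rec_forest; apply: eq_card => F; rewrite [RHS]inE.
  case: (boolP (F \in forest E A)) => //= Ff; apply/esym/goodP.
  have yA := RA' y yR; split; first by exists y; rewrite connect0.
  by move=> x; rewrite conn_dead; [move=> /eqP->; rewrite (negbTE yA) | move/forestP: Ff => [_ ->]].
have yA : y \in A by move: yAR; rewrite inE (negbTE yR) orbF.
case: (pickP [pred p : T * T | [&& p.1 \in A, p.1 \in B, p.2 \in R & E p.1 p.2]]) => /=;
  last first.
  move=> no; transitivity 0; first apply/eqP; last apply/esym/eqP.
    rewrite cards_eq0; apply/eqP/setP => xi; rewrite in_set0.
    apply/negP; rewrite inE => /andP[xr].
    suff /subsetP h : burn E A B R (hgt xi) \subset set0 by move/h; rewrite inE.
    apply: burn_min; apply/bclosedP => v vA vB; rewrite setU0 => ld.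
    move/recP: xr => [h1 _ _]; have := h1 v vA => lt.
    have : 0 < nb E R v by lia.
    rewrite card_gt0 => /set0Pn[r]; rewrite !inE => /andP[rR Evr].
    by have := no (v, r); rewrite /= vA vB rR Evr.
  rewrite cards_eq0; apply/eqP/setP => F; rewrite in_set0 inE; apply/negP.
  move=> /andP[/forestP[h1 h2 _] /goodP[[z [zR zA /fconnectP[m zm]]] hB]].
  suff : iter m F y \notin R by rewrite -zm zR.
  elim: m {zm} => //= m IHm; have [xA|xA] := boolP (iter m F y \in A); last by rewrite h2.
  have xB : iter m F y \in B by apply: hB => //; apply: fconnect_iter.
  apply/negP => FR.
  by have := no (iter m F y, F (iter m F y)); rewrite /= xA xB FR h1.
move=> [v r] /= /and4P[vA vB rR Evr]; have rA := RA' r rR.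
rewrite (cardsI_split _ (fun xi => @rec_top_split E A v xi vA)).
rewrite (@cardsI_split _ (forest E A) _ (fun F => F v != r) (fun F => F v == r)) //.
congr (_ + _).
  transitivity #|[set xi in rec (dele E v r) A |
      (y \in R) || (y \in burn (dele E v r) A B R (hgt xi))]|.
    apply: eq_card => xi; rewrite rec_dele // [LHS]inE [RHS]inE [in RHS]inE.
    by rewrite (negbTE yR) (burn_dele E A _ vB rR) /= andbA andbAC.
  apply: etrans (IH _ A R _ RA yAR) _; first by have := edges_dele Evr; lia.
  apply: eq_card => F; rewrite forest_dele // [LHS]inE [RHS]inE [in LHS]inE.
  by rewrite andbA andbAC.
rewrite (card_rec_top vA rA Evr (Q := fun x => (y \in v |: R) ||
  (y \in burn E (A :\ v) B (v |: R) (hgt x)))); last first.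
  by move=> xi xr xt; rewrite (burn_cut vA rA Evr vB rR xt) !inE (negbTE yR) orbF.
rewrite (card_forest_top vA rA Evr (Q := fun F => good (A :\ v) B (v |: R) F y)); last first.
  by move=> F Ff Fv; apply: (good_cut rA _ vB rR Ff Fv).
apply: IH.
- by rewrite (cardsD1 v A) vA in le; lia.
- apply/subsetP => x; rewrite !inE => /orP[/eqP->|/RA' xA]; first by rewrite eqxx.
  by rewrite (negbTE xA) andbF.
by rewrite !inE yA; case: eqP.
Qed.

End BurningForests.

(** * Conditioning a forest on the path of one vertex *)

Section ForestPaths.
Variable T : finType.
Implicit Types (E : rel T) (A B R S X P : {set T}) (u v w x y z : T).
Implicit Types (F : {ffun T -> T}) (n : nat).

Lemma conn_linear F u a b :
  fconnect F u a -> fconnect F u b -> fconnect F a b || fconnect F b a.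
Proof.
move=> /fconnectP[n ->] /fconnectP[m ->]; case: (leqP n m) => [le|/ltnW le].
  by rewrite -(subnK le) iterD fconnect_iter.
by rewrite -(subnK le) iterD fconnect_iter orbT.
Qed.

Lemma conn_fix2 F u a b :
  F a = a -> F b = b -> fconnect F u a -> fconnect F u b -> a = b.
Proof.
move=> Fa Fb ua ub; case/orP: (conn_linear ua ub); rewrite conn_dead //.
  by move/eqP.
by move/eqP.
Qed.

Lemma conn_back F y x : fconnect F (F y) y -> fconnect F y x -> fconnect F x y.
Proof.
move=> cyc /fconnectP[n ->]; elim: n => [|n IH] //=.
by move: IH; rewrite fconnect_eqVf => /orP[/eqP->|].
Qed.

Lemma forest_acyclic E A F y :
  F \in forest E A -> y \in A -> ~~ fconnect F (F y) y.
Proof.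
move=> /forestP[_ h2 h3] yA; apply/negP => cyc; have [z zA yz] := h3 y.
have := conn_back cyc yz; rewrite conn_dead ?h2 // => /eqP yzE.
by rewrite -yzE yA in zA.
Qed.

Lemma forest_antisym E A F x y : F \in forest E A ->
  fconnect F x y -> fconnect F y x -> x = y.
Proof.
move=> Ff xy yx; move: (xy); rewrite fconnect_eqVf => /orP[/eqP//|Fxy].
have [xA|xA] := boolP (x \in A).
  by have := forest_acyclic Ff xA; rewrite (connect_trans Fxy yx).
by move: xy; rewrite conn_dead; [move/eqP | move/forestP: Ff => [_ ->]].
Qed.

Lemma forest_upd E A F y u : F \in forest E A -> y \in A -> E y u ->
  ~~ fconnect F u y -> upd F y u \in forest E A.
Proof.
move=> /forestP[h1 h2 h3] yA Eyu nuy; have hc := conn_upd u nuy.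
apply/forestP; split => [v vA|v vA|v].
- by rewrite updE; case: eqP => [->//|_]; apply: h1.
- by rewrite updE ifN ?h2 //; apply: contraNneq vA => ->.
have [vy|vy] := boolP (fconnect F v y); last first.
  by have [z zA vz] := h3 v; exists z; rewrite ?conn_upd.
have [z zA uz] := h3 u; exists z => //.
apply: connect_trans (conn_upd_to u vy) _.
by rewrite fconnect_eqVf updE eqxx hc uz orbT.
Qed.

Definition swap y (p : {ffun T -> T} * T) :=
  if fconnect p.1 p.2 y then p else (upd p.1 y p.2, p.1 y).

Lemma swap_in E A y F u : y \in A -> F \in forest E A -> E y u ->
  ((swap y (F, u)).1 \in forest E A) && E y (swap y (F, u)).2.
Proof.
move=> yA Ff Eyu; rewrite /swap /=; case: ifPn => /= [_|nuy]; first by rewrite Ff.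
by rewrite forest_upd //; move/forestP: Ff => [-> ].
Qed.

Lemma swapK E A y F u : y \in A -> F \in forest E A ->
  swap y (swap y (F, u)) = (F, u).
Proof.
move=> yA Ff; rewrite {2}/swap /=; case: ifPn => [uy|nuy]; first by rewrite /swap /= uy.
have ac := forest_acyclic Ff yA.
rewrite /swap /= (conn_upd u ac) (negbTE ac).
by rewrite upd_upd upd_id updE eqxx.
Qed.

(** After a reattachment the path of [y] is [y] followed by the path of [u]; otherwise it is the
    tail of the path of [u] starting at [y]. Both inherit goodness. *)
Lemma swap_good E A B R y F u : y \in A -> y \in B -> F \in forest E A ->
  good A B R F u -> good A B R (swap y (F, u)).1 y.
Proof.
move=> yA yB Ff /goodP[[z [zR zA uz]] hB]; rewrite /swap /=.
have Fz : F z = z by move/forestP: Ff => [_ ->].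
case: ifPn => /= [uy|nuy]; apply/goodP.
  split=> [|x yx]; last by apply: hB; apply: connect_trans uy yx.
  exists z; split => //; case/orP: (conn_linear uy uz) => //.
  by rewrite conn_dead // => /eqP yz; rewrite -yz yA in zA.
have hc := conn_upd u nuy.
split=> [|x]; last by rewrite fconnect_eqVf updE eqxx hc => /orP[/eqP <-|/hB].
by exists z; rewrite fconnect_eqVf updE eqxx hc uz orbT.
Qed.

(* Reattaching [y] to a neighbour [u] that does not descend from [y] is an
   involution on the pairs (forest, out-neighbour of [y]). *)
Theorem good_superharmonic E A B R y : y \in A -> y \in B ->
  \sum_(u | E y u) #|[set F in forest E A | good A B R F u]| <=
  deg E y * #|[set F in forest E A | good A B R F y]|.
Proof.
move=> yA yB.
pose D (Q : {ffun T -> T} -> T -> bool) :=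
  [set p : {ffun T -> T} * T | [&& p.1 \in forest E A, E y p.2 & Q p.1 p.2]].
have cD Q : #|D Q| = \sum_(u | E y u) #|[set F in forest E A | Q F u]|.
  rewrite -sum1_card (eq_bigr (fun u => \sum_(F in forest E A | Q F u) 1)); last first.
    by move=> u _; rewrite -sum1_card; apply: eq_bigl => F; rewrite inE.
  rewrite (exchange_big_dep (mem (forest E A))) /=; last by move=> u F _ /andP[].
  rewrite pair_big_dep /=; apply: eq_bigl => -[F u]; rewrite inE /=.
  by case: (F \in forest E A).
rewrite -(cD (fun F u => good A B R F u)).
suff : #|D (fun F u => good A B R F u)| <= #|D (fun F _ => good A B R F y)|.
  by rewrite [X in _ <= X]cD sum_nat_cond_const; congr (_ <= _ * _); apply: eq_card => u; rewrite !inE.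
rewrite -(@card_in_imset _ _ (swap y)); last first.
  move=> [F1 u1] [F2 u2]; rewrite !inE /= => /and3P[f1 _ _] /and3P[f2 _ _] e.
  by rewrite -(swapK u1 yA f1) e (swapK u2 yA f2).
apply/subset_leq_card/subsetP => p /imsetP[[F u]]; rewrite inE /= => /and3P[Ff Eyu gF] ->.
by rewrite inE andbA swap_in //= (swap_good yA yB Ff gF).
Qed.

Definition path_set A F w := [set x in A | fconnect F w x].

Definition cutP P F : {ffun T -> T} := [ffun u => if u \in P then u else F u].

(** The path of [w] with its parent pointers. Fixing a key means conditioning on the first branch in
    Wilson's algorithm. *)
Definition key A w F : {ffun T -> option T} :=
  [ffun u => if u \in path_set A F w then Some (F u) else None].

Lemma key_eq A w F F0 : key A w F = key A w F0 ->
  path_set A F w = path_set A F0 w /\ {in path_set A F0 w, F =1 F0}.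
Proof.
move/ffunP => e.
have e1 : path_set A F w = path_set A F0 w.
  by apply/setP => u; have := e u; rewrite !ffunE; do 2 case: ifP.
split=> // u uP; have := e u; rewrite !ffunE e1 uP; by case.
Qed.

Lemma conn_cutP_sub P F x a : fconnect (cutP P F) x a -> fconnect F x a.
Proof.
move=> /fconnectP[n ->]; elim: n => [|n IH] //=.
rewrite ffunE; case: ifP => // _; exact: connect_trans IH (fconnect1 _ _).
Qed.

Lemma conn_cutP P F x z a : cutP P F z = z -> fconnect (cutP P F) x z ->
  fconnect F x a = fconnect (cutP P F) x a || fconnect F z a.
Proof.
move=> Fz xz; apply/idP/orP => [/fconnectP[n ->]|[/conn_cutP_sub //|]]; last first.
  by apply: connect_trans; apply: conn_cutP_sub xz.
have : fconnect (cutP P F) x (iter n F x) \/ fconnect F z (iter n F x).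
  elim: n => [|n [IH|IH]] /=; first by left.
    have [iP|iP] := boolP (iter n F x \in P).
      rewrite -(conn_fix2 Fz _ xz IH) ?ffunE ?iP //; by right; apply: fconnect1.
    left; apply: connect_trans IH _.
    by rewrite -(_ : cutP P F (iter n F x) = F (iter n F x)) ?fconnect1 // ffunE (negbTE iP).
  by right; apply: connect_trans IH (fconnect1 _ _).
by case; [left|right].
Qed.

Section Fiber.
Variables (E : rel T) (A : {set T}) (w : T) (F0 : {ffun T -> T}).
Hypothesis F0f : F0 \in forest E A.
Let P := path_set A F0 w.

Lemma forest_cutP F : F \in forest E A -> cutP P F \in forest E (A :\: P).
Proof.
move=> /forestP[h1 h2 h3]; apply/forestP; split=> x.
- by rewrite inE ffunE => /andP[xP xA]; rewrite (negbTE xP) h1.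
- by rewrite inE ffunE negb_and negbK; case: ifP => //= _; apply: h2.
have [z zA /fconnectP[n zn]] := h3 x.
have : exists2 m, m <= n & iter m (cutP P F) x \in P \/ iter m (cutP P F) x = iter m F x /\ m = n.
  elim: n {zn} => [|n [m mn [h|[e emn]]]]; first by exists 0; [|right].
    by exists m; [apply: leq_trans mn _ | left].
  have [iP|iP] := boolP (iter m F x \in P); first by exists m; [lia | left; rewrite e].
  exists m.+1; first lia.
  by right; split; rewrite /= ?e ?ffunE ?(negbTE iP) ?emn.
case=> m _ [iP|[e emn]].
  by exists (iter m (cutP P F) x); [rewrite inE iP | apply: fconnect_iter].
exists z; first by rewrite inE (negbTE zA) andbF.
by rewrite zn -emn -e fconnect_iter.
Qed.

Definition glue F : {ffun T -> T} := [ffun u => if u \in P then F0 u else F u].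

Lemma glue_conn F : F \in forest E (A :\: P) -> fconnect (glue F) w =1 fconnect F0 w.
Proof.
move=> /forestP[_ h2 _].
suff H n : iter n (glue F) w = iter n F0 w.
  by move=> x; apply/fconnectP/fconnectP => -[n ->]; exists n; rewrite H.
elim: n => //= n ->; rewrite ffunE.
case: ifP => // iP; have iA : iter n F0 w \notin A.
  by apply/negP => iA; rewrite inE iA fconnect_iter in iP.
rewrite h2 ?inE ?(negbTE iA) ?andbF //.
by move/forestP: F0f => [_ ->].
Qed.

Lemma glue_path F : F \in forest E (A :\: P) -> path_set A (glue F) w = P.
Proof. by move=> Ff; apply/setP => x; rewrite !inE glue_conn. Qed.

Lemma glue_key F : F \in forest E (A :\: P) -> key A w (glue F) = key A w F0.
Proof.
move=> Ff; apply/ffunP => u; rewrite !ffunE glue_path //.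
by case: ifP => // ->.
Qed.

Lemma glue_forest F : F \in forest E (A :\: P) -> glue F \in forest E A.
Proof.
move=> Ff; have /forestP[h1 h2 h3] := Ff; have /forestP[k1 k2 k3] := F0f.
have PA x : x \in P -> x \in A by rewrite inE => /andP[].
apply/forestP; split=> x.
- move=> xA; rewrite ffunE; case: ifPn => xP; first exact: k1.
  by apply: h1; rewrite inE xP.
- move=> xA; rewrite ffunE ifN; last by apply: contra xA => /PA.
  by apply: h2; rewrite inE (negbTE xA) andbF.
have Pdead y : y \in P -> exists2 z, z \notin A & fconnect (glue F) y z.
  move=> yP; have [z zA yz] := k3 y; exists z => //.
  have wy : fconnect F0 w y by move: yP; rewrite inE => /andP[].
  have wz : fconnect (glue F) w z by rewrite glue_conn // (connect_trans wy yz).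
  have wy' : fconnect (glue F) w y by rewrite glue_conn.
  case/orP: (conn_linear wy' wz) => //; rewrite conn_dead.
    by move/eqP => e; rewrite -e PA in zA.
  rewrite ffunE ifN; last by apply: contra zA => /PA.
  by apply: h2; rewrite inE (negbTE zA) andbF.
have [z zA /fconnectP[n zn]] := h3 x.
have : (exists2 y, y \in P & fconnect (glue F) x y) \/ iter n (glue F) x = iter n F x.
  elim: n {zn} => [|n [IH|IH]] /=; [by right | by left |].
  rewrite IH ffunE; case: ifP => iP; last by right.
  by left; exists (iter n F x) => //; rewrite -IH fconnect_iter.
case=> [[y yP xy]|e].
  by have [z' z'A yz'] := Pdead y yP; exists z' => //; apply: connect_trans yz'.
have [zP|zP] := boolP (z \in P).
  have [z' z'A yz'] := Pdead z zP; exists z' => //; apply: connect_trans yz'.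
  by rewrite zn -e fconnect_iter.
exists z; last by rewrite zn -e fconnect_iter.
by move: zA; rewrite inE zP.
Qed.

Lemma cut_glue F : F \in forest E (A :\: P) -> cutP P (glue F) = F.
Proof.
move=> /forestP[_ h2 _]; apply/ffunP => u; rewrite !ffunE.
by case: (boolP (u \in P)) => uP //; rewrite h2 // inE uP.
Qed.

Lemma glue_cut F : key A w F = key A w F0 -> glue (cutP P F) = F.
Proof.
move=> /key_eq[_ e]; apply/ffunP => u; rewrite !ffunE.
by case: (boolP (u \in P)) => uP //; rewrite e.
Qed.

(** Domain Markov property: once the path is fixed its vertices become roots, and [glue] restores
    the path above any forest on the remaining vertices. *)
Lemma card_fiber (Q : pred {ffun T -> T}) :
  #|[set F in forest E A | (key A w F == key A w F0) && Q (cutP P F)]| =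
  #|[set F in forest E (A :\: P) | Q F]|.
Proof.
rewrite -(@card_in_imset _ _ (cutP P)); last first.
  move=> F1 F2; rewrite !inE => /and3P[_ /eqP k1 _] /and3P[_ /eqP k2 _] e.
  by rewrite -(glue_cut k1) e glue_cut.
apply: eq_card => F; apply/imsetP/idP => [[F1]|].
  by rewrite inE => /and3P[f1 _ q1] ->; rewrite inE forest_cutP.
rewrite inE => /andP[Ff QF]; exists (glue F); rewrite ?cut_glue //.
by rewrite inE glue_forest // glue_key // eqxx cut_glue.
Qed.

End Fiber.

(** Total probability over the path of [w]: the key decides [Pc], and in each fibre the bound on [Q]
    is relative to the size of the fibre, which [card_fiber] provides. *)
Lemma fiber_bound (R : realFieldType) E A w (Pc Q : pred {ffun T -> T}) (lam : R) :
  (0 <= lam)%R ->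
  (forall F0, F0 \in forest E A -> Pc F0 ->
     #|[set F in forest E A | (key A w F == key A w F0) && Q F]|%:R <=
     lam * #|forest E (A :\: path_set A F0 w)|%:R)%R ->
  (forall F F0, F \in forest E A -> F0 \in forest E A ->
     key A w F = key A w F0 -> Pc F = Pc F0) ->
  (#|[set F in forest E A | Pc F && Q F]|%:R <= lam * #|forest E A|%:R)%R.
Proof.
move=> lam0 hb hinv.
have part (D : {set {ffun T -> T}}) :
    #|D| = \sum_(k : {ffun T -> option T}) #|[set F in D | key A w F == k]|.
  rewrite -sum1_card (partition_big (key A w) xpredT) //=.
  by apply: eq_bigr => k _; rewrite -sum1_card; apply: eq_bigl => F; rewrite inE.
rewrite (part [set F in _ | _]) (part (forest E A)) !natr_sum mulr_sumr.
apply: ler_sum => k _.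
case: (pickP [pred F | [&& F \in forest E A, key A w F == k & Pc F]]) => [F0|no] /=; last first.
  rewrite (_ : #|_| = 0) ?mulr_ge0 ?ler0n //; apply/eqP; rewrite cards_eq0.
  apply/eqP/setP => F; rewrite in_set0; apply/negP; rewrite inE => /andP[].
  rewrite inE => /and3P[Ff pF _] kF.
  by have := no F; rewrite /= Ff kF pF.
move=> /and3P[f0 /eqP <- p0].
have := hb F0 f0 p0; have := card_fiber w f0 predT.
rewrite [X in _ = X -> _](_ : _ = #|forest E (A :\: path_set A F0 w)|); last first.
  by apply: eq_card => F; rewrite [LHS]inE andbT.
move=> <- h; apply: le_trans (le_trans h _).
  rewrite ler_nat; apply/subset_leq_card/subsetP => F; rewrite !inE => /andP[].
  move=> /andP[Ff]; by move=> /andP[_ ->] ->; rewrite Ff.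
apply: ler_wpM2l => //; rewrite ler_nat; apply/subset_leq_card/subsetP => F.
by rewrite !inE andbT.
Qed.

End ForestPaths.

Section MoreBurning.
Variable T : finType.
Implicit Types (E : rel T) (A B R X : {set T}) (c : T -> nat) (v : T).

Lemma eq_burn E A B R c c' : {in A, c =1 c'} -> burn E A B R c = burn E A B R c'.
Proof.
move=> e; suff h (d d' : T -> nat) : {in A, d =1 d'} -> burn E A B R d \subset burn E A B R d'.
  by apply/eqP; rewrite eqEsubset !h // => v vA; rewrite e.
move=> ed; apply: burn_min; apply/bclosedP => v vA vB; rewrite ed // => le.
exact: (bclosedP _ _ _ _ _ _ (burn_closed E A B R d')).
Qed.

Lemma burn_monoB E A B B' R c : B \subset B' -> burn E A B R c \subset burn E A B' R c.
Proof.
move=> BB; apply: burn_min; apply/bclosedP => v vA vB le.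
by apply: (bclosedP _ _ _ _ _ _ (burn_closed E A B' R c)) => //; apply: (subsetP BB).
Qed.

Lemma burn_step E A B R c X : X \subset burn E A B R c -> X != burn E A B R c ->
  exists v, [/\ v \in burn E A B R c, v \notin X & deg E v <= c v + nb E (R :|: X) v].
Proof.
move=> Xs Xn; have : ~~ bclosed E A B R c X.
  by apply: contra Xn => cX; rewrite eqEsubset Xs burn_min.
rewrite negb_forall => /existsP[v]; rewrite negb_imply => /andP[/and3P[vA vB le] vX].
exists v; split=> //; apply: (bclosedP _ _ _ _ _ _ (burn_closed E A B R c)) => //.
by apply: leq_trans le _; rewrite leq_add2l; apply: nbS; apply: setUS.
Qed.

(** A burning order: the least closed set is built one vertex at a time, each ignited by [R] and the
    vertices already present. *)
Lemma burn_ind E A B R c (P : {set T} -> Prop) : P set0 ->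
  (forall X v, X \subset burn E A B R c -> P X -> v \in burn E A B R c -> v \notin X ->
     deg E v <= c v + nb E (R :|: X) v -> P (v |: X)) -> P (burn E A B R c).
Proof.
move=> P0 PS; set W := burn E A B R c.
suff h n X : #|W :\: X| <= n -> X \subset W -> P X -> P W.
  by apply: (h #|T| set0) => //; [apply: max_card | apply: sub0set].
elim: n X => [|n IH] X; rewrite ?leqn0 ?cards_eq0 ?setD_eq0 => hn XW PX.
  by rewrite (_ : W = X) //; apply/eqP; rewrite eqEsubset hn.
have [<- //|Xn] := eqVneq X W; have [v [vW vX le]] := burn_step XW Xn.
apply: (IH (v |: X)); last exact: PS.
  have vD : v \in W :\: X by rewrite inE vX.
  by move: hn; rewrite (cardsD1 v) vD setDDl setUC.
by rewrite subUset sub1set vW.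
Qed.

Lemma burn_fixed E A B R c v : v \in burn E A B R c ->
  deg E v <= c v + nb E (R :|: burn E A B R c) v.
Proof.
apply: (burn_ind (P := fun X => v \in X -> deg E v <= c v + nb E (R :|: burn E A B R c) v)).
  by rewrite inE.
move=> X u XW IH uW uX le; rewrite !inE => /orP[/eqP ->|//].
by apply: leq_trans le _; rewrite leq_add2l; apply: nbS; apply: setUS.
Qed.

End MoreBurning.

(** * Waves *)

Section Waves.
Variables (T : finType) (E : rel T) (D : {set T}) (o : T).
Hypotheses (symE : {in D &, symmetric E}) (oD : o \in D).
Implicit Types (c : T -> nat) (v w : T) (X : {set T}) (eta : cfg T).

Definition wave c := o |: burn E (D :\ o) setT [set o] c.

(** The invariant between waves. The height of [o] may reach [deg E o], and does so exactly when
    another wave follows. *)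
Definition wstate c :=
  [/\ {in D :\ o, forall v, c v < deg E v}, c o <= deg E o & allowed E D c].

Definition fire c v := c v + nb E (wave c) v - (v \in wave c) * deg E v.

Definition wstep c := if deg E o <= c o then fire c else c.

Lemma wave_sub c : wave c \subset D.
Proof.
rewrite subUset sub1set oD /=; apply: subset_trans (burn_sub _ _ _ _ _) _.
by rewrite setIT; apply: subD1set.
Qed.

Lemma wave_o c : o \in wave c. Proof. by rewrite !inE eqxx. Qed.

Lemma wave_burnt c v : v \in wave c -> v != o -> deg E v <= c v + nb E (wave c) v.
Proof. by rewrite !inE => /orP[->//|vb _]; apply: burn_fixed. Qed.

Lemma fireE c v : deg E o <= c o ->
  fire c v + (v \in wave c) * deg E v = c v + nb E (wave c) v.
Proof.
move=> co; rewrite subnK //; case: (boolP (v \in wave c)) => vW; rewrite ?mul0n // mul1n.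
have [->|vo] := eqVneq v o; first by apply: leq_trans co _; apply: leq_addr.
exact: wave_burnt.
Qed.

(** For allowedness, a set not contained in the wave uses its part outside, which received particles
    from the wave. A set containing [o] uses [o], whose new height is [nb E (wave c) o]. Any other
    set uses its first vertex to burn, which then had enough burnt neighbours outside the set. *)
Lemma wstate_fire c : wstate c -> deg E o <= c o -> wstate (fire c).
Proof.
move=> [st co al] uns; have {co uns} co : c o = deg E o by apply/eqP; rewrite eqn_leq co.
have uns : deg E o <= c o by rewrite co.
have fE v := fireE v uns; split.
- move=> v vA; have := fE v; have := st v vA; have := nb_deg E (wave c) v.
  case: (boolP (v \in wave c)) => vW; first by lia.
  move=> _ cv; rewrite mul0n addn0 => ->.
  rewrite ltnNge; apply: contra vW => le; rewrite !inE; apply/orP; right.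
  by apply: (bclosedP _ _ _ _ _ _ (burn_closed E (D :\ o) setT [set o] c)).
- by have := fE o; rewrite wave_o mul1n co; have := nb_deg E (wave c) o; lia.
apply/allowedP => X XD X0.
have [XW0|XW0] := eqVneq (X :\: wave c) set0; last first.
  have XWD : X :\: wave c \subset D by apply: subset_trans (subsetDl _ _) XD.
  have [v vX le] := allowedP _ _ _ al _ XWD XW0.
  move: (vX); rewrite inE => /andP[vW vX']; exists v => //.
  have := fE v; rewrite (negbTE vW) mul0n addn0 => ->.
  apply: leq_trans (leq_add le (leqnn _)); rewrite -nbU; last first.
    rewrite -setI_eq0; apply/eqP/setP => x; rewrite in_setI in_setD in_set0.
    by case: (x \in wave c); rewrite ?andbF.
  by apply: nbS; apply/subsetP => x xX; rewrite in_setU in_setD xX andbT orNb.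
have XW : X \subset wave c by rewrite -setD_eq0 XW0.
have [oX|oX] := boolP (o \in X).
  exists o => //; have := fE o; rewrite wave_o mul1n co => e.
  by apply: leq_trans (nbS E o XW) _; lia.
set W := burn E (D :\ o) setT [set o] c.
have XB : X \subset W.
  apply/subsetP => x xX; have := subsetP XW x xX; rewrite !inE => /orP[/eqP xo|//].
  by rewrite -xo xX in oX.
have WX : W :\: X != W.
  apply/eqP => e; case/set0Pn: X0 => x xX; have := subsetP XB x xX.
  by rewrite -e inE xX.
have [v [vW vX le]] := burn_step (subsetDl W X) WX.
have vX' : v \in X by move: vX; rewrite inE vW andbT negbK.
exists v => //; have := fE v; rewrite (subsetP XW) // mul1n.
have : nb E ([set o] :|: W :\: X) v + nb E X v = nb E (wave c) v.
  rewrite -nbU; last first.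
    rewrite -setI_eq0; apply/eqP/setP => x; rewrite !inE.
    by case: (boolP (x \in X)) => xX; rewrite ?andbF //= andbT orbF; apply/eqP => xo; rewrite -xo xX in oX.
  congr (nb E _ v); apply/setP => x; rewrite !inE -/W.
  by case: (boolP (x \in X)) => xX; rewrite ?orbF ?orbT // (subsetP XB) ?orbT.
by clear -le; lia.
Qed.

Lemma wstate_step c : wstate c -> wstate (wstep c).
Proof. by rewrite /wstep; case: ifP => // ? ?; apply: wstate_fire. Qed.

Definition start eta v := hgt eta v + (v == o).

Definition state eta k := iter k wstep (start eta).

Definition active eta k := deg E o <= state eta k o.

Definition fires eta k v := \sum_(j < k) (active eta j && (v \in wave (state eta j))).

Lemma firesS eta k v :
  fires eta k.+1 v = fires eta k v + (active eta k && (v \in wave (state eta k))).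
Proof. exact: big_ord_recr. Qed.

Lemma fires_o eta k : fires eta k o = \sum_(j < k) active eta j.
Proof. by apply: eq_bigr => j _; rewrite wave_o andbT. Qed.

Lemma fires_le eta k v : fires eta k v <= fires eta k o.
Proof. by apply: leq_sum => j _; rewrite wave_o andbT; case: (active _ _); case: (v \in _). Qed.

Lemma fires_out eta k v : v \notin D -> fires eta k v = 0.
Proof.
move=> vD; apply: big1 => j _; rewrite (_ : v \in _ = false) ?andbF //.
by apply: contraNF vD; apply: (subsetP (wave_sub _)).
Qed.

Lemma wstate_start eta : eta \in rec E D -> wstate (start eta).
Proof.
move=> /recP[st _ al]; split.
- by move=> v; rewrite !inE /start => /andP[/negbTE -> vD]; rewrite addn0 st.
- by rewrite /start eqxx addn1 st.
by apply: allowed_le al => v _; apply: leq_addr.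
Qed.

Lemma wstate_state eta k : eta \in rec E D -> wstate (state eta k).
Proof. by move=> h; elim: k => [|k IH]; [apply: wstate_start | apply: wstate_step]. Qed.

Lemma active_prev eta k : active eta k.+1 -> active eta k.
Proof.
rewrite /active /state /= /wstep; set c := iter k _ _.
by move=> h; case: (leqP (deg E o) (c o)) h => //= lt; rewrite leqNgt lt.
Qed.

Lemma active_le eta j k : j <= k -> active eta k -> active eta j.
Proof.
elim: k => [|k IH]; first by rewrite leqn0 => /eqP ->.
by rewrite leq_eqVlt => /orP[/eqP -> //|jk /active_prev]; apply: IH.
Qed.

Lemma laplacian_state eta k v :
  state eta k v + deg E v * fires eta k v = start eta v + \sum_(w | E v w) fires eta k w.
Proof.
elim: k => [|k IH].
  by rewrite /fires big_ord0 muln0 big1 // => w _; rewrite big_ord0.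
rewrite firesS (eq_bigr _ (fun w _ => firesS eta k w)) big_split /= addnA -IH.
rewrite /wstep -/(active eta k).
have [a|na] := boolP (active eta k); last by rewrite big1_eq !addn0.
have := fireE v a; set W := wave _.
have -> : \sum_(w | E v w) (true && (w \in W)) = nb E W v.
  rewrite nb_sum big_mkcond [RHS]big_mkcond /=; apply: eq_bigr => w _.
  by case: (E v w); case: (w \in W).
by rewrite mulnDr andTb mulnC; lia.
Qed.

(* Forgetting the height of [o] after [k] waves makes [o] a sink. *)
Definition cut_state eta k : cfg T :=
  [ffun v => inord (if v \in D :\ o then state eta k v else 0)].

Lemma hgt_cut_state eta k v : eta \in rec E D ->
  hgt (cut_state eta k) v = if v \in D :\ o then state eta k v else 0.
Proof.
move=> h; rewrite /hgt ffunE inordK //; case: ifP => // vA.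
have [st _ _] := wstate_state k h; rewrite ltnS; apply: leq_trans (ltnW (st v vA)) _.
exact: max_card.
Qed.

Lemma cut_state_rec eta k : eta \in rec E D -> cut_state eta k \in rec E (D :\ o).
Proof.
move=> h; have [st co al] := wstate_state k h.
have hE v : v \in D :\ o -> hgt (cut_state eta k) v = state eta k v.
  by move=> vA; rewrite hgt_cut_state // vA.
apply/recP; split=> [v vA|v vA|].
- by rewrite hE // st.
- by rewrite hgt_cut_state // (negbTE vA).
by rewrite (eq_allowed _ hE); apply: allowed_sub al; apply: subD1set.
Qed.

(** The initial configurations differ by the Laplacian of the difference of toppling numbers, which
    vanishes outside [D]; being stable and allowed, they coincide by [class_eq]. *)
Lemma state_inj eta eta' k j : eta \in rec E D -> eta' \in rec E D ->
  {in D, state eta k =1 state eta' j} ->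
  eta = eta' /\ forall v, fires eta k v = fires eta' j v.
Proof.
move=> h h' e; have [s1 z1 a1] := recP _ _ _ h; have [s2 z2 a2] := recP _ _ _ h'.
pose w v : int := ((fires eta k v)%:Z - (fires eta' j v)%:Z)%R.
have [|v vD|w0 eqh] := @class_eq T E D (hgt eta) (hgt eta') w _ s1 s2 a1 a2.
- by move=> v vD; rewrite /w !fires_out // subrr.
- have := laplacian_state eta k v; have := laplacian_state eta' j v.
  rewrite e // /start sumrB -!(big_morph Posz PoszD (erefl _)) /w.
  by rewrite mulrBr; lia.
split; last by move=> v; have := w0 v; rewrite /w => /eqP; rewrite subr_eq0 => /eqP[].
apply/ffunP => v; apply: val_inj; rewrite -[LHS]/(hgt eta v) -[RHS]/(hgt eta' v).
by case: (boolP (v \in D)) => vD; [apply: eqh | rewrite z1 ?z2].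
Qed.

Lemma fires_active eta k : active eta k -> fires eta k o = k.
Proof.
move=> a; rewrite fires_o (eq_bigr (fun=> 1)) ?sum1_card ?card_ord // => j _.
by rewrite (active_le (ltnW (ltn_ord j)) a).
Qed.

(** While a wave is to come, the height of [o] is exactly [deg E o], so forgetting it loses nothing;
    the index is recovered as the number of topplings at [o]. *)
Lemma cut_state_inj eta eta' k j : eta \in rec E D -> eta' \in rec E D ->
  active eta k -> active eta' j -> cut_state eta k = cut_state eta' j ->
  eta = eta' /\ k = j.
Proof.
move=> h h' a a' e.
have ao (eta1 : cfg T) i : eta1 \in rec E D -> active eta1 i -> state eta1 i o = deg E o.
  by move=> h1 a1; have [_ le _] := wstate_state i h1; apply/eqP; rewrite eqn_leq le.
have [|e1 f] := state_inj (k := k) (j := j) h h'.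
  move=> v vD; have [->|vo] := eqVneq v o; first by rewrite !ao.
  have vA : v \in D :\ o by rewrite !inE vo.
  by have := congr1 (fun x => hgt x v) e; rewrite !hgt_cut_state // vA.
by split=> //; rewrite -(fires_active a) -[RHS](fires_active a').
Qed.

(** Injectivity makes the union over all waves free: bad waves are compared with uniform
    configurations for the larger sink. *)
Lemma sum_waves K (Bad : pred (cfg T)) :
  \sum_(eta in rec E D) \sum_(k < K) (active eta k && Bad (cut_state eta k)) <=
  #|[set xi in rec E (D :\ o) | Bad xi]|.
Proof.
pose S := [set p : cfg T * 'I_K |
  [&& p.1 \in rec E D, active p.1 p.2 & Bad (cut_state p.1 p.2)]].
have -> : \sum_(eta in rec E D) \sum_(k < K) (active eta k && Bad (cut_state eta k)) = #|S|.
  rewrite pair_big_dep /= -(sum1_card (mem S)) [RHS]big_mkcond /= [LHS]big_mkcond /=.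
  apply: eq_bigr => -[eta k] _; rewrite inE /= andbT.
  by case: (eta \in rec E D) => //=; case: (_ && _).
rewrite -(@card_in_imset _ _ (fun p : cfg T * 'I_K => cut_state p.1 p.2)); last first.
  move=> [e1 k1] [e2 k2]; rewrite !inE /= => /and3P[h1 a1 _] /and3P[h2 a2 _] e.
  by have [-> /val_inj ->] := cut_state_inj h1 h2 a1 a2 e.
apply/subset_leq_card/subsetP => x /imsetP[[eta k]]; rewrite inE /= => /and3P[h _ b] ->.
by rewrite inE cut_state_rec.
Qed.

(** By injectivity of [cut_state] no configuration has more waves than this, so [fires] at this
    index counts all topplings of the stabilization. *)
Definition wave_bound := #|rec E (D :\ o)|.

Lemma wave_bound_inactive eta : eta \in rec E D -> ~~ active eta wave_bound.
Proof.
move=> h; apply/negP => a; have := sum_waves wave_bound.+1 predT.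
rewrite (bigD1 eta) //= (eq_bigr (fun=> 1)); last first.
  by move=> k _; rewrite (active_le _ a) // -ltnS.
rewrite sum1_card card_ord => le.
have : #|[set xi in rec E (D :\ o) | predT xi]| <= wave_bound.
  by apply/subset_leq_card/subsetP => x; rewrite inE => /andP[].
by move/(leq_trans le); rewrite addSn ltnNge leq_addr.
Qed.

Definition final eta : cfg T :=
  [ffun v => inord (if v \in D then state eta wave_bound v else 0)].

Lemma final_stable eta v : eta \in rec E D -> v \in D ->
  state eta wave_bound v < deg E v.
Proof.
move=> h vD; have [->|vo] := eqVneq v o; first by rewrite ltnNge wave_bound_inactive.
by have [st _ _] := wstate_state wave_bound h; apply: st; rewrite !inE vo.
Qed.

Lemma hgt_final eta v : eta \in rec E D ->
  hgt (final eta) v = if v \in D then state eta wave_bound v else 0.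
Proof.
move=> h; rewrite /hgt ffunE inordK //; case: ifP => // vD.
by rewrite ltnS; apply: leq_trans (ltnW (final_stable h vD)) _; apply: max_card.
Qed.

Lemma final_rec eta : eta \in rec E D -> final eta \in rec E D.
Proof.
move=> h; have [st co al] := wstate_state wave_bound h.
have hE v : v \in D -> hgt (final eta) v = state eta wave_bound v.
  by move=> vD; rewrite hgt_final // vD.
apply/recP; split=> [v vD|v vD|].
- by rewrite hE // final_stable.
- by rewrite hgt_final // (negbTE vD).
by rewrite (eq_allowed _ hE).
Qed.

Lemma final_inj : {in rec E D &, injective final}.
Proof.
move=> eta eta' h h' e; have [|//] := state_inj (k := wave_bound) (j := wave_bound) h h'.
by move=> v vD; have := congr1 (fun x => hgt x v) e; rewrite !hgt_final // vD.
Qed.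

Lemma final_surj eta : eta \in rec E D -> exists2 eta', eta' \in rec E D & final eta' = eta.
Proof.
move=> h; have : final @: rec E D = rec E D.
  apply/eqP; rewrite eqEcard card_in_imset ?leqnn ?andbT; last exact: final_inj.
  by apply/subsetP => x /imsetP[y hy ->]; apply: final_rec.
by move/setP/(_ eta); rewrite h => /imsetP[y hy ->]; exists y.
Qed.

Definition total_fires v := \sum_(eta in rec E D) fires eta wave_bound v.

(** Dhar's formula. Stabilization permutes the recurrent configurations, so the mean height at [v]
    is the same before and after, and conservation of particles leaves the equation of a Green
    function. *)
Lemma total_firesE v : v \in D ->
  deg E v * total_fires v = (v == o) * #|rec E D| + \sum_(w | E v w) total_fires w.
Proof.
move=> vD; rewrite /total_fires [X in _ = _ + X]exchange_big /= big_distrr /=.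
have e : \sum_(eta in rec E D) state eta wave_bound v = \sum_(eta in rec E D) hgt eta v.
  rewrite (eq_bigr (fun eta => hgt (final eta) v)); last first.
    by move=> eta h; rewrite hgt_final // vD.
  rewrite -(big_imset (fun x => hgt x v) final_inj) /=; apply: eq_bigl => x.
  apply/imsetP/idP => [[y hy ->]|hx]; first exact: final_rec.
  by have [y hy <-] := final_surj hx; exists y.
apply/eqP; rewrite -(eqn_add2l (\sum_(eta in rec E D) hgt eta v)) -{1}e -big_split /=.
rewrite (eq_bigr _ (fun eta _ => laplacian_state eta wave_bound v)) big_split /=.
by rewrite [X in X + _ == _]big_split /= sum_nat_const mulnC -addnA.
Qed.

(** No neighbour of [v] topples more often than [o], so a deficit at [w] is felt in the particle
    balance at [v], up to the initial height, which is at most [deg E v]. Deficits thus grow by a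
    bounded factor per step. *)
Lemma fires_gap eta v w : eta \in rec E D -> v \in D -> E v w ->
  fires eta wave_bound o - fires eta wave_bound w <=
  deg E v * (fires eta wave_bound o - fires eta wave_bound v) + deg E v.
Proof.
move=> h vD Evw; have := laplacian_state eta wave_bound v.
set n := fires eta wave_bound; have le x : n x <= n o by apply: fires_le.
have s0 : start eta v <= deg E v.
  have [st _ _] := recP _ _ _ h; have := st v vD.
  by rewrite /start; case: (v == o); lia.
have : \sum_(x | E v x) n x + (n o - n w) <= deg E v * n o.
  rewrite (bigD1 w) //= (_ : deg E v = #|E v|); last by apply: eq_card => x; rewrite !inE.
  rewrite -sum_nat_const [leqRHS](bigD1 w) //= addnAC subnKC // leq_add2l.
  by apply: leq_sum => x _; apply: le.
by rewrite mulnBr; have := le v; have := leq_mul (leqnn (deg E v)) (le v); lia.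
Qed.

End Waves.

Local Open Scope ring_scope.

(** * Logarithmic potentials on the square lattice *)

Section Potentials.
Variable R : realType.
Implicit Types (z x w : site) (p n m : nat).

Definition nm z : nat := maxn `|z.1|%N `|z.2|%N.
Definition sq z : R := (z.1)%:~R ^+ 2 + (z.2)%:~R ^+ 2.
Definition lap4 (g : site -> R) z : R :=
  g (z.1 + 1, z.2) + g (z.1 - 1, z.2) + g (z.1, z.2 + 1) + g (z.1, z.2 - 1).

(* The value at the origin is small enough for [ln] of this to be superharmonic
   away from the origin. *)
Definition pk z : R := if z == origin then 126^-1 else sq z - 2^-1.
Definition qk z : R := ln (pk z).
Definition fk z : R := ln (1 + sq z).

Lemma natz_sq (a : int) : (a%:~R : R) ^+ 2 = (`|a|%N%:R) ^+ 2.
Proof. by rewrite natr_absz intr_norm real_normK ?num_real. Qed.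

Lemma sqE z : sq z = `|z.1|%N%:R ^+ 2 + `|z.2|%N%:R ^+ 2.
Proof. by rewrite /sq !natz_sq. Qed.

Lemma nm_sq z : (nm z)%:R ^+ 2 <= sq z <= 2 * (nm z)%:R ^+ 2.
Proof.
rewrite sqE /nm; have := leq_maxl `|z.1| `|z.2|; have := leq_maxr `|z.1| `|z.2|.
rewrite -!(ler_nat R); case: (leqP `|z.1|%N `|z.2|%N) => _ h1 h2; apply/andP; split.
- by have := sqr_ge0 (`|z.1|%N%:R : R); lra.
- have : 0 <= `|z.1|%N%:R :> R by []. nra.
- by have := sqr_ge0 (`|z.2|%N%:R : R); lra.
have : 0 <= `|z.2|%N%:R :> R by []. nra.
Qed.

Lemma nm_eq0 z : (nm z == 0)%N = (z == origin).
Proof. by case: z => a b; rewrite /nm /origin xpair_eqE /=; lia. Qed.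

Lemma nm_gt0_sq z : z != origin -> 1 <= sq z.
Proof.
rewrite -nm_eq0 -lt0n => h; have /andP[le _] := nm_sq z.
by apply: le_trans le; rewrite -natrX ler1n expn_gt0 h.
Qed.

Lemma pk_gt0 z : 0 < pk z.
Proof. by rewrite /pk; case: ifPn => [_|/nm_gt0_sq]; [rewrite invr_gt0; lra | lra]. Qed.

Lemma ln_prod4 (a b c d y : R) : 0 < a -> 0 < b -> 0 < c -> 0 < d -> 0 < y ->
  a * b * c * d <= y ^+ 4 -> ln a + ln b + ln c + ln d <= 4 * ln y.
Proof.
move=> a0 b0 c0 d0 y0 h.
rewrite -!lnM ?posrE ?mulr_gt0 // mulr_natl -lnXn //.
by rewrite ler_ln ?posrE ?mulr_gt0 ?exprn_gt0.
Qed.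

Lemma ln_prod4_ge (a b c d y : R) : 0 < a -> 0 < b -> 0 < c -> 0 < d -> 0 < y ->
  y ^+ 4 <= a * b * c * d -> 4 * ln y <= ln a + ln b + ln c + ln d.
Proof.
move=> a0 b0 c0 d0 y0 h.
rewrite -!lnM ?posrE ?mulr_gt0 // mulr_natl -lnXn //.
by rewrite ler_ln ?posrE ?mulr_gt0 ?exprn_gt0.
Qed.

(** Away from the origin and its neighbours, the shift by 1/2 makes the fourth power exceed the
    product by [4 * (x ^+ 2 - y ^+ 2) ^+ 2]. At a neighbour of the origin there is equality, which
    is where 126 comes from: 7/2, 3/2, 3/2 and 1/126 multiply to 1/16. *)
Lemma qk_super z : z != origin -> lap4 qk z <= 4 * qk z.
Proof.
move=> z0; apply: ln_prod4; rewrite ?pk_gt0 //.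
case: z z0 => a b z0; have := z0; rewrite /pk /origin /sq /= !xpair_eqE negb_and => z0'.
have zE : (a == 0) && (b == 0) = false by apply/negbTE; rewrite negb_and.
rewrite zE.
have e1 : ((a + 1)%:~R : R) = a%:~R + 1 by rewrite rmorphD.
have e2 : ((a - 1)%:~R : R) = a%:~R - 1 by rewrite rmorphB.
have e3 : ((b + 1)%:~R : R) = b%:~R + 1 by rewrite rmorphD.
have e4 : ((b - 1)%:~R : R) = b%:~R - 1 by rewrite rmorphB.
rewrite e1 e2 e3 e4.
case: (boolP ((a + 1 == 0) && (b == 0))) => [/andP[/eqP h1 /eqP h2]|h1].
  have -> : a = -1 by lia.
  by rewrite h2 /= !(rmorphN, rmorph1, rmorph0) /=; lra.
case: (boolP ((a - 1 == 0) && (b == 0))) => [/andP[/eqP h2 /eqP h3]|h2].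
  have -> : a = 1 by lia.
  by rewrite h3 /= !(rmorphN, rmorph1, rmorph0) /=; lra.
case: (boolP ((a == 0) && (b + 1 == 0))) => [/andP[/eqP h3 /eqP h4]|h3].
  have -> : b = -1 by lia.
  by rewrite h3 /= !(rmorphN, rmorph1, rmorph0) /=; lra.
case: (boolP ((a == 0) && (b - 1 == 0))) => [/andP[/eqP h4 /eqP h5]|h4].
  have -> : b = 1 by lia.
  by rewrite h4 /= !(rmorphN, rmorph1, rmorph0) /=; lra.
set x : R := a%:~R; set y : R := b%:~R.
rewrite -subr_ge0; set L := (X in 0 <= X).
have -> : L = 4 * (x ^+ 2 - y ^+ 2) ^+ 2 by rewrite /L; field.
by rewrite mulr_ge0 ?sqr_ge0.
Qed.

Lemma qk_origin : lap4 qk origin - 4 * qk origin = 4 * ln 63.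
Proof.
rewrite /lap4 /qk /pk /origin /sq /=.
rewrite !(rmorphD, rmorphN, rmorph1, rmorph0) /=.
have -> : (0 + 1) ^+ 2 + 0 ^+ 2 - 2^-1 = 2^-1 :> R by lra.
have -> : (0 - 1) ^+ 2 + 0 ^+ 2 - 2^-1 = 2^-1 :> R by lra.
have -> : 0 ^+ 2 + (0 + 1) ^+ 2 - 2^-1 = 2^-1 :> R by lra.
have -> : 0 ^+ 2 + (0 - 1) ^+ 2 - 2^-1 = 2^-1 :> R by lra.
rewrite !lnV ?posrE //.
have -> : (126 : R) = 2 * 63 by lra.
rewrite lnM ?posrE //; lra.
Qed.

(** Adding 1 under the logarithm removes the singularity, so the inequality also holds at the
    origin. *)
Lemma fk_sub z : 4 * fk z <= lap4 fk z.
Proof.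
have pos x : 0 < 1 + sq x by rewrite /sq; have := sqr_ge0 ((x.1)%:~R : R);
  have := sqr_ge0 ((x.2)%:~R : R); lra.
apply: ln_prod4_ge; rewrite ?pos //.
case: z => a b; rewrite /sq /= !(rmorphD, rmorphN, rmorph1) /=.
set x : R := a%:~R; set y : R := b%:~R.
rewrite -subr_ge0; set L := (X in 0 <= X).
have -> : L = 2 * (1 + x ^+ 2 + y ^+ 2) ^+ 2 + 8 * (1 + x ^+ 2 + y ^+ 2) + 5 +
              16 * x ^+ 2 * y ^+ 2 by rewrite /L; ring.
have := sqr_ge0 x; have := sqr_ge0 y; have := sqr_ge0 (1 + x ^+ 2 + y ^+ 2).
have := mulr_ge0 (sqr_ge0 x) (sqr_ge0 y); lra.
Qed.

Definition dsite (x w : site) : site := (x.1 - w.1, x.2 - w.2).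

Lemma lap4_shift (g : site -> R) w x :
  lap4 (fun z => g (dsite z w)) x = lap4 g (dsite x w).
Proof.
rewrite /lap4 /dsite /=; congr (g (_, _) + g (_, _) + g (_, _) + g (_, _)); ring.
Qed.

Lemma nm_dist x w : (nm (dsite x w) <= nm x + nm w)%N.
Proof. by rewrite /nm /dsite /=; lia. Qed.

Lemma nm_dist_ge x w : (nm x <= nm (dsite x w) + nm w)%N.
Proof. by rewrite /nm /dsite /=; lia. Qed.

Lemma nm_dist_ge' x w : (nm w <= nm (dsite x w) + nm x)%N.
Proof. by rewrite /nm /dsite /=; lia. Qed.

Lemma sum_invsqrt n :
  \sum_(0 <= l < n) (Num.sqrt (l.+1)%:R)^-1 <= 2 * Num.sqrt n%:R :> R.
Proof.
elim: n => [|n IH]; first by rewrite big_nil sqrtr0 mulr0.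
rewrite big_nat_recr //=.
suff : (Num.sqrt (n.+1)%:R)^-1 <= 2 * Num.sqrt (n.+1)%:R - 2 * Num.sqrt n%:R :> R by lra.
set s := Num.sqrt (n.+1)%:R; set t := Num.sqrt n%:R.
have s0 : 0 < s by rewrite sqrtr_gt0.
have t0 : 0 <= t by rewrite sqrtr_ge0.
have s2 : s ^+ 2 = n%:R + 1 :> R by rewrite sqr_sqrtr ?ler0n // -natr1.
have t2 : t ^+ 2 = n%:R :> R by rewrite sqr_sqrtr ?ler0n.
rewrite -(ler_pM2l s0) divff ?gt_eqF //; nra.
Qed.

Lemma sum_dist (n k X : nat) :
  \sum_(0 <= l < n) (Num.sqrt (`|X%:Z - (k + l)%:Z|%N.+1)%:R)^-1
    <= 4 * Num.sqrt n%:R :> R.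
Proof.
set g : nat -> R := fun m => (Num.sqrt m.+1%:R)^-1.
have gle a b : (a <= b)%N -> g b <= g a.
  move=> ab; rewrite /g lef_pV2 ?posrE ?sqrtr_gt0 ?ltr0n //.
  by rewrite ler_sqrt ?ler_nat // ltr0n.
(* Up to [j] the points approach [X], from there on they move away; each half is dominated by a sum
   as in [sum_invsqrt]. *)
pose j := minn n (X - k).
have jn : (j <= n)%N by apply: geq_minl.
rewrite (big_cat_nat (n := j)) //=.
have sq_le m : (m <= n)%N -> Num.sqrt m%:R <= Num.sqrt n%:R :> R.
  by move=> mn; apply: ler_wsqrtr; rewrite ler_nat.
have h1 : \sum_(0 <= l < j) g `|X%:Z - (k + l)%:Z|%N <= 2 * Num.sqrt n%:R.
  apply: (@le_trans _ _ (\sum_(0 <= l < j) g l)); last first.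
    by apply: le_trans (sum_invsqrt j) _; rewrite ler_pM2l // sq_le.
  rewrite [leRHS]big_nat_rev /=; apply: ler_sum_nat => l /andP[_ lj].
  by apply: gle; move: lj; rewrite /j; lia.
have h2 : \sum_(j <= l < n) g `|X%:Z - (k + l)%:Z|%N <= 2 * Num.sqrt n%:R.
  apply: (@le_trans _ _ (\sum_(0 <= l < n - j) g l)); last first.
    by apply: le_trans (sum_invsqrt _) _; rewrite ler_pM2l // sq_le // leq_subr.
  rewrite -{1}(add0n j) big_addn; apply: ler_sum_nat => l /andP[_ lj].
  by apply: gle; move: lj; rewrite /j; lia.
have -> : 4 * Num.sqrt n%:R = 2 * Num.sqrt n%:R + 2 * Num.sqrt n%:R :> R by lra.
exact: lerD.
Qed.

End Potentials.

(** * Barriers from logarithmic potentials *)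

Section Barriers.
Variable R : realType.
Implicit Types (z x : site) (p n m : nat).

Lemma lap4_sum (I : Type) (r : seq I) (g : I -> site -> R) x :
  lap4 (fun z => \sum_(i <- r) g i z) x = \sum_(i <- r) lap4 (g i) x.
Proof. by rewrite /lap4 !big_split. Qed.

Lemma lap4_divr (g : site -> R) c x : lap4 (fun z => g z / c) x = lap4 g x / c.
Proof. by rewrite /lap4 !mulrDl. Qed.

(** The poles have norm at most [2 * p], so points of norm at least [16 * p] are at distance at
    least [14 * p] from them. *)
Definition Fp p : R := ln ((14 * p%:R) ^+ 2 - 2^-1).
(** A lower bound for the probability that a walk from [x] meets some [w l] before leaving the box
    of radius [16 * p]. Spreading [p] poles over [p] levels, instead of using one, keeps the sum of
    order [p] even at the poles; hence the bound inside does not depend on the scale. *)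
Definition psi p (w : nat -> site) x : R :=
  (\sum_(0 <= l < p) (Fp p - qk R (dsite x (w l)))) / (208 * p%:R).
(** Poles are within [4 * p] of the box of radius [2 * p], and [(14 * p) ^+ 2] over
    [2 * (4 * p) ^+ 2] is 196/32, just above 6. *)
Definition c0 : R := ln 6 / 208.

Lemma c0_gt0 : 0 < c0.
Proof. by rewrite divr_gt0 // ln_gt0 //; lra. Qed.

Lemma pk_le z : pk R z <= 2 * (nm z)%:R ^+ 2 + 126^-1.
Proof.
rewrite /pk; case: ifPn => _; first by have := sqr_ge0 ((nm z)%:R : R); lra.
have /andP[_ h] := nm_sq R z; have : 0 < 126^-1 :> R by rewrite invr_gt0. lra.
Qed.

Lemma pk_ge z : (0 < nm z)%N -> (nm z)%:R ^+ 2 - 2^-1 <= pk R z.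
Proof.
move=> h; rewrite /pk ifN; last by rewrite -nm_eq0; lia.
by have /andP[h1 _] := nm_sq R z; lra.
Qed.

Lemma ler1nat p : (0 < p)%N -> 1 <= p%:R :> R.
Proof. by move=> h; rewrite ler1n. Qed.

Section Psi.
Variables (p : nat) (w : nat -> site).
Hypotheses (p0 : (0 < p)%N) (hw : forall l, (l < p)%N -> nm (w l) = (p + 1 + l)%N).

Let p1 : 1 <= p%:R :> R. Proof. exact: ler1nat. Qed.

Lemma Fp_pos : 0 < (14 * p%:R) ^+ 2 - 2^-1 :> R.
Proof. by have : 1 <= p%:R ^+ 2 :> R by [rewrite exprn_ege1]; rewrite exprMn; lra. Qed.

Lemma psi_out x : (16 * p <= nm x)%N -> psi p w x <= 0.
Proof.
move=> hx; rewrite /psi pmulr_lle0 ?invr_gt0 ?mulr_gt0 ?ltr0n //.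
rewrite big_nat_cond; apply: sumr_le0 => l /andP[/andP[_ lp] _].
rewrite subr_le0 ler_ln ?posrE ?pk_gt0 ?Fp_pos //.
have := nm_dist_ge x (w l); rewrite hw // => h.
have hd : (14 * p <= nm (dsite x (w l)))%N by lia.
apply: le_trans (pk_ge _); last lia.
rewrite lerB // lerXn2r ?nnegrE ?mulr_ge0 ?ler0n //.
by rewrite -natrM ler_nat.
Qed.

Lemma psi_in x : (nm x <= 2 * p)%N -> c0 <= psi p w x.
Proof.
move=> hx; rewrite /psi ler_pdivlMr ?mulr_gt0 ?ltr0n //.
have -> : c0 * (208 * p%:R) = \sum_(0 <= l < p) ln 6.
  by rewrite big_const_nat iter_addr addr0 subn0 -[RHS]mulr_natr /c0; field.
apply: ler_sum_nat => l /andP[_ lp].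
have hd := nm_dist x (w l); rewrite hw // in hd.
have hd4 : (nm (dsite x (w l)) <= 4 * p)%N by lia.
have pk4 : pk R (dsite x (w l)) <= 32 * p%:R ^+ 2 + 126^-1.
  apply: le_trans (pk_le _) _; rewrite lerD2r.
  have : ((nm (dsite x (w l)))%:R : R) ^+ 2 <= (4 * p%:R) ^+ 2.
    by rewrite lerXn2r ?nnegrE ?mulr_ge0 ?ler0n // -natrM ler_nat.
  by rewrite exprMn; lra.
rewrite lerBrDr -lnM ?posrE ?pk_gt0 //.
rewrite ler_ln ?posrE ?mulr_gt0 ?pk_gt0 ?Fp_pos //.
have : 1 <= p%:R ^+ 2 :> R by rewrite exprn_ege1.
by rewrite exprMn; lra.
Qed.

(** At level distance [m] a pole contributes at most [4 * ln (13 * sqrt (p / (m + 1)))], because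
    [pk] is at least [(m + 1) ^+ 2 / 126] and [13 ^+ 4 / 126] exceeds 196. By [ln y <= y] and
    [sum_dist] the total is at most [52 * 4 * p], whence 208. *)
Lemma psi_le1 x : psi p w x <= 1.
Proof.
rewrite /psi ler_pdivrMr ?mulr_gt0 ?ltr0n // mul1r.
set sp := Num.sqrt (p%:R : R).
have sp0 : 0 < sp by rewrite sqrtr_gt0 ltr0n.
have sp2 : sp ^+ 2 = p%:R by rewrite sqr_sqrtr ?ler0n.
apply: (@le_trans _ _ (\sum_(0 <= l < p) (52 * sp) *
    (Num.sqrt (`|(nm x)%:Z - (p + 1 + l)%:Z|%N.+1)%:R)^-1)); last first.
  rewrite -mulr_sumr.
  have h := sum_dist R p (p + 1) (nm x).
  apply: (@le_trans _ _ (52 * sp * (4 * sp))).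
    by rewrite ler_pM2l ?mulr_gt0.
  by rewrite -sp2; lra.
apply: ler_sum_nat => l /andP[_ lp].
set m := `|_|%N; set s := Num.sqrt (m.+1)%:R.
have s0 : 0 < s by rewrite sqrtr_gt0 ltr0n.
have s2 : s ^+ 2 = m%:R + 1 by rewrite sqr_sqrtr ?ler0n // -natr1.
have m0 : 0 <= m%:R :> R by [].
have md : (m <= nm (dsite x (w l)))%N.
  by have := nm_dist_ge x (w l); have := nm_dist_ge' x (w l); rewrite hw // /m; lia.
have pkl : (m%:R + 1) ^+ 2 / 126 <= pk R (dsite x (w l)).
  have [m00|mp] := posnP m.
    have -> : m%:R = 0 :> R by rewrite m00.
    rewrite add0r expr1n mul1r /pk; case: ifPn => // /(nm_gt0_sq R).
    have : 126^-1 <= 2^-1 :> R by rewrite lef_pV2 ?posrE //; lra.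
    lra.
  apply: le_trans (pk_ge _); last by apply: leq_trans md.
  have h1 : 1 <= m%:R :> R by rewrite ler1n.
  have h2 : m%:R ^+ 2 <= (nm (dsite x (w l)))%:R ^+ 2 :> R.
    by rewrite lerXn2r ?nnegrE ?ler0n // ler_nat.
  nra.
set y := 13 * (sp / s).
have y0 : 0 < y by rewrite mulr_gt0 ?divr_gt0.
apply: (@le_trans _ _ (4 * ln y)); last first.
  have : ln y <= y by apply: ltW; apply: ln_sublinear.
  by rewrite /y; lra.
have y4 : 0 < y ^+ 4 by rewrite exprn_gt0.
have k0 := @pk_gt0 R (dsite x (w l)).
have yk : 0 < y ^+ 4 * pk R (dsite x (w l)) by rewrite mulr_gt0.
rewrite lerBlDr mulr_natl -lnXn // -lnM ?posrE //.
rewrite ler_ln ?posrE ?Fp_pos //.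
have ym : y ^+ 4 = 13 ^+ 4 * p%:R ^+ 2 / (m%:R + 1) ^+ 2.
  by rewrite -s2 -sp2 /y; field; rewrite gt_eqF.
have m1 : 0 < (m%:R + 1) ^+ 2 :> R by rewrite exprn_gt0 // ltr_wpDl.
apply: (@le_trans _ _ (y ^+ 4 * ((m%:R + 1) ^+ 2 / 126))); last first.
  by rewrite ler_pM2l ?exprn_gt0.
have -> : y ^+ 4 * ((m%:R + 1) ^+ 2 / 126) = (13 ^+ 2 * 13 ^+ 2 / 126) * p%:R ^+ 2.
  by rewrite ym; field; rewrite gt_eqF // ltr_wpDl.
have : 0 <= p%:R ^+ 2 :> R by exact: sqr_ge0.
have -> : 13 ^+ 2 = 169 :> R by rewrite -natrX.
by rewrite exprMn; lra.
Qed.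

Lemma psi_sub x : (forall l, (l < p)%N -> x != w l) ->
  4 * psi p w x <= lap4 (psi p w) x.
Proof.
move=> hx.
have -> : lap4 (psi p w) x =
    (\sum_(0 <= l < p) lap4 (fun z => Fp p - qk R (dsite z (w l))) x) / (208 * p%:R).
  rewrite -lap4_sum.
  exact: (lap4_divr (fun z => \sum_(0 <= l < p) (Fp p - qk R (dsite z (w l)))) _ x).
rewrite /psi mulrA ler_pM2r ?invr_gt0 ?mulr_gt0 ?ltr0n // mulr_sumr.
apply: ler_sum_nat => l /andP[_ lp].
have e : lap4 (fun z => Fp p - qk R (dsite z (w l))) x =
    4 * Fp p - lap4 (qk R) (dsite x (w l)).
  by rewrite -(lap4_shift (qk R)) /lap4; ring.
rewrite e; have := @qk_super R (dsite x (w l)).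
have -> : dsite x (w l) != origin.
  apply: contra (hx l lp) => /eqP; rewrite /dsite /origin => -[h1 h2].
  by apply/eqP; case: x (w l) h1 h2 {hx e} => a b [a' b'] /= h1 h2; congr pair; lia.
by move=> /(_ isT); lra.
Qed.

End Psi.

(* [theta] bounds the probability that the walk reaches the inner box. *)
Definition theta (a n : nat) x : R :=
  (ln (1 + 2 * n%:R ^+ 2) - fk R x) / (ln (1 + 2 * n%:R ^+ 2) - ln (1 + 2 * a%:R ^+ 2)).

Section Theta.
Variables (a n : nat).
Hypotheses (an : (a < n)%N).

Lemma theta_den : 0 < ln (1 + 2 * n%:R ^+ 2) - ln (1 + 2 * a%:R ^+ 2) :> R.
Proof.
have h (k : nat) : 0 < 1 + 2 * k%:R ^+ 2 :> R by have := sqr_ge0 (k%:R : R); lra.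
rewrite subr_gt0 ltr_ln ?posrE // ltrD2l ltr_pM2l // ltrXn2r ?nnegrE ?ler0n //.
  by rewrite ltr_nat.
Qed.

Lemma sq_pos x : 0 < 1 + sq R x.
Proof. by rewrite /sq; have := sqr_ge0 ((x.1)%:~R : R); have := sqr_ge0 ((x.2)%:~R : R); lra. Qed.

Lemma fk_le x k : (nm x <= k)%N -> fk R x <= ln (1 + 2 * k%:R ^+ 2).
Proof.
move=> h; have kk : 0 < 1 + 2 * k%:R ^+ 2 :> R by have := sqr_ge0 (k%:R : R); lra.
rewrite /fk ler_ln ?posrE ?sq_pos // lerD2l.
have /andP[_ le] := nm_sq R x; apply: le_trans le _.
by rewrite ler_pM2l // lerXn2r ?nnegrE ?ler0n // ler_nat.
Qed.

Lemma theta_ge0 x : (nm x <= n)%N -> 0 <= theta a n x.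
Proof. by move=> h; rewrite divr_ge0 ?(ltW theta_den) // subr_ge0 fk_le. Qed.

Lemma theta_ge1 x : (nm x <= a)%N -> 1 <= theta a n x.
Proof.
move=> h; rewrite /theta ler_pdivlMr ?theta_den // mul1r lerB //.
exact: fk_le.
Qed.

Lemma theta_super x : lap4 (theta a n) x <= 4 * theta a n x.
Proof.
rewrite /theta; set D := (X in _ / X); have D0 := theta_den; rewrite -/D in D0.
have -> : lap4 (fun x => (ln (1 + 2 * n%:R ^+ 2) - fk R x) / D) x =
   (4 * ln (1 + 2 * n%:R ^+ 2) - lap4 (fk R) x) / D by rewrite /lap4; ring.
rewrite [leRHS]mulrA ler_pM2r ?invr_gt0 //; have := fk_sub R x; lra.
Qed.

Lemma theta_le x (k : nat) : (k <= nm x)%N ->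
  theta a n x <= (ln (1 + 2 * n%:R ^+ 2) - ln (1 + k%:R ^+ 2)) /
                 (ln (1 + 2 * n%:R ^+ 2) - ln (1 + 2 * a%:R ^+ 2)).
Proof.
move=> h; rewrite /theta ler_pM2r ?invr_gt0 ?theta_den // lerB //.
have kk : 0 < 1 + k%:R ^+ 2 :> R by have := sqr_ge0 (k%:R : R); lra.
rewrite /fk ler_ln ?posrE ?sq_pos // lerD2l.
have /andP[le _] := nm_sq R x; apply: le_trans le.
by rewrite lerXn2r ?nnegrE ?ler0n // ler_nat.
Qed.

End Theta.
End Barriers.

(** * Maximum principle and decay over one scale *)

Section MaxPrinciple.
Variables (R : realType) (T : finType) (E : rel T).

(** The set of maxima in [Y] has an arc leaving it, to a strictly smaller value, which contradicts
    subharmonicity at its tail. *)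
Lemma max_principle (Y : {set T}) (phi : T -> R) :
  (forall v, v \in Y -> (deg E v)%:R * phi v <= \sum_(u | E v u) phi u) ->
  (forall X : {set T}, X \subset Y -> X != set0 ->
     exists2 v, v \in X & exists2 u, E v u & u \notin X) ->
  (forall v u, v \in Y -> E v u -> u \notin Y -> phi u <= 0) ->
  forall v, v \in Y -> phi v <= 0.
Proof.
move=> sub exit bd v0 v0Y; rewrite leNgt; apply/negP => pv0.
have [m mY hm] := @Order.TotalTheory.arg_maxP _ _ _ v0 (mem Y) phi v0Y.
have pm : 0 < phi m by apply: lt_le_trans (hm _ v0Y).
pose X := [set v in Y | phi v == phi m].
have XY : X \subset Y by apply/subsetP => v; rewrite inE => /andP[].
have X0 : X != set0 by apply/set0Pn; exists m; rewrite inE eqxx andbT.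
have [v vX [u Evu uX]] := exit X XY X0.
move: vX; rewrite inE => /andP[vY /eqP pv].
have le w : E v w -> phi w <= phi m.
  move=> Evw; case: (boolP (w \in Y)) => wY; first exact: hm.
  exact: le_trans (bd v w vY Evw wY) (ltW pm).
have lt : phi u < phi m.
  rewrite lt_neqAle le // andbT; case: (boolP (u \in Y)) => uY.
    by move: uX; rewrite inE uY.
  by rewrite lt_eqF // (le_lt_trans (bd v u vY Evu uY)).
have := sub v vY; rewrite pv (bigD1 u) //=; apply/negP; rewrite -ltNge.
have dE : (deg E v)%:R * phi m = phi m + \sum_(w | E v w && (w != u)) phi m.
  rewrite -(bigD1 u (F := fun=> phi m)) // sumr_const mulr_natl; congr (_ *+ _).
  by apply: eq_card => w; rewrite !inE.
by rewrite dE ltr_leD // ler_sum // => w /andP[/le].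
Qed.

End MaxPrinciple.

Section BoxGeometry.
Variables (R : realType) (N : nat).
Implicit Types (v u : V N) (z : site).

Definition nv v := nm (val v).

Lemma mem_boxE z : (z \in box N) = (nm z <= N)%N.
Proof. by rewrite mem_box /nm; apply/idP/idP; lia. Qed.

Lemma nvN v : (nv v <= N)%N.
Proof. by rewrite -mem_boxE; apply: valP. Qed.

Definition at_site z (h : (nm z <= N)%N) : V N := SeqSub (etrans (mem_boxE z) h).

Lemma val_at z (h : (nm z <= N)%N) : val (at_site h) = z. Proof. by []. Qed.

Definition nbrs z : seq site :=
  [:: (z.1 + 1, z.2); (z.1 - 1, z.2); (z.1, z.2 + 1); (z.1, z.2 - 1)].

Lemma adj_nbrs z z' : adj z z' = (z' \in nbrs z).
Proof.
case: z => a b; case: z' => c d; rewrite /adj /nbrs !inE !xpair_eqE /=.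
by apply/idP/idP; lia.
Qed.

Lemma adj_sym : symmetric adj.
Proof. by move=> x y; rewrite /adj; lia. Qed.

Lemma adj_irr : irreflexive adj.
Proof. by move=> x; rewrite /adj; lia. Qed.

Lemma nbrs_uniq z : uniq (nbrs z).
Proof. by case: z => a b; rewrite /= !inE !xpair_eqE /=; lia. Qed.

Lemma adj_nm z z' : adj z z' -> (nm z' <= (nm z).+1)%N.
Proof. by rewrite /adj /nm; lia. Qed.

Lemma perm_nbrs v : (nv v < N)%N ->
  perm_eq [seq z <- map val (enum (V N)) | adj (val v) z] (nbrs (val v)).
Proof.
move=> h; apply: uniq_perm; rewrite ?nbrs_uniq ?filter_uniq //.
  by rewrite (map_inj_uniq val_inj) enum_uniq.
move=> z; rewrite mem_filter adj_nbrs; apply: andb_idr => zn.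
have zN : (nm z <= N)%N.
  by rewrite -adj_nbrs in zn; apply: leq_trans (adj_nm zn) h.
by apply/mapP; exists (at_site zN); rewrite ?mem_enum.
Qed.

Lemma sum_adj (M : nmodType) v (g : site -> M) : (nv v < N)%N ->
  \sum_(u : V N | adj (val v) (val u)) g (val u) = \sum_(z <- nbrs (val v)) g z.
Proof.
move=> h; rewrite -(perm_big _ (perm_nbrs h)) /= big_filter big_map big_enum_cond.
by apply: eq_bigl => u; rewrite inE.
Qed.

Lemma sum_lap v (g : site -> R) : (nv v < N)%N ->
  \sum_(u : V N | adj (val v) (val u)) g (val u) = lap4 g (val v).
Proof. by move=> h; rewrite sum_adj // !big_cons big_nil /lap4 !addrA addr0. Qed.

Definition adjN : rel (V N) := fun v u => adj (val v) (val u).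

Lemma card_adj v : (nv v < N)%N -> #|[set u : V N | adjN v u]| = 4%N.
Proof.
move=> h; rewrite -sum1_card; under eq_bigl => u do rewrite inE.
by rewrite (sum_adj (M := nat) (fun=> 1%N) h) !big_cons big_nil.
Qed.

(** A vertex of [X] with largest first coordinate has its right neighbour outside [X]. *)
Lemma box_exit (E : rel (V N)) (n : nat) (X : {set V N}) : (n <= N)%N ->
  (forall v u, v \in X -> E v u = adjN v u) ->
  (forall v, v \in X -> (nv v < n)%N) -> X != set0 ->
  exists2 v, v \in X & exists2 u, E v u & u \notin X.
Proof.
move=> nN EX Xn /set0Pn[v0 v0X].
have [v vX hv] := @Order.TotalTheory.arg_maxP _ _ _ v0 (mem X) (fun v => (val v).1) v0X.
have hN : (nm ((val v).1 + 1, (val v).2)%R <= N)%N.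
  by apply: leq_trans nN; have := Xn v vX; rewrite /nv /nm /=; lia.
exists v => //; exists (at_site hN).
  by rewrite EX // /adjN val_at adj_nbrs !inE eqxx.
by apply/negP => /hv; rewrite val_at /=; lia.
Qed.

(* One scale of decay outwards: a subharmonic function vanishing on a set that
   meets every level between [p] and [2 p] loses a constant factor. *)
Lemma decay_out (E : rel (V N)) (p : nat) (dead : {set V N}) (u : V N -> R) (M : R) :
  (0 < p)%N -> (16 * p <= N)%N -> 0 <= M ->
  (forall v w, (nv v < 16 * p)%N -> v \notin dead -> E v w = adjN v w) ->
  (forall v, (nv v <= 16 * p)%N -> u v <= M) ->
  (forall v, (nv v < 16 * p)%N -> v \notin dead -> 4 * u v <= \sum_(w | E v w) u w) ->
  (forall v, (nv v < 16 * p)%N -> v \in dead -> u v <= 0) ->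
  (forall l, (p < l <= 2 * p)%N -> exists2 z, z \in dead & nv z = l) ->
  forall v, (nv v <= 2 * p)%N -> u v <= (1 - c0 R) * M.
Proof.
move=> p0 pN M0 hE uM usub udead lev.
have hw (l : nat) : exists z : V N, (l < p)%N -> z \in dead /\ nv z = (p + 1 + l)%N.
  case: (ltnP l p) => lp.
    by have [|z zd zl] := lev (p + 1 + l)%N; [lia | exists z].
  have h0 : (nm origin <= N)%N by [].
  by exists (at_site h0).
have [wz hwz] := choice hw.
pose w l := val (wz l).
have wn l : (l < p)%N -> nm (w l) = (p + 1 + l)%N by move=> /hwz[].
(* The function subtracted from [u] is superharmonic off the poles, which are dead, and at least [M]
   beyond radius [16 * p], where [psi] is nonpositive. *)
pose phi v := u v - M * (1 - psi R p w (val v)).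
pose Y := [set v : V N | (nv v < 16 * p)%N && (v \notin dead)].
have YE v x : v \in Y -> E v x = adjN v x.
  by rewrite inE => /andP[h1 h2]; apply: hE.
have phiY : forall v, v \in Y -> phi v <= 0.
  apply: (@max_principle R _ E) => [v vY|X XY X0|v x vY Evx xY].
  - have := vY; rewrite inE => /andP[vn vd].
    have -> : deg E v = 4%N.
      rewrite -(card_adj (v := v)); last exact: leq_trans vn pN.
      by rewrite /deg /nb; apply: eq_card => x; rewrite !inE (YE v x vY).
    rewrite /phi big_split /= sumrN -mulr_sumr.
    have eE : (fun x => E v x) =1 adjN v by move=> x; apply: YE.
    rewrite [X in _ <= _ - _ * X](eq_bigl _ _ eE) (sum_lap (fun z => 1 - psi R p w z)); last exact: leq_trans vn pN.
    have := usub v vn vd.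
    have : 4 * psi R p w (val v) <= lap4 (psi R p w) (val v).
      apply: psi_sub => // l lp; apply: contraNneq vd => e.
      by have [wd _] := hwz l lp; rewrite (val_inj e).
    have -> : lap4 (fun z => 1 - psi R p w z) (val v) = 4 - lap4 (psi R p w) (val v).
      by rewrite /lap4; ring.
    nra.
  - apply: (box_exit pN) => // [v x vX|v vX]; first by rewrite YE // (subsetP XY).
    by have := subsetP XY v vX; rewrite inE => /andP[].
  have xn : (nv x <= 16 * p)%N.
    move: (vY); rewrite inE => /andP[vn _]; apply: leq_trans vn.
    by apply: adj_nm; rewrite -/(adjN v x) -YE.
  rewrite /phi subr_le0; move: xY; rewrite inE negb_and negbK -leqNgt => /orP[xb|xd].
    apply: le_trans (uM x xn) _; rewrite ler_peMr // lerBrDr gerDl.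
    exact: psi_out.
  have [xb|xb] := leqP (16 * p) (nv x).
    apply: le_trans (uM x xn) _; rewrite ler_peMr // lerBrDr gerDl.
    exact: psi_out.
  apply: le_trans (udead x xb xd) _; rewrite mulr_ge0 // subr_ge0.
  exact: psi_le1.
move=> v vp; have vb : (nv v < 16 * p)%N by lia.
have pin : c0 R <= psi R p w (val v) by apply: psi_in.
have := psi_le1 R p0 wn (val v) => ple.
case: (boolP (v \in dead)) => vd.
  apply: le_trans (udead v vb vd) _; rewrite mulr_ge0 // subr_ge0.
  exact: le_trans pin ple.
have : phi v <= 0 by apply: phiY; rewrite inE vb vd.
rewrite /phi subr_le0 => h; apply: le_trans h _.
by rewrite mulrC ler_wpM2r // lerB.
Qed.

(* One scale of decay inwards; [Lam] is large enough that the walk rarely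
   reaches the box of radius [a] before leaving that of radius [16 p]. *)
Lemma decay_in (E : rel (V N)) (A : {set V N}) (a p : nat) (u : V N -> R) (M : R) :
  (0 < p)%N -> (a < 2 * p)%N -> (16 * p <= N)%N -> 0 <= M ->
  (forall x : site, nm x = (2 * p)%N -> theta R a (16 * p) x <= c0 R / 2) ->
  (forall v w, v \in A -> E v w -> adjN v w) ->
  (forall v w, v \in A -> (a < nv v < 16 * p)%N -> E v w = adjN v w) ->
  (forall X : {set V N}, X \subset A -> X != set0 ->
     exists2 v, v \in X & exists2 w, E v w & w \notin X) ->
  (forall v, (a <= nv v)%N -> u v <= M) ->
  (forall v, v \in A -> (a < nv v)%N -> (deg E v)%:R * u v <= \sum_(w | E v w) u w) ->
  (forall v, v \notin A -> (a < nv v)%N -> u v <= 0) ->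
  (forall l, (p < l <= 2 * p)%N -> exists2 z, z \notin A & nv z = l) ->
  forall v, (2 * p <= nv v)%N -> u v <= (1 - c0 R / 2) * M.
Proof.
move=> p0 ap pN M0 hth hadj hE exit uM usub udead lev.
have hw (l : nat) : exists z : V N, (l < p)%N -> z \notin A /\ nv z = (p + 1 + l)%N.
  case: (ltnP l p) => lp.
    by have [|z zd zl] := lev (p + 1 + l)%N; [lia | exists z].
  have h0 : (nm origin <= N)%N by [].
  by exists (at_site h0).
have [wz hwz] := choice hw.
pose w l := val (wz l).
have wn l : (l < p)%N -> nm (w l) = (p + 1 + l)%N by move=> /hwz[].
have an : (a < 16 * p)%N by lia.
(* [theta] is at least 1 on the inner box, where nothing is known about dead vertices, and at most
   half of [c0] at radius [2 * p]; so half of the gain from [psi] survives. *)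
pose g x := 1 - psi R p w x + theta R a (16 * p) x.
pose phi v := u v - M * g (val v).
pose Y := [set v in A | a < nv v < 16 * p]%N.
have YA : Y \subset A by apply/subsetP => v; rewrite inE => /andP[].
have phiY : forall v, v \in Y -> phi v <= 0.
  apply: (@max_principle R _ E) => [v vY|X XY X0|v x vY Evx xY].
  - have := vY; rewrite inE => /andP[vA vn].
    have vN : (nv v < N)%N by case/andP: vn => _ h; apply: leq_trans h pN.
    have d4 : deg E v = 4%N.
      rewrite -(card_adj vN).
      by rewrite /deg /nb; apply: eq_card => x; rewrite !inE hE.
    rewrite d4 /phi big_split /= sumrN -mulr_sumr.
    have eE : (fun x => E v x) =1 adjN v by move=> x; apply: hE.
    rewrite [X in _ <= _ - _ * X](eq_bigl _ _ eE) (sum_lap g vN).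
    have := usub v vA; rewrite d4; case/andP: (vn) => va _ /(_ va).
    have : 4 * psi R p w (val v) <= lap4 (psi R p w) (val v).
      apply: psi_sub => // l lp; apply: contraTneq vA => e.
      by have [wd _] := hwz l lp; rewrite (val_inj e).
    have := theta_super R an (val v).
    have -> : lap4 g (val v) = 4 - lap4 (psi R p w) (val v) +
        lap4 (theta R a (16 * p)) (val v) by rewrite /lap4 /g; ring.
    rewrite /g; nra.
  - by apply: exit => //; apply: subset_trans YA.
  have vA := subsetP YA v vY; have vxa := hadj v x vA Evx.
  move: (vY); rewrite inE => /andP[_ /andP[va vn]].
  have xn : (nv x <= 16 * p)%N by apply: leq_trans vn; apply: adj_nm.
  have xa : (a <= nv x)%N.
    by rewrite -ltnS; apply: leq_trans va _; apply: adj_nm; rewrite adj_sym.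
  have th0 : 0 <= theta R a (16 * p) (val x) by apply: theta_ge0.
  have ps1 := psi_le1 R p0 wn (val x).
  rewrite /phi subr_le0; have [xb|xb] := leqP (16 * p) (nv x).
    apply: le_trans (uM x xa) _; rewrite ler_peMr // /g.
    by have := psi_out R p0 wn xb; lra.
  have [xe|xe] := leqP (nv x) a.
    apply: le_trans (uM x xa) _; rewrite ler_peMr // /g.
    by have := theta_ge1 R an xe; lra.
  have xA : x \notin A by move: xY; rewrite inE xb xe /= !andbT.
  by apply: le_trans (udead x xA xe) _; rewrite mulr_ge0 // /g; lra.
have M' : 0 <= (1 - c0 R / 2) * M.
  rewrite mulr_ge0 // subr_ge0 ler_pdivrMr // mul1r.
  have h0 : (nm origin <= 2 * p)%N by [].
  by have := psi_in R p0 wn h0; have := psi_le1 R p0 wn origin; lra.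
have mid v : nv v = (2 * p)%N -> u v <= (1 - c0 R / 2) * M.
  move=> vp; case: (boolP (v \in A)) => vA; last first.
    by apply: le_trans M'; apply: udead => //; rewrite vp.
  have : phi v <= 0 by apply: phiY; rewrite inE vA vp ap /=; lia.
  rewrite /phi subr_le0 => h; apply: le_trans h _.
  rewrite mulrC ler_wpM2r // /g.
  have := hth _ vp; have : (nm (val v) <= 2 * p)%N by rewrite -/(nv v) vp.
  by move=> /(psi_in R p0 wn); lra.
move=> v; rewrite leq_eqVlt => /orP[/eqP/esym/mid//|vp].
case: (boolP (v \in A)) => vA; last first.
  by apply: le_trans M'; apply: udead => //; lia.
(* Beyond radius [2 * p] a constant is the barrier: the boundary consists of the level [2 * p],
   already treated, and of dead vertices. *)
pose Z := [set v in A | 2 * p < nv v]%N.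
suff : forall v, v \in Z -> u v - (1 - c0 R / 2) * M <= 0.
  by move=> /(_ v); rewrite inE vA vp => /(_ isT); rewrite subr_le0.
apply: (@max_principle R _ E) => [x|X XZ X0|x y].
- rewrite inE => /andP[xA xn]; rewrite big_split /= sumr_const mulrBr.
  have -> : - ((1 - c0 R / 2) * M) *+ #|E x| = - ((deg E x)%:R * ((1 - c0 R / 2) * M)).
    rewrite mulNrn mulr_natl; congr (- (_ *+ _)).
    by apply: eq_card => y; rewrite !inE.
  by rewrite lerB // usub //; lia.
- by apply: exit => //; apply: subset_trans XZ _; apply/subsetP => y; rewrite inE => /andP[].
rewrite !inE => /andP[xA xn] Exy; rewrite subr_le0.
have xy := hadj x y xA Exy.
have yn : (2 * p <= nv y)%N.
  by rewrite -ltnS; apply: leq_trans xn _; apply: adj_nm; rewrite adj_sym.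
rewrite negb_and -leqNgt => /orP[yA|yn']; last by apply: mid; lia.
move: yn; rewrite leq_eqVlt => /orP[/eqP/esym/mid//|yn].
by apply: le_trans M'; apply: udead => //; lia.
Qed.

End BoxGeometry.

(** * Detours of forest paths *)

Section BadForests.
Variable T : finType.
Implicit Types (E : rel T) (A B R S : {set T}) (y u : T) (F : {ffun T -> T}).

Definition nbad E A B R y := #|[set F in forest E A | ~~ good A B R F y]|.

Lemma nbad_good E A B R y :
  (nbad E A B R y + #|[set F in forest E A | good A B R F y]| = #|forest E A|)%N.
Proof.
rewrite /nbad addnC -(cardsID [set F | good A B R F y] (forest E A)).
by congr addn; apply: eq_card => F; rewrite !inE // andbC.
Qed.

Lemma nbad_le E A B R y : (nbad E A B R y <= #|forest E A|)%N.
Proof. by rewrite -(nbad_good E A B R y) leq_addr. Qed.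

Lemma nbad_subharmonic E A B R y : y \in A -> y \in B ->
  (deg E y * nbad E A B R y <= \sum_(u | E y u) nbad E A B R u)%N.
Proof.
move=> yA yB; have := @good_superharmonic _ E A B R y yA yB.
have : (\sum_(u | E y u) #|[set F in forest E A | good A B R F u]| +
  \sum_(u | E y u) nbad E A B R u = deg E y * #|forest E A|)%N.
  rewrite -big_split /= (eq_bigr (fun=> #|forest E A|)); last first.
    by move=> u _; rewrite addnC nbad_good.
  by rewrite sum_nat_cond_const; congr (_ * _)%N; apply: eq_card => u; rewrite !inE.
rewrite -(nbad_good E A B R y) mulnDr; lia.
Qed.

Lemma nbad_dead E A B R y : y \notin A -> nbad E A B R y = ((y \notin R) * #|forest E A|)%N.
Proof.
move=> yA; rewrite /nbad; have gE F : F \in forest E A -> good A B R F y = (y \in R).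
  move=> /forestP[_ h _]; have c x : fconnect F y x = (x == y) by apply: conn_dead; apply: h.
  apply/goodP/idP => [[[z [zR _ +]] _]|yR]; first by rewrite c => /eqP <-.
  by split=> [|x]; [exists y | rewrite c => /eqP ->; rewrite (negbTE yA)].
case: (boolP (y \in R)) => yR; rewrite ?mul0n ?mul1n.
  by apply/eqP; rewrite cards_eq0; apply/eqP/setP => F; rewrite !inE;
    apply/negP => /andP[/gE ->]; rewrite yR.
apply: eq_card => F; rewrite inE; apply: andb_idr => /gE ->.
exact: yR.
Qed.

(** The path from [w] meets the path of [z] first at [z] itself: an earlier common vertex would lie
    on a cycle. *)
Lemma conn_cutP_back E A F w z : F \in forest E A -> fconnect F w z ->
  fconnect (cutP (path_set A F z) F) w z.
Proof.
move=> Ff /fconnectP[n ->]; elim: n w => [|n IH] w; first exact: connect0.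
have [wP|wP] := boolP (w \in path_set A F (iter n.+1 F w)).
  move: wP; rewrite inE => /andP[_ zw].
  by rewrite -(forest_antisym Ff (fconnect_iter _ _ _) zw).
apply: connect_trans (_ : fconnect _ w (F w)) _.
  by rewrite fconnect_eqVf ffunE (negbTE wP) connect0 orbT.
by rewrite iterSr; apply: IH.
Qed.

(** By [card_burn_good], the forest counterpart of [x] burning from [o], but not when the fire is
    confined to [B]. *)
Definition escapes A B o x F := good A setT [set o] F x && ~~ good A B [set o] F x.

Lemma escapesP A B o x F : o \notin A ->
  reflect (fconnect F x o /\ exists z, [/\ fconnect F x z, z \in A & z \notin B])
    (escapes A B o x F).
Proof.
move=> oA; apply: (iffP andP) => [[/goodP[[z [/set1P -> _ xo]] _] ng]|[xo [z [xz zA zB]]]].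
  split=> //; move: ng; rewrite /good negb_and => /orP[/negP[]|].
    by apply/existsP; exists o; rewrite inE eqxx oA.
  rewrite negb_forall => /existsP[y]; rewrite negb_imply.
  by move=> /andP[/andP[? ?] ?]; exists y.
split; first by apply/goodP; split=> [|? _ _]; [exists o; rewrite inE eqxx oA | rewrite inE].
by apply/goodP => -[_ /(_ z xz zA)]; rewrite (negbTE zB).
Qed.

Lemma key_conn E A z F F0 y : F \in forest E A -> F0 \in forest E A ->
  key A z F = key A z F0 -> fconnect F z y = fconnect F0 z y.
Proof.
move=> Ff F0f k.
have half G G' : G \in forest E A -> G' \in forest E A ->
    key A z G = key A z G' -> fconnect G' z y -> fconnect G z y.
  move=> Gf G'f /key_eq[_ e] /fconnectP[n ->].
  suff : fconnect G z (iter n G' z) by [].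
  elim: n => [|n IH] //=.
  have [nA|nA] := boolP (iter n G' z \in A); last first.
    by have /forestP[_ d _] := G'f; rewrite d.
  by rewrite -e ?inE ?nA ?fconnect_iter //; apply: connect_trans IH (fconnect1 _ _).
by apply/idP/idP; apply: half.
Qed.

Lemma key_escapes E A B o z F F0 : o \notin A ->
  F \in forest E A -> F0 \in forest E A ->
  key A z F = key A z F0 -> escapes A B o z F = escapes A B o z F0.
Proof.
move=> oA Ff F0f k.
apply/idP/idP => /(escapesP B z _ oA)[zo [y [zy yA yB]]];
  apply/(escapesP B z _ oA);
  by (split; last exists y); rewrite ?(key_conn _ Ff F0f k) // -?(key_conn _ Ff F0f k).
Qed.

(** With the path of [z] turned into roots, the path of [w] passes through [z] only if [w] is rooted
    at [z]; for the root set [~: [set z]] this is a bad event. *)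
Lemma card_key_root E A F0 z w : F0 \in forest E A ->
  (#|[set F in forest E A | (key A z F == key A z F0) && fconnect F w z]| <=
   nbad E (A :\: path_set A F0 z) setT (~: [set z]) w)%N.
Proof.
move=> F0f; set P := path_set A F0 z; rewrite /nbad.
rewrite -(card_fiber z F0f (fun F => ~~ good (A :\: P) setT (~: [set z]) F w)).
apply/subset_leq_card/subsetP => F; rewrite !inE => /andP[Ff /andP[kF wz]].
rewrite Ff kF /=; apply/goodP => -[[y [+ yA wy]] _]; rewrite inE => /negP[].
rewrite inE; have /eqP/key_eq[pe _] := kF.
have := conn_cutP_back Ff wz; rewrite pe -/P => wz'.
have Fz : cutP P F z = z.
  rewrite ffunE; case: ifP => // /negbT zP; have /forestP[_ F_dead _] := Ff.
  by apply: F_dead; apply: contra zP => zA; rewrite inE zA connect0.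
have Fy : cutP P F y = y.
  by have /forestP[_ F_dead _] := forest_cutP z F0f Ff; exact: F_dead.
by rewrite (conn_fix2 Fz Fy wz' wy).
Qed.

Lemma forest_leave E A G (X : {set T}) : G \in forest E A -> X \subset A -> X != set0 ->
  exists2 v, v \in X & exists2 u, E v u & u \notin X.
Proof.
move=> /forestP[h1 _ h3] XA /set0Pn[v vX]; have [y yA /fconnectP[n yn]] := h3 v.
have yX : iter n G v \notin X by rewrite -yn; apply: contra yA; apply: (subsetP XA).
elim: n v vX yX {yn} => [|n IH] v vX; first by rewrite vX.
rewrite iterSr; have [GX|GX _] := boolP (G v \in X); first exact: IH.
by exists v => //; exists (G v) => //; apply: h1; apply: (subsetP XA).
Qed.

Lemma cutP_dead E A F w y : F \in forest E A -> y \notin A :\: path_set A F w ->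
  cutP (path_set A F w) F y = y.
Proof.
by move=> Ff yP; have /forestP[_ d _] := forest_cutP w Ff Ff; apply: d.
Qed.

Lemma conn_split E A F x y o : F \in forest E A -> o \notin A ->
  fconnect F x y -> fconnect F x o -> fconnect F y o.
Proof.
move=> /forestP[_ d _] oA xy xo; case/orP: (conn_linear xy xo) => //.
by rewrite conn_dead ?d // => /eqP ->; apply: connect0.
Qed.

(** Paths with different roots never meet, so cutting the path of [w] leaves the path of [x], with
    its excursion out of [B], unchanged. *)
Lemma escapes_other E A B o F w x : o \notin A -> F \in forest E A ->
  ~~ fconnect F w o -> escapes A B o x F ->
  ~~ good (A :\: path_set A F w) B setT (cutP (path_set A F w) F) x.
Proof.
set P := path_set A F w => oA Ff wo /(escapesP _ _ _ oA)[xo [z [xz zA zB]]].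
have nP y : fconnect F x y -> y \notin P.
  move=> xy; apply: contra wo; rewrite inE => /andP[_ wy].
  by apply: connect_trans wy _; apply: conn_split Ff oA xy xo.
apply/goodP => -[[y [_ yA xy]] hB].
have yP := nP y (conn_cutP_sub xy).
have yA' : y \notin A by move: yA; rewrite inE yP.
have := xz; rewrite (conn_cutP z (cutP_dead Ff yA) xy) => /orP[xz'|].
  by have := hB z xz'; rewrite inE zA nP // (negbTE zB) => /(_ isT).
have /forestP[_ d _] := Ff; rewrite conn_dead ?d // => /eqP zy.
by rewrite zy (negbTE yA') in zA.
Qed.

(** In the cut forest the path of [x] ends at some [y] of [S] without leaving [S]. The excursion out
    of [B] therefore comes after [y], so [y] lies on the path of [w] and escapes itself. *)
Lemma escapes_same E A B S o F w x : o \notin A -> F \in forest E A -> S \subset B ->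
  escapes A B o x F ->
  good (A :\: path_set A F w) S S (cutP (path_set A F w) F) x ->
  exists2 y, y \in S & escapes A B o y F && fconnect F w y.
Proof.
set P := path_set A F w => oA Ff SB /(escapesP _ _ _ oA)[xo [z [xz zA zB]]].
move=> /goodP[[y [yS yA xy]] hS]; exists y => //.
have zS : z \notin S by apply: contra zB; apply: (subsetP SB).
have Fy := cutP_dead Ff yA.
have yz : fconnect F y z.
  have := xz; rewrite (conn_cutP z Fy xy) => /orP[xz'|//].
  have [zP|zP] := boolP (z \in A :\: P).
    by have := hS z xz' zP; rewrite (negbTE zS).
  by rewrite (conn_fix2 Fy (cutP_dead Ff zP) xy xz') connect0.
have yA' : y \in A.
  apply: contraTT zA => yA'; have /forestP[_ d _] := Ff.
  by move: yz; rewrite conn_dead ?d // => /eqP ->.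
have -> : fconnect F w y by move: yA; rewrite !inE yA' andbT negbK.
rewrite andbT; apply/(escapesP _ _ _ oA); split; last by exists z.
exact: conn_split Ff oA (conn_cutP_sub xy) xo.
Qed.

End BadForests.

(** * Detours across several scales *)

Section ScaleBound.
Variables (R : realType) (h : nat).
Hypothesis h8 : (8 <= h)%N.
Let Lam := (2 * h)%N.
Hypothesis hth : forall a x, (0 < a)%N -> nm x = (Lam * a)%N ->
  theta R a (8 * Lam * a) x <= c0 R / 2.
Let lam : R := 1 - c0 R / 2.

Variables (N rho : nat) (D : {set V N}) (o : V N) (E : rel (V N)).
Hypotheses (rhoN : (rho < N)%N) (oo : val o = origin).
Hypothesis rhoD : forall v, (nv v <= rho)%N -> v \in D.
Hypothesis ED : forall v u, E v u = [&& v \in D, adjN v u & (u \in D) || (nv v <= rho)%N].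
Let A := D :\ o.

Definition ball (r : nat) : {set V N} := [set v | (nv v <= r)%N].

Lemma nvo : nv o = 0%N. Proof. by rewrite /nv oo. Qed.

Lemma E_in v u : (nv v <= rho)%N -> E v u = adjN v u.
Proof. by move=> vr; rewrite ED rhoD // vr orbT andbT. Qed.

Lemma E_adj v u : E v u -> adjN v u.
Proof. by rewrite ED => /and3P[]. Qed.

Lemma lam_ge0 : 0 <= lam.
Proof.
have hw (k : nat) : (k < 1)%N -> nm ((2, 0) : site) = (1 + 1 + k)%N by case: k.
have := psi_in R (isT : (0 < 1)%N) hw (isT : (nm origin <= 2 * 1)%N).
have := psi_le1 R (isT : (0 < 1)%N) hw origin.
by have := c0_gt0 R; rewrite /lam; lra.
Qed.

Lemma Lam_gt0 j : (0 < Lam ^ j)%N.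
Proof. by rewrite expn_gt0 /Lam muln_gt0 (leq_trans _ h8). Qed.

Lemma Lam_le i j : (i <= j)%N -> (Lam ^ i <= Lam ^ j)%N.
Proof. by move=> ij; rewrite leq_exp2l // /Lam; lia. Qed.

Lemma out_iter (dead : {set V N}) (u : V N -> R) (M : R) i d :
  (Lam ^ (i + d) <= rho)%N -> 0 <= M ->
  (forall v, (nv v < Lam ^ (i + d))%N -> v \notin dead ->
     4 * u v <= \sum_(w | E v w) u w) ->
  (forall v, (nv v < Lam ^ (i + d))%N -> v \in dead -> u v <= 0) ->
  (forall l, (Lam ^ i < l <= Lam ^ (i + d))%N -> exists2 z, z \in dead & nv z = l) ->
  (forall v, (nv v <= Lam ^ (i + d))%N -> u v <= M) ->
  forall v, (nv v <= Lam ^ i)%N -> u v <= lam ^+ d * M.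
Proof.
elim: d M => [|d IH] M; first by rewrite addn0 expr0 mul1r.
rewrite addnS => rr M0 us ud lev uM v vi; rewrite exprSr -mulrA.
have L16 : (16 * Lam ^ (i + d) <= Lam ^ (i + d).+1)%N.
  by rewrite expnS leq_mul2r; apply/orP; right; rewrite /Lam; lia.
have hid : (Lam ^ i <= Lam ^ (i + d))%N by rewrite Lam_le // leq_addr.
have p0 := Lam_gt0 (i + d).
apply: IH vi => //; first by apply: leq_trans rr; lia.
- by rewrite mulr_ge0 // lam_ge0.
- by move=> x xl; apply: us; lia.
- by move=> x xl; apply: ud; lia.
- by move=> l hl; apply: lev; lia.
move=> x xl.
have : u x <= (1 - c0 R) * M.
  apply: (@decay_out R N E (Lam ^ (i + d)) dead u M) => // [|y w yl _|y yl|y yl|y yl|l hl|].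
  - by lia.
  - by apply: E_in; lia.
  - by apply: uM; lia.
  - by apply: us; lia.
  - by apply: ud; lia.
  - by apply: lev; lia.
  by lia.
move/le_trans; apply; rewrite ler_wpM2r // /lam.
by have := c0_gt0 R; lra.
Qed.

(** One use of [decay_in] per factor [Lam], with inner radius [a] a power of [Lam] and [p = h * a],
    so that [2 * p] is the next power. *)
Lemma in_iter (Al : {set V N}) (u : V N -> R) (M : R) i d :
  (Lam ^ (i + d).+1 <= rho)%N -> 0 <= M -> Al \subset A ->
  (forall X : {set V N}, X \subset Al -> X != set0 ->
     exists2 v, v \in X & exists2 w, E v w & w \notin X) ->
  (forall v, v \in Al -> (Lam ^ i < nv v)%N ->
     (deg E v)%:R * u v <= \sum_(w | E v w) u w) ->
  (forall v, v \notin Al -> (Lam ^ i < nv v)%N -> u v <= 0) ->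
  (forall l, (Lam ^ i < l <= Lam ^ (i + d))%N -> exists2 z, z \notin Al & nv z = l) ->
  (forall v, u v <= M) ->
  forall v, (Lam ^ (i + d) <= nv v)%N -> u v <= lam ^+ d * M.
Proof.
move=> rr M0 AlA ex us ud lev uM.
elim: d rr lev => [|d IH] rr lev v; first by rewrite expr0 mul1r.
rewrite exprS -mulrA addnS => vi.
move: rr lev; rewrite addnS => rr lev.
have hid : (Lam ^ i <= Lam ^ (i + d))%N by rewrite Lam_le // leq_addr.
have a0 := Lam_gt0 (i + d).
have pE : (Lam ^ (i + d).+1 = 2 * (h * Lam ^ (i + d)))%N by rewrite expnS mulnA.
have pr : (16 * (h * Lam ^ (i + d)) <= rho)%N.
  apply: leq_trans rr; rewrite (expnS _ (i + d).+1) pE [leqRHS]mulnA leq_mul2r.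
  by apply/orP; right; rewrite /Lam; lia.
have hp : (8 * Lam ^ (i + d) <= h * Lam ^ (i + d))%N by rewrite leq_mul2r h8 orbT.
apply: (@decay_in R N E Al (Lam ^ (i + d)) (h * Lam ^ (i + d))) => //.
- by lia.
- by lia.
- by lia.
- by rewrite mulr_ge0 // exprn_ge0 // lam_ge0.
- move=> x xe.
  have <- : (8 * Lam * Lam ^ (i + d) = 16 * (h * Lam ^ (i + d)))%N.
    by rewrite mulnA; congr (_ * _)%N; rewrite /Lam; lia.
  by apply: hth => //; rewrite xe mulnA.
- by move=> x w _; apply: E_adj.
- by move=> x w _ hx; apply: E_in; lia.
- move=> x; apply: IH => [|l hl]; last by apply: lev; lia.
  by apply: leq_trans rr; rewrite Lam_le.
- by move=> x xA xl; apply: us => //; lia.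
- by move=> x xA xl; apply: ud => //; lia.
- by move=> l hl; apply: lev; lia.
by rewrite -pE.
Qed.

(** Discrete intermediate values: the norm changes by at most one along a step. *)
Lemma fconnect_level (F : {ffun V N -> V N}) v x l :
  (forall y, F y = y \/ adjN y (F y)) -> fconnect F v x ->
  (nv v <= l <= nv x)%N || (nv x <= l <= nv v)%N ->
  exists2 z, fconnect F v z & nv z = l.
Proof.
move=> Fa /fconnectP[n ->]; elim: n v => [|n IH] v /=.
  by move=> hl; exists v => //; lia.
rewrite -iterS iterSr => hl.
have [e|ne] := eqVneq (nv v) l; first by exists v.
have st : (nv v <= (nv (F v)).+1)%N /\ (nv (F v) <= (nv v).+1)%N.
  case: (Fa v) => [->|av]; first by lia.
  by split; apply: adj_nm; rewrite // adj_sym.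
have [|z zc zl] := IH (F v).
  move: hl st; rewrite neq_ltn in ne.
  by move: (nv (iter n F (F v))) (nv (F v)) (nv v) ne => a b c; lia.
by exists z => //; apply: connect_trans zc; apply: fconnect1.
Qed.

Lemma forest_step B F : F \in forest E B -> forall y, F y = y \/ adjN y (F y).
Proof.
move=> /forestP[h1 h2 _] y; have [yB|yB] := boolP (y \in B); last by left; apply: h2.
by right; apply: E_adj; apply: h1.
Qed.

Lemma deg_in v : (nv v <= rho)%N -> deg E v = 4%N.
Proof.
move=> vr; rewrite -(card_adj (v := v)); last exact: leq_ltn_trans vr rhoN.
by rewrite /deg /nb; apply: eq_card => u; rewrite !inE E_in.
Qed.

(** Condition on the path of [z]. Since it escapes, it meets every level between the two scales, and
    the path of [w] has to avoid all of it in order to be rooted at [z]. *)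
Lemma escapes_path (t : nat) z i d : (Lam ^ (i + d).+1 <= rho)%N ->
  (Lam ^ (i + d) <= t)%N -> (nv z <= Lam ^ i)%N ->
  forall w, nv w = (Lam ^ (i + d))%N ->
  #|[set F in forest E A | escapes A (ball t) o z F && fconnect F w z]|%:R <=
     lam ^+ d * #|forest E A|%:R.
Proof.
move=> rr tt zi w wn.
have oA : o \notin A by rewrite !inE eqxx.
apply: (@fiber_bound _ R E A z (escapes A (ball t) o z) (fun F => fconnect F w z)).
- by rewrite exprn_ge0 // lam_ge0.
- move=> F0 F0f /(escapesP _ _ _ oA)[zo [x [zx xA xt]]].
  have := card_key_root z w F0f; rewrite -(ler_nat R) => /le_trans; apply.
  set P := path_set A F0 z.
  have [f0|/set0Pn[G Gf]] := eqVneq (forest E (A :\: P)) set0.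
    have := nbad_le E (A :\: P) setT (~: [set z]) w.
    by rewrite f0 cards0 leqn0 => /eqP ->; rewrite mulr0.
  apply: (@in_iter (A :\: P) (fun v => (nbad E (A :\: P) setT (~: [set z]) v)%:R) _ i d) => //.
  - exact: finset.subsetDl.
  - by move=> X; apply: forest_leave Gf.
  - move=> v vA _; rewrite -natr_sum -natrM ler_nat; exact: nbad_subharmonic.
  - move=> v vA vi; rewrite nbad_dead // !inE negbK.
    by rewrite (_ : v == z = false) ?mul0n //; apply/negP => /eqP e;
      rewrite e ltnNge zi in vi.
  - move=> l hl; have [||y zy yl] := @fconnect_level F0 z x l _ zx.
    + exact: forest_step F0f.
    + by move: xt; rewrite inE; lia.
    by exists y => //; rewrite !inE zy andbT andNb.
  - by move=> v; rewrite ler_nat nbad_le.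
  by rewrite wn.
move=> F F0 Ff F0f k; exact: key_escapes oA Ff F0f k.
Qed.

(** Condition on the path of [w]. As it does not end in [o], it leaves the box of radius [rho] and
    obstructs every level the path of [x] has to cross. *)
Lemma escapes_far i d x w : (Lam ^ (i + d) <= rho)%N ->
  nv w = (Lam ^ i)%N -> (nv x <= Lam ^ i)%N ->
  #|[set F in forest E A | ~~ fconnect F w o && escapes A (ball (Lam ^ (i + d))) o x F]|%:R
    <= lam ^+ d * #|forest E A|%:R.
Proof.
move=> rr wn xn; set t := (Lam ^ (i + d))%N.
have oA : o \notin A by rewrite !inE eqxx.
apply: (@fiber_bound _ R E A w (fun F => ~~ fconnect F w o) (escapes A (ball t) o x)).
- by rewrite exprn_ge0 // lam_ge0.
- move=> F0 F0f wo; set P := path_set A F0 w.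
  apply: (@le_trans _ _ (nbad E (A :\: P) (ball t) setT x)%:R).
    rewrite ler_nat /nbad.
    rewrite -(card_fiber w F0f (fun F => ~~ good (A :\: P) (ball t) setT F x)).
    apply/subset_leq_card/subsetP => F; rewrite !inE => /and3P[Ff kF ex].
    rewrite Ff kF /=; have /eqP/key_eq[pe _] := kF.
    rewrite /P -pe; apply: (escapes_other oA Ff _ ex).
    by rewrite (key_conn _ Ff F0f (eqP kF)).
  apply: (@out_iter (~: (A :\: P)) (fun v => (nbad E (A :\: P) (ball t) setT v)%:R) _ i d) => //.
  - move=> v vt; rewrite inE negbK => vA.
    have vr : (nv v <= rho)%N by apply: leq_trans rr; apply: ltnW.
    rewrite -natr_sum -[4]/(4%:R) -natrM ler_nat -(deg_in vr).
    by apply: nbad_subharmonic => //; rewrite inE ltnW.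
  - by move=> v _; rewrite inE => vA; rewrite nbad_dead // inE.
  - move=> l hl; have /forestP[_ d0 /(_ w)[z zA wz]] := F0f.
    have zr : (rho < nv z)%N.
      rewrite ltnNge; apply: contra wo => zr.
      by move: zA wz; rewrite !inE rhoD // andbT negbK => /eqP ->.
    have [||y wy yl] := @fconnect_level F0 w z l _ wz.
    + exact: forest_step F0f.
    + by rewrite wn; lia.
    by exists y => //; rewrite !inE wy andbT; case: (y == o); case: (y \in D).
  by move=> v _; rewrite ler_nat nbad_le.
by move=> F F0 Ff F0f k; rewrite (key_conn _ Ff F0f k).
Qed.

(** Here the path of [w] comes from beyond [Lam ^ (i + d)] and ends in [o], so it too meets every
    level; the path of [x] rarely leaves the ball before touching it. *)
Lemma escapes_near i d x w : (Lam ^ (i + d) <= rho)%N ->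
  (Lam ^ (i + d) <= nv w)%N -> (nv x <= Lam ^ i)%N ->
  #|[set F in forest E A | fconnect F w o &&
     ~~ good (A :\: path_set A F w) (ball (Lam ^ (i + d))) (ball (Lam ^ (i + d)))
        (cutP (path_set A F w) F) x]|%:R
    <= lam ^+ d * #|forest E A|%:R.
Proof.
move=> rr wn xn; set S := ball (Lam ^ (i + d))%N.
apply: (@fiber_bound _ R E A w (fun F => fconnect F w o)
  (fun F => ~~ good (A :\: path_set A F w) S S (cutP (path_set A F w) F) x)).
- by rewrite exprn_ge0 // lam_ge0.
- move=> F0 F0f wo; set P := path_set A F0 w.
  apply: (@le_trans _ _ (nbad E (A :\: P) S S x)%:R).
    rewrite ler_nat /nbad.
    rewrite -(card_fiber w F0f (fun F => ~~ good (A :\: P) S S F x)).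
    apply/subset_leq_card/subsetP => F /setIdP[Ff /andP[kF ex]].
    have /eqP/key_eq[pe _] := kF; apply/setIdP; split; first exact: Ff.
    rewrite kF /= /P -pe; exact: ex.
  apply: (@out_iter (~: (A :\: P)) (fun v => (nbad E (A :\: P) S S v)%:R) _ i d) => //.
  - move=> v vt; rewrite inE negbK => vA.
    have vr : (nv v <= rho)%N by apply: leq_trans rr; apply: ltnW.
    rewrite -natr_sum -[4]/(4%:R) -natrM ler_nat -(deg_in vr).
    by apply: nbad_subharmonic => //; rewrite inE ltnW.
  - by move=> v vt; rewrite inE => vA; rewrite nbad_dead // inE (ltnW vt).
  - move=> l hl.
    have [||y wy yl] := @fconnect_level F0 w o l _ wo.
    + exact: forest_step F0f.
    + by rewrite nvo; lia.
    by exists y => //; rewrite !inE wy andbT; case: (y == o); case: (y \in D).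
  by move=> v _; rewrite ler_nat nbad_le.
by move=> F F0 Ff F0f k; rewrite (key_conn _ Ff F0f k).
Qed.

(** Take [w] at radius [Lam ^ (i + d1 + d2)]. Its path avoids [o] ([lam ^+ d3]); or it reaches [o]
    but the path of [x] leaves [S] before joining it ([lam ^+ d1]); or they join at some [y] in [S],
    which then lies on the path of [w] and escapes ([lam ^+ d2] for each [y]). *)
Lemma card_escapes i d1 d2 d3 x : (0 < d3)%N -> (Lam ^ (i + d1 + d2 + d3) <= rho)%N ->
  (nv x <= Lam ^ i)%N ->
  #|[set F in forest E A | escapes A (ball (Lam ^ (i + d1 + d2 + d3))) o x F]|%:R <=
    (lam ^+ d3 + lam ^+ d1 + #|ball (Lam ^ (i + d1))|%:R * lam ^+ d2) * #|forest E A|%:R.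
Proof.
move=> d30 rr xn; set t := (Lam ^ (i + d1 + d2 + d3))%N in rr *.
have le1 : (Lam ^ i <= Lam ^ (i + d1))%N by rewrite Lam_le // leq_addr.
have le2 : (Lam ^ (i + d1) <= Lam ^ (i + d1 + d2))%N by rewrite Lam_le // leq_addr.
have le3 : (Lam ^ (i + d1 + d2).+1 <= t)%N by rewrite Lam_le // -addn1 leq_add2l.
have le3' : (Lam ^ (i + d1 + d2) <= Lam ^ (i + d1 + d2).+1)%N by rewrite Lam_le.
have bN : (nm ((Lam ^ (i + d1 + d2))%N%:Z, 0%R) <= N)%N by rewrite /nm /=; lia.
pose w := at_site bN.
have wn : nv w = (Lam ^ (i + d1 + d2))%N by rewrite /nv val_at /nm /=; lia.
have oA : o \notin A by rewrite !inE eqxx.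
set S := ball (Lam ^ (i + d1)).
pose X := [set F in forest E A | ~~ fconnect F w o && escapes A (ball t) o x F].
pose Y := [set F in forest E A | fconnect F w o &&
     ~~ good (A :\: path_set A F w) S S (cutP (path_set A F w) F) x].
pose Z z := [set F in forest E A | escapes A (ball t) o z F && fconnect F w z].
have far : #|X|%:R <= lam ^+ d3 * #|forest E A|%:R.
  by apply: escapes_far => //; lia.
have near : #|Y|%:R <= lam ^+ d1 * #|forest E A|%:R.
  by apply: escapes_near => //; lia.
have path z : z \in S -> #|Z z|%:R <= lam ^+ d2 * #|forest E A|%:R.
  by rewrite inE => zi; apply: escapes_path zi _ wn; lia.
rewrite !mulrDl -mulrA mulr_natl.
apply: (@le_trans _ _ (#|X| + #|Y| + \sum_(z in S) #|Z z|)%N%:R); last first.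
  rewrite !natrD natr_sum; apply: lerD; first exact: lerD.
  by rewrite -sumr_const; apply: ler_sum => z zS; apply: path.
rewrite ler_nat.
have cU : (#|\bigcup_(z in S) Z z| <= \sum_(z in S) #|Z z|)%N.
  elim/big_rec2: _ => [|z m B _ hB]; first by rewrite cards0.
  by rewrite (leq_trans (leq_card_setU _ _)) // leq_add2l.
apply: (leq_trans _ (leq_add (leq_card_setU X Y) cU)).
apply: (leq_trans _ (leq_card_setU _ _)).
apply/subset_leq_card/subsetP => F; rewrite inE => /andP[Ff ex].
rewrite !in_setU; have [wo|wo] := boolP (fconnect F w o); last first.
  by rewrite (_ : F \in X) // inE Ff wo.
have [g|ng] := boolP (good (A :\: path_set A F w) S S (cutP (path_set A F w) F) x).
  have St : S \subset ball t by apply/subsetP => y; rewrite !inE; lia.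
  have [y yS ey] := escapes_same oA Ff St ex g.
  by apply/orP; right; apply/bigcupP; exists y => //; rewrite inE Ff.
by rewrite (_ : F \in Y) ?orbT // inE Ff wo.
Qed.

End ScaleBound.

Lemma card_ball N r : (#|ball N r| <= (2 * r + 1) ^ 2)%N.
Proof.
have -> : ((2 * r + 1) ^ 2 = size (box r))%N.
  by rewrite /box size_allpairs !size_map size_iota mulnn.
rewrite cardE -(size_map val); apply: uniq_leq_size.
  by rewrite (map_inj_uniq val_inj) enum_uniq.
by move=> z /mapP[v]; rewrite mem_enum inE => vr ->; rewrite mem_boxE.
Qed.

Lemma exists_lam_pow (R : realType) (lam eps : R) : 0 <= lam < 1 -> 0 < eps ->
  exists q : nat, lam ^+ q <= eps.
Proof.
move=> /andP[l0 l1] e0; have /cvgrPdist_lt/(_ eps e0)[q _ hq] : (lam ^+ n @[n --> \oo] --> (0 : R))%classic.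
  by apply: cvg_expr; rewrite ger0_norm.
exists q; have := hq q (leqnn q); rewrite /= sub0r normrN ger0_norm ?exprn_ge0 //.
exact: ltW.
Qed.

(** For [k = 2 * 2 ^ m * a] the numerator of [theta] is at most [7 * ln 2], as [2 * 8 ^ 2 = 2 ^ 7],
    and the denominator at least [2 * m * ln 2]; hence the condition [7 <= c0 R * m%:R]. *)
Lemma exists_scale (R : realType) : exists2 h : nat, (8 <= h)%N &
  forall a x, (0 < a)%N -> nm x = (2 * h * a)%N -> theta R a (8 * (2 * h) * a) x <= c0 R / 2.
Proof.
have c0p := c0_gt0 R.
have [m m3 hm] : exists2 m, (3 <= m)%N & 7 <= c0 R * m%:R.
  exists (Num.bound (7 / c0 R)).+3 => //.
  rewrite mulrC -ler_pdivrMr // ltW //; apply: lt_le_trans (archi_boundP _) _.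
    by rewrite divr_ge0 // ltW.
  by rewrite ler_nat; move: (Num.bound _) => n; lia.
exists (2 ^ m)%N; first by rewrite -[8%N]/(2 ^ 3)%N leq_exp2l.
move=> a x a0 xe; set k := (2 * 2 ^ m * a)%N in xe *.
rewrite -mulnA -/k; have ak : (a < 8 * k)%N by rewrite /k -mulnA; have := expn_gt0 2 m; nia.
apply: le_trans (theta_le R ak (eq_leq (esym xe))) _.
have a1 : 1 <= a%:R :> R by rewrite ler1n.
have k1 : 1 <= k%:R :> R by rewrite ler1n; lia.
have sa : 1 <= a%:R ^+ 2 :> R by rewrite expr_ge1 // (le_trans ler01).
have sk : 1 <= k%:R ^+ 2 :> R by rewrite expr_ge1 // (le_trans ler01).
rewrite ler_pdivrMr ?theta_den //.
have -> : (8 * k)%:R = 8 * k%:R :> R by rewrite natrM.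
have P1 : 0 < 1 + k%:R ^+ 2 :> R by lra.
have P2 : 0 < 1 + 2 * (8 * k%:R) ^+ 2 :> R by rewrite exprMn; lra.
have P3 : 0 < 1 + 2 * a%:R ^+ 2 :> R by lra.
have num : ln (1 + 2 * (8 * k%:R) ^+ 2) - ln (1 + k%:R ^+ 2) <= 7 * ln 2 :> R.
  rewrite lerBlDr [7 * _]mulr_natl -lnXn // -lnM ?posrE ?exprn_gt0 // ler_ln ?posrE ?mulr_gt0 ?exprn_gt0 //.
  by rewrite exprMn; lra.
have den : 2 * (m%:R * ln 2) <= ln (1 + 2 * (8 * k%:R) ^+ 2) - ln (1 + 2 * a%:R ^+ 2) :> R.
  have kE : k%:R = 2 * 2 ^+ m * a%:R :> R by rewrite /k !natrM natrX.
  have e1 : 1 <= 2 ^+ m :> R by rewrite exprn_ege1 // ler1n.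
  rewrite lerBrDr [m%:R * _]mulr_natl [2 * (_ *+ _)]mulr_natl -!lnXn ?exprn_gt0 // -lnM ?posrE ?exprn_gt0 //.
  rewrite ler_ln ?posrE ?mulr_gt0 ?exprn_gt0 // kE.
  by move: (2 ^+ m) e1 => e e1; rewrite !exprMn; nra.
have l2 : 0 < ln 2 :> R by rewrite ln_gt0 // ltr1n.
apply: le_trans num _.
apply: le_trans (_ : _ <= c0 R / 2 * (2 * (m%:R * ln 2))) _; last first.
  by rewrite ler_wpM2l // divr_ge0 // ltW.
rewrite (_ : c0 R / 2 * _ = (c0 R * m%:R) * ln 2); last by field.
by rewrite ler_pM2r.
Qed.
(** The graph left after burning the outside: a vertex of [D] keeps its arcs into [D], and its arcs
    to the sink only in the box of radius [rho], which the fire may not enter. *)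
Definition sink_graph N rho (D : {set V N}) : rel (V N) :=
  fun v u => [&& v \in D, adjN v u & (u \in D) || (nv v <= rho)%N].

(* With [Lam] and [Q] chosen once and for all, a path of the uniform spanning
   forest rooted at [o] rarely makes a detour between polynomially related scales. *)
Lemma sum_escapes (R : realType) : exists Lam Q : nat, [/\ (16 <= Lam)%N, (0 < Q)%N &
  forall N rho (D : {set V N}) o i, (rho < N)%N -> val o = origin ->
    (forall v, (nv v <= rho)%N -> v \in D) -> (0 < i)%N -> (Lam ^ (Q * i) <= rho)%N ->
    (\sum_(x in ball N (Lam ^ i))
      #|[set F in forest (sink_graph rho D) (D :\ o) |
           escapes (D :\ o) (ball N (Lam ^ (Q * i))) o x F]|)%N%:R <=
    2^-1 ^+ i * #|forest (sink_graph rho D) (D :\ o)|%:R :> R].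
Proof.
have [h h8 hth] := exists_scale R; set Lam := (2 * h)%N in hth.
have L16 : (16 <= Lam)%N by rewrite /Lam; lia.
have [] := (c0_gt0 R, lam_ge0 R); set lam := 1 - c0 R / 2 => c0p l0.
pose b : R := Lam%:R; have b16 : 16 <= b by rewrite /b (ler_nat _ 16).
have b0 : 0 < b by lra.
have bp j : 0 < b ^+ j by rewrite exprn_gt0.
have l1 : lam < 1 by rewrite /lam; lra.
(* Sums run over two balls, of size at most [9 * b ^+ (2 * i)] and [9 * b ^+ (2 * m)]; this explains
   81 and four powers of [b]. The fifth power leaves geometric decay. *)
have [||q hq] := @exists_lam_pow R lam (81 * b ^+ 5)^-1; first by rewrite l0.
  by rewrite invr_gt0 mulr_gt0 //; lra.
exists Lam, ((q + 1) ^ 3)%N; split=> //; first by rewrite expn_gt0 addn1.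
move=> N rho D o i rN oo rD i0 ir.
(* As [m = i + q * i] and [M = m + q * m], each gap between exponents is [q] times the exponent
   below it, so the decay beats the ball at its inner radius. *)
pose m := ((q + 1) * i)%N; pose M := ((q + 1) * m)%N.
have im : (i <= m)%N by rewrite /m leq_pmull // addn1.
have mM : (m <= M)%N by rewrite /M leq_pmull // addn1.
have eQ : ((q + 1) ^ 3 * i = i + q * i + q * m + q * M)%N.
  by rewrite /M /m !expnS expn0; ring.
have em : (i + q * i = m)%N by rewrite /m; ring.
rewrite eQ in ir *; set t := (i + _ + _ + _)%N in ir *.
set f := #|forest _ _|.
have cb j : #|ball N (Lam ^ j)|%:R <= 9 * b ^+ (2 * j) :> R.
  apply: (@le_trans _ _ (((2 * Lam ^ j + 1) ^ 2)%N%:R)); first by rewrite ler_nat card_ball.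
  rewrite natrX natrD natrM natrX -/b mulnC exprM.
  have : 1 <= b ^+ j by apply: exprn_ege1; lra.
  by move: (b ^+ j) => x hx; nra.
have lq j : lam ^+ (q * j) <= ((81 * b ^+ 5)^-1) ^+ j.
  by rewrite exprM lerXn2r ?nnegrE ?exprn_ge0 // invr_ge0 mulr_ge0 // ltW.
have q0 : (0 < q)%N.
  rewrite lt0n; apply/negP => /eqP q0; move: hq; rewrite q0 expr0.
  rewrite invf_ge1 ?mulr_gt0 //.
  have : 1 <= b ^+ 5 by apply: exprn_ege1; lra.
  by lra.
have qM : (0 < q * M)%N by rewrite muln_gt0 q0; exact: leq_trans i0 (leq_trans im mM).
have card x : x \in ball N (Lam ^ i) ->
   #|[set F in forest (sink_graph rho D) (D :\ o) |
           escapes (D :\ o) (ball N (Lam ^ t)) o x F]|%:R <=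
   (lam ^+ (q * M) + lam ^+ (q * i) + #|ball N (Lam ^ m)|%:R * lam ^+ (q * m)) * f%:R.
  rewrite inE /t -em => xi; rewrite /t -em in ir.
  exact: (card_escapes h8 hth rN oo rD).
rewrite natr_sum; apply: le_trans (ler_sum _ (fun x hx => card x hx)) _.
rewrite sumr_const -[leLHS]mulr_natl mulrA ler_wpM2r //.
have le1 : lam ^+ (q * M) <= lam ^+ (q * i).
  by apply: ler_wiXn2l => //; [exact: ltW | rewrite leq_mul2l (leq_trans im) ?orbT].
have B j : 0 <= #|ball N (Lam ^ j)|%:R :> R by [].
have lp j : 0 <= lam ^+ j by apply: exprn_ge0.
have bb j : ((81 * b ^+ 5)^-1) ^+ j = (81 ^+ j * b ^+ j * b ^+ (2 * j) * b ^+ (2 * j))^-1.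
  rewrite exprVn exprMn -exprM -!mulrA -!exprD; congr (_ * _ ^+ _)^-1; lia.
have e81 j : (0 < j)%N -> 81 <= 81 ^+ j :> R.
  by case: j => // j _; rewrite exprS ler_peMr // exprn_ege1 //; lra.
have b1 j : 1 <= b ^+ j by apply: exprn_ege1; lra.
have p81 j : 0 < 81 ^+ j :> R by rewrite exprn_gt0.
have first_term : 9 * b ^+ (2 * i) * lam ^+ (q * i) <= 9^-1 * (b ^+ i)^-1.
  apply: (@le_trans _ _ (9 * b ^+ (2 * i) * ((81 * b ^+ 5)^-1) ^+ i)).
    by rewrite ler_wpM2l // mulr_ge0 // ltW.
  rewrite bb; have := e81 i i0; have := b1 (2 * i)%N; move: (bp i) (bp (2 * i)%N) (p81 i).
  move: (b ^+ i) (b ^+ (2 * i)) (81 ^+ i) => x y z x0 y0 z0 y1 z1.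
  rewrite (_ : 9 * y * (z * x * y * y)^-1 = 9 / (z * y) / x); last first.
    by field; rewrite !gt_eqF.
  apply: ler_wpM2r; first by rewrite invr_ge0 ltW.
  by rewrite ler_pdivrMr ?mulr_gt0 //; nra.
have snd_term : 9 * b ^+ (2 * i) * (9 * b ^+ (2 * m) * lam ^+ (q * m)) <= (b ^+ i)^-1.
  apply: (@le_trans _ _ (9 * b ^+ (2 * m) * (9 * b ^+ (2 * m) * ((81 * b ^+ 5)^-1) ^+ m))).
    have bg j : 0 <= b ^+ j by apply: ltW.
    apply: ler_pM; rewrite ?mulr_ge0 //.
      by apply: ler_wpM2l => //; apply: ler_weXn2l; [lra | rewrite leq_mul2l im].
    by apply: ler_wpM2l => //; rewrite mulr_ge0.
  apply: (@le_trans _ _ ((b ^+ m)^-1)); last first.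
    by rewrite lef_pV2 ?posrE // ler_weXn2l //; lra.
  rewrite bb; have := e81 m (leq_trans i0 im); move: (bp m) (bp (2 * m)%N) (p81 m).
  move: (b ^+ m) (b ^+ (2 * m)) (81 ^+ m) => x y z x0 y0 z0 z1.
  rewrite (_ : 9 * y * (9 * y / (z * x * y * y)) = (81 / z) / x); last first.
    by field; rewrite !gt_eqF.
  apply: ler_piMl; first by rewrite invr_ge0 ltW.
  by rewrite ler_pdivrMr // mul1r.
have bi : (b ^+ i)^-1 <= 16^-1 ^+ i.
  by rewrite -exprVn lerXn2r ?nnegrE ?invr_ge0 // ?lef_pV2 ?posrE //; lra.
have fin : 16^-1 ^+ i <= 8^-1 * 2^-1 ^+ i :> R.
  case: (i) i0 => // j _; rewrite !exprS.
  have : 16^-1 ^+ j <= 2^-1 ^+ j :> R by rewrite lerXn2r ?nnegrE ?invr_ge0 // lef_pV2 ?posrE //; lra.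
  have : 0 <= 16^-1 ^+ j :> R by rewrite exprn_ge0.
  by lra.
have h1 := cb i; have h2 := cb m.
apply: (@le_trans _ _ (9 * b ^+ (2 * i) * (2 * lam ^+ (q * i) + 9 * b ^+ (2 * m) * lam ^+ (q * m)))).
  rewrite ler_pM ?addr_ge0 ?mulr_ge0 // lerD //; first by lra.
  by rewrite ler_wpM2r.
have : 0 <= 2^-1 ^+ i :> R by rewrite exprn_ge0.
rewrite mulrDr (_ : _ * (2 * _) = 2 * (9 * b ^+ (2 * i) * lam ^+ (q * i))); last by ring.
by move: first_term snd_term bi fin; lra.
Qed.

(** * Effective resistance *)

Section Resistance.
Variables (T : finType) (E : rel T) (D : {set T}) (o : T).
Hypotheses (symE : {in D &, symmetric E}) (oD : o \in D).
Let A := D :\ o.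
Let oA : o \notin A. Proof. by rewrite !inE eqxx. Qed.

(** Since [u] is not rooted at [o], hanging [o] on [u] creates no cycle. *)
Lemma forest_attach F u : F \in forest E A -> E o u -> ~~ fconnect F u o ->
  upd F o u \in forest E D.
Proof.
move=> /forestP[h1 h2 h3] Eou uo.
have DA z : z \notin A -> z != o -> z \notin D by rewrite !inE negb_and negbK => /orP[->|].
have root v : ~~ fconnect F v o -> exists2 z, z \notin D & fconnect (upd F o u) v z.
  move=> vo; have [z zA vz] := h3 v; exists z; last by rewrite (conn_upd u vo).
  by apply: DA => //; apply: contraNneq vo => <-.
apply/forestP; split=> [v vD|v vD|v].
- rewrite updE; have [-> //|vo] := eqVneq v o; apply: h1.
  by rewrite !inE vo.
- rewrite updE; have [vo|vo] := eqVneq v o; first by rewrite vo oD in vD.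
  by apply: h2; rewrite !inE negb_and vD orbT.
have [vo|vo] := boolP (fconnect F v o); last exact: root.
have [z zD uz] := root u uo; exists z => //.
apply: connect_trans (conn_upd_to u vo) _; apply: connect_trans uz.
by apply: connect1; rewrite /= updE eqxx.
Qed.

Lemma forest_attach_le :
  (\sum_(u | E o u) #|[set F in forest E A | ~~ fconnect F u o]| <= #|forest E D|)%N.
Proof.
pose S := [set p : {ffun T -> T} * T |
  [&& p.1 \in forest E A, E o p.2 & ~~ fconnect p.1 p.2 o]].
have -> : (\sum_(u | E o u) #|[set F in forest E A | ~~ fconnect F u o]| = #|S|)%N.
  rewrite -sum1_card (eq_bigr (fun u => \sum_(F in forest E A | ~~ fconnect F u o) 1)%N).
    rewrite (exchange_big_dep (mem (forest E A))) /=; last by move=> u F _ /andP[].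
    rewrite pair_big_dep /=; apply: eq_bigl => -[F u]; rewrite inE /=.
    by case: (F \in forest E A).
  by move=> u _; rewrite -sum1_card; apply: eq_bigl => F; rewrite inE.
rewrite -(@card_in_imset _ _ (fun p : {ffun T -> T} * T => upd p.1 o p.2)).
  apply/subset_leq_card/subsetP => x /imsetP[[F u]]; rewrite inE /= => /and3P[h1 h2 h3] ->.
  exact: forest_attach.
move=> [F u] [F' u']; rewrite !inE /= => /and3P[/forestP[_ h _] _ _].
move=> /and3P[/forestP[_ h' _] _ _] e; congr pair; last first.
  by have := congr1 (fun G : {ffun T -> T} => G o) e; rewrite !updE eqxx.
rewrite -(upd_id F o) -(upd_id F' o) h // h' //.
by rewrite -(upd_upd F o u o) e upd_upd.
Qed.

Definition off_root v := nbad E A setT [set o] v.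

Lemma off_rootE v : off_root v = #|[set F in forest E A | ~~ fconnect F v o]|.
Proof.
apply: eq_card => F; rewrite !inE; congr (_ && ~~ _).
apply/goodP/idP => [[[z [/set1P -> _ //]] _]|vo].
by split=> [|? _ _]; [exists o; rewrite inE eqxx | rewrite inE].
Qed.

(** Not being rooted at [o] is itself a good event, for the root set [~: [set o]], so the inequality
    for [good] holds in both directions. *)
Lemma off_root_harmonic v : v \in A ->
  (deg E v * off_root v = \sum_(u | E v u) off_root u)%N.
Proof.
move=> vA; apply/eqP; rewrite eqn_leq; apply/andP; split; first exact: nbad_subharmonic.
have e u : off_root u = #|[set F in forest E A | good A setT (~: [set o]) F u]|.
  rewrite off_rootE; apply: eq_card => F; rewrite !inE.
  have [Ff|//] := boolP (F \in forest E A); have /forestP[_ d h] := Ff.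
  apply/idP/goodP => [uo|[[z [+ zA uz]] _]].
    split=> [|? _ _]; last by rewrite inE.
    have [z zA uz] := h u; exists z; split=> //; rewrite !inE.
    by apply: contraNneq uo => <-.
  rewrite !inE; apply: contraNN => uo; apply/eqP.
  exact: conn_fix2 (d _ zA) (d _ oA) uz uo.
by rewrite e (eq_bigr _ (fun u _ => e u)); apply: good_superharmonic.
Qed.

Section Energy.
Variables (R : realFieldType) (f : T -> R).
Hypotheses (fo : f o = 0) (f1 : forall v, v \notin D -> f v = 1).
Hypothesis fh : forall v, v \in A -> (deg E v)%:R * f v = \sum_(u | E v u) f u.

Definition flux := \sum_(u | E o u) f u.

Definition local_energy v := \sum_(u in D | E v u) (f u - f v) ^+ 2.

Lemma swap_edges (F : T -> T -> R) :
  \sum_(v in D) \sum_(u in D | E v u) F v u = \sum_(v in D) \sum_(u in D | E v u) F u v.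
Proof.
rewrite (exchange_big_dep (mem D)) /=; last by move=> i j _ /andP[].
apply: eq_bigr => v vD; apply: eq_big => [u|u _ //].
by case: (boolP (u \in D)) => uD //=; rewrite vD symE.
Qed.

(** Summation by parts: the sum of [f v * S v] vanishes because [f] is 0 at [o] and harmonic
    elsewhere, while the sum of [S v] is minus the flux. Inner edges are counted twice, whence the
    factors 2. *)
Lemma energy_flux :
  \sum_(v in D) local_energy v + 2 * \sum_(v in D) \sum_(u | (u \notin D) && E v u) (1 - f v) ^+ 2
  = 2 * flux.
Proof.
pose S v := \sum_(u | E v u) (f v - f u).
have Sh v : v \in A -> S v = 0.
  move=> vA; rewrite /S big_split /= sumrN -fh // sumr_const.
  rewrite [_ *+ _](_ : _ = (deg E v)%:R * f v) ?subrr // mulr_natl; congr (_ *+ _).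
  by apply: eq_card => u; rewrite !inE.
have So : S o = - flux.
  by rewrite /S -sumrN; apply: eq_bigr => u _; rewrite fo sub0r.
have Ssplit v : S v = \sum_(u in D | E v u) (f v - f u) +
                      \sum_(u | (u \notin D) && E v u) (f v - 1).
  rewrite /S (bigID (mem D)) /=; congr (_ + _); first by apply: eq_bigl => u; rewrite andbC.
  by apply: eq_big => [u|u /andP[_ uD]]; [rewrite andbC | rewrite (f1 uD)].
have s1 : \sum_(v in D) S v = - flux.
  rewrite (bigD1 o) //= So big1 ?addr0 // => v /andP[vD vo].
  by apply: Sh; rewrite !inE vo.
have s2 : \sum_(v in D) f v * S v = 0.
  rewrite (bigD1 o) //= fo mul0r add0r big1 // => v /andP[vD vo].
  by rewrite Sh ?mulr0 // !inE vo.
pose X := \sum_(v in D) \sum_(u in D | E v u) f v * (f v - f u).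
pose Y := \sum_(v in D) \sum_(u | (u \notin D) && E v u) (f v - 1).
pose Z := \sum_(v in D) \sum_(u | (u \notin D) && E v u) f v * (f v - 1).
have z0 : \sum_(v in D) \sum_(u in D | E v u) (f v - f u) = 0.
  set W := LHS; suff : W = - W by lra.
  rewrite {1}/W swap_edges /W -sumrN; apply: eq_bigr => v _; rewrite -sumrN.
  by apply: eq_bigr => u _; rewrite opprB.
have e1 : Y = - flux.
  rewrite -s1 (eq_bigr _ (fun v _ => Ssplit v)) big_split /= z0 add0r.
  by [].
have e2 : X + Z = 0.
  rewrite -s2 /X /Z -big_split /=; apply: eq_bigr => v _.
  by rewrite -!mulr_sumr -mulrDr -Ssplit.
have e3 : \sum_(v in D) local_energy v = 2 * X.
  rewrite (_ : 2 * X = X + X); last by ring.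
  have eX : X = \sum_(v in D) \sum_(u in D | E v u) f u * (f u - f v) by rewrite /X swap_edges.
  rewrite {1}eX /X -big_split /=; apply: eq_bigr => v _.
  rewrite -big_split /=; apply: eq_bigr => u _; ring.
have e4 : \sum_(v in D) \sum_(u | (u \notin D) && E v u) (1 - f v) ^+ 2 = Z - Y.
  rewrite /Z /Y -sumrB; apply: eq_bigr => v _; rewrite -sumrB.
  by apply: eq_bigr => u _; ring.
by rewrite e3 e4; lra.
Qed.

Lemma local_energy_ge0 v : 0 <= local_energy v.
Proof. by apply: sumr_ge0 => u _; apply: sqr_ge0. Qed.

Lemma sum_local_energy : \sum_(v in D) local_energy v <= 2 * flux.
Proof.
rewrite -energy_flux lerDl mulr_ge0 // sumr_ge0 // => v _.
by apply: sumr_ge0 => u _; apply: sqr_ge0.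
Qed.

Lemma edge_energy v u : v \in D -> u \in D -> E v u -> (f u - f v) ^+ 2 <= 2 * flux.
Proof.
move=> vD uD Evu; apply: le_trans sum_local_energy; rewrite (bigD1 v) //= ler_wpDr //.
  by apply: sumr_ge0 => w _; apply: local_energy_ge0.
rewrite /local_energy (bigD1 u) ?uD //= ler_wpDr // sumr_ge0 // => w _.
exact: sqr_ge0.
Qed.

Lemma sink_energy v u : v \in D -> u \notin D -> E v u -> (1 - f v) ^+ 2 <= flux.
Proof.
move=> vD uD Evu; have := energy_flux.
have : 0 <= \sum_(v in D) local_energy v by apply: sumr_ge0 => w _; apply: local_energy_ge0.
suff : (1 - f v) ^+ 2 <= \sum_(v in D) \sum_(u | (u \notin D) && E v u) (1 - f v) ^+ 2 by lra.
have ge w : 0 <= \sum_(u | (u \notin D) && E w u) (1 - f w) ^+ 2.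
  by apply: sumr_ge0 => x _; apply: sqr_ge0.
rewrite (bigD1 v) //= ler_wpDr ?sumr_ge0 //.
by rewrite (bigD1 u) ?uD //= ler_wpDr // sumr_ge0 // => w _; apply: sqr_ge0.
Qed.

End Energy.
End Resistance.

(** * Variation of a function along squares, bounded by its energy *)

Section Triangle.
Variables (R : realFieldType) (h : nat -> nat -> R).

Definition antidiag j := \sum_(i < j.+1) h i (j - i).

Definition antidiag_energy j := \sum_(i < j.+1)
  ((h i.+1 (j - i) - h i (j - i)) ^+ 2 + (h i (j - i).+1 - h i (j - i)) ^+ 2).

Definition harm J : R := \sum_(j < J) j.+1%:R^-1.

(** The weights are those of the flow spreading uniformly over successive antidiagonals: each site
    of antidiagonal [j] emits [j.+2], each site of the next one receives [j.+1]. *)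
Lemma antidiagS j : j.+1%:R * antidiag j.+1 - j.+2%:R * antidiag j =
  \sum_(i < j.+1) (i.+1%:R * (h i.+1 (j - i) - h i (j - i)) +
                   (j - i).+1%:R * (h i (j - i).+1 - h i (j - i))).
Proof.
have e1 : \sum_(i < j.+1) i.+1%:R * h i.+1 (j - i) = \sum_(i < j.+2) i%:R * h i (j.+1 - i).
  rewrite [RHS]big_ord_recl mul0r add0r; apply: eq_bigr => i _.
  by rewrite lift0 subSS.
have e2 : \sum_(i < j.+1) (j - i).+1%:R * h i (j - i).+1 =
          \sum_(i < j.+2) (j.+1 - i)%:R * h i (j.+1 - i).
  rewrite [RHS]big_ord_recr /= subnn mul0r addr0; apply: eq_bigr => i _.
  by rewrite subSn // -ltnS.
have e3 : j.+1%:R * antidiag j.+1 =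
    \sum_(i < j.+1) i.+1%:R * h i.+1 (j - i) + \sum_(i < j.+1) (j - i).+1%:R * h i (j - i).+1.
  rewrite e1 e2 -big_split /= mulr_sumr; apply: eq_bigr => i _.
  by rewrite -mulrDl -natrD subnKC // -ltnS.
rewrite e3 mulr_sumr -big_split /= -sumrB; apply: eq_bigr => i _.
have -> : j.+2%:R = i.+1%:R + (j - i).+1%:R :> R.
  by rewrite -natrD; congr _%:R; have := ltn_ord i; lia.
by ring.
Qed.

Lemma young (tau a x : R) : 0 < tau -> `|a * x| <= 2^-1 * (tau * a ^+ 2 + x ^+ 2 / tau).
Proof.
move=> t0; have ti : 0 < tau^-1 by rewrite invr_gt0.
have s y : tau * a ^+ 2 + y ^+ 2 / tau - 2 * (a * y) = tau * (a - y / tau) ^+ 2.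
  by field; rewrite gt_eqF.
have p y : 0 <= tau * (a - y / tau) ^+ 2 by rewrite mulr_ge0 ?sqr_ge0 ?ltW.
by rewrite ler_norml; have := p x; have := p (- x); rewrite -!s sqrrN; lra.
Qed.

(** Young's inequality with the same [tau] on every antidiagonal: the squared flow contributes at
    most [1 / (j + 1)], which later sums to [harm], and the energies simply add up. *)
Lemma antidiag_step (tau : R) j : 0 < tau ->
  `|antidiag j.+1 / j.+2%:R - antidiag j / j.+1%:R| <=
  tau / j.+1%:R + antidiag_energy j / (2 * tau).
Proof.
move=> t0; have e : antidiag j.+1 / j.+2%:R - antidiag j / j.+1%:R =
    (j.+1%:R * antidiag j.+1 - j.+2%:R * antidiag j) / (j.+1%:R * j.+2%:R).
  have a0 : j.+1%:R != 0 :> R by rewrite pnatr_eq0.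
  have b0 : j.+2%:R != 0 :> R by rewrite pnatr_eq0.
  by move: (j.+1%:R) (j.+2%:R) a0 b0 => a b a0 b0; field; rewrite a0 b0.
rewrite e antidiagS mulr_suml; apply: le_trans (ler_norm_sum _ _ _) _.
have j1 : 0 < j.+1%:R :> R by rewrite ltr0n.
have j2 : 0 < j.+2%:R :> R by rewrite ltr0n.
pose b : R := (j.+2%:R)^-1; have b0 : 0 < b by rewrite invr_gt0.
have bE : b ^+ 2 * j.+1%:R <= j.+1%:R^-1.
  rewrite -[leRHS]mul1r ler_pdivlMr // -mulrA -expr2 -exprMn.
  rewrite -[leRHS](expr1n _ 2) lerXn2r ?nnegrE ?mulr_ge0 ?ltW // /b mulrC ltr_pdivrMr //.
  by rewrite mul1r ltr_nat.
apply: (@le_trans _ _ (\sum_(i < j.+1) (tau * b ^+ 2 +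
  ((h i.+1 (j - i) - h i (j - i)) ^+ 2 + (h i (j - i).+1 - h i (j - i)) ^+ 2) / (2 * tau)))); last first.
  rewrite big_split /= -[X in _ + X <= _]mulr_suml -/(antidiag_energy j) lerD2r sumr_const card_ord.
  by rewrite -mulrnAr ler_pM2l // -mulr_natr.
apply: ler_sum => i _; have ij := ltn_ord i.
set x := _ - _; set y := h i _.+1 - _.
have c k : (k <= j.+1)%N -> 0 <= (k%:R : R) / (j.+1%:R * j.+2%:R) <= b.
  move=> kj; apply/andP; split; first by rewrite divr_ge0 // mulr_ge0 // ltW.
  rewrite invfM mulrA; apply: ler_piMl; first exact: ltW.
  by rewrite ler_pdivrMr // mul1r ler_nat.
have bd k z : (k <= j.+1)%N -> `|k%:R / (j.+1%:R * j.+2%:R) * z| <=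
    2^-1 * (tau * b ^+ 2 + z ^+ 2 / tau).
  move=> kj; have /andP[c0 c1] := c k kj; apply: le_trans (young _ _ t0).
  by rewrite !normrM ler_wpM2r // !ger0_norm // ltW.
have -> : (i.+1%:R * x + (j - i).+1%:R * y) / (j.+1%:R * j.+2%:R) =
   i.+1%:R / (j.+1%:R * j.+2%:R) * x + (j - i).+1%:R / (j.+1%:R * j.+2%:R) * y by ring.
apply: le_trans (ler_normD _ _) _.
have := bd i.+1 x ij; have := bd (j - i).+1 y; rewrite ltnS leq_subr => /(_ isT).
move=> h1 h2.
have -> : tau * b ^+ 2 + (x ^+ 2 + y ^+ 2) / (2 * tau) =
  2^-1 * (tau * b ^+ 2 + x ^+ 2 / tau) + 2^-1 * (tau * b ^+ 2 + y ^+ 2 / tau) by field; rewrite gt_eqF.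
by rewrite lerD.
Qed.

Lemma antidiag_mean (tau : R) J : 0 < tau ->
  `|antidiag J / J.+1%:R - h 0 0| <=
  tau * harm J + (\sum_(j < J) antidiag_energy j) / (2 * tau).
Proof.
move=> t0; elim: J => [|J IH].
  by rewrite /harm !big_ord0 /antidiag big_ord1 subnn divr1 subrr normr0 mulr0 mul0r addr0.
have := antidiag_step J t0; rewrite /harm !big_ord_recr /= -/(harm J) => st.
rewrite mulrDr mulrDl addrACA.
rewrite (_ : _ - _ = (antidiag J / J.+1%:R - h 0 0) +
  (antidiag J.+1 / J.+2%:R - antidiag J / J.+1%:R)); last by ring.
by apply: le_trans (ler_normD _ _) _; rewrite lerD.
Qed.

End Triangle.

(** Two triangles share the long antidiagonal of the square, so both corners are compared with the
    same mean. *)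
Lemma square_hop (R : realFieldType) (h : nat -> nat -> R) (tau G : R) J : 0 < tau ->
  \sum_(j < J) antidiag_energy h j <= G ->
  \sum_(j < J) antidiag_energy (fun i k => h (J - i)%N (J - k)%N) j <= G ->
  `|h J J - h 0%N 0%N| <= 2 * tau * harm R J + G / tau.
Proof.
move=> t0 g1 g2; pose h' i k := h (J - i)%N (J - k)%N.
have e : antidiag h' J = antidiag h J.
  rewrite /antidiag (reindex_inj rev_ord_inj) /=; apply: eq_bigr => i _; rewrite /h'.
  by congr h; have := ltn_ord i; lia.
have := antidiag_mean h J t0; have := antidiag_mean h' J t0; rewrite e /h' !subn0.
have t2 : 0 < 2 * tau by rewrite mulr_gt0.
have b1 : (\sum_(j < J) antidiag_energy h j) / (2 * tau) <= G / (2 * tau).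
  by rewrite ler_pM2r ?invr_gt0.
have b2 : (\sum_(j < J) antidiag_energy (fun i k => h (J - i)%N (J - k)%N) j) / (2 * tau) <= G / (2 * tau).
  by rewrite ler_pM2r ?invr_gt0.
have -> : G / tau = G / (2 * tau) + G / (2 * tau) by field; rewrite gt_eqF.
move: b1 b2; set x := antidiag h J / _; rewrite !ler_norml; lra.
Qed.

Section SiteHop.
Variables (R : realType) (N rho : nat) (D : {set V N}) (o : V N).
Hypotheses (rhoN : (rho < N)%N) (oo : val o = origin).
Hypothesis rhoD : forall v, (nv v <= rho)%N -> v \in D.
Let E := sink_graph rho D.
Variable f : V N -> R.
Let Phi := flux E o f.
Hypothesis energy : \sum_(v in D) local_energy E D f v <= 2 * Phi.

Definition at_or0 (z : site) : R := if insub z is Some v then f v else 0.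

Lemma at_or0E v : at_or0 (val v) = f v.
Proof. by rewrite /at_or0 valK. Qed.

Lemma sq_unit (s : int) : s ^+ 2 = 1 -> s = 1 \/ s = -1.
Proof. by move=> /eqP; rewrite -subr_eq0 subr_sqr_1 mulf_eq0 => /orP[]; rewrite ?subr_eq0 ?addr_eq0 => /eqP; [left|right]. Qed.

Definition on_square (z : site) (s1 s2 : int) (i k : nat) : site :=
  (z.1 + s1 * i%:Z, z.2 + s2 * k%:Z).

Lemma on_square_nm z s1 s2 J i k : s1 ^+ 2 = 1 -> s2 ^+ 2 = 1 -> (i <= J)%N -> (k <= J)%N ->
  (nm z <= rho)%N -> (nm (on_square z s1 s2 J J) <= rho)%N ->
  (nm (on_square z s1 s2 i k) <= rho)%N.
Proof.
move=> /sq_unit h1 /sq_unit h2; rewrite /on_square /nm /=.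
by case: h1 => ->; case: h2 => ->; rewrite ?mul1r ?mulN1r; lia.
Qed.

Lemma antidiag_energy_le z s1 s2 J : s1 ^+ 2 = 1 -> s2 ^+ 2 = 1 ->
  (nm z <= rho)%N -> (nm (on_square z s1 s2 J J) <= rho)%N ->
  \sum_(j < J) antidiag_energy (fun i k => at_or0 (on_square z s1 s2 i k)) j <= 2 * Phi.
Proof.
move=> e1 e2 z1 z2; apply: le_trans energy.
have inB i k : (i <= J)%N -> (k <= J)%N -> (nm (on_square z s1 s2 i k) <= N)%N.
  by move=> iJ kJ; apply: leq_trans (ltnW rhoN); apply: (on_square_nm (J := J)).
have h0 : (nm origin <= N)%N by [].
pose a i k : V N := insubd o (on_square z s1 s2 i k).
have aE i k : (i <= J)%N -> (k <= J)%N -> val (a i k) = on_square z s1 s2 i k.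
  by move=> iJ kJ; rewrite val_insubd mem_boxE inB.
have fE i k : (i <= J)%N -> (k <= J)%N -> at_or0 (on_square z s1 s2 i k) = f (a i k).
  by move=> iJ kJ; rewrite -aE // at_or0E.
have aD i k : (i <= J)%N -> (k <= J)%N -> a i k \in D /\ (nv (a i k) <= rho)%N.
  move=> iJ kJ; have : (nv (a i k) <= rho)%N by rewrite /nv aE //; apply: (on_square_nm (J := J)).
  by move=> h; split=> //; apply: rhoD.
have aadj i k i' k' : (i <= J)%N -> (k <= J)%N -> (i' <= J)%N -> (k' <= J)%N ->
    (i' = i.+1 /\ k' = k) \/ (i' = i /\ k' = k.+1) -> E (a i k) (a i' k').
  move=> iJ kJ iJ' kJ' h; have [d1 d2] := aD i k iJ kJ; have [d3 _] := aD i' k' iJ' kJ'.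
  rewrite /E /sink_graph d1 d3 /= andbT /adjN !aE // /adj /on_square /=.
  have := sq_unit e1; have := sq_unit e2.
  by case=> ->; case=> ->; rewrite ?mul1r ?mulN1r; case: h => -[-> ->]; lia.
have ainj i k i' k' : (i <= J)%N -> (k <= J)%N -> (i' <= J)%N -> (k' <= J)%N ->
    a i k = a i' k' -> i = i' /\ k = k'.
  move=> iJ kJ iJ' kJ' /(congr1 val); rewrite !aE // /on_square => -[].
  have := sq_unit e1; have := sq_unit e2.
  by case=> ->; case=> ->; rewrite ?mul1r ?mulN1r => h1 h2; split; lia.
apply: (@le_trans _ _ (\sum_(j < J) \sum_(i < j.+1) local_energy E D f (a i (j - i)%N))).
  apply: ler_sum => j _; apply: ler_sum => i _.
  have jJ := ltn_ord j; have ij : (i <= j)%N := ltn_ord i.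
  have [b1 b2 b3] : [/\ (i <= J)%N, (i.+1 <= J)%N & (j - i <= J)%N] by split; lia.
  have b4 : ((j - i).+1 <= J)%N by lia.
  rewrite !fE // /local_energy.
  have [d1 _] := aD _ _ b2 b3; have [d2 _] := aD _ _ b1 b4.
  have E1 : E (a i (j - i)%N) (a i.+1 (j - i)%N) by apply: aadj => //; left.
  have E2 : E (a i (j - i)%N) (a i (j - i).+1) by apply: aadj => //; right.
  rewrite (bigD1 (a i.+1 (j - i)%N)) ?d1 //= lerD2l (bigD1 (a i (j - i).+1)) /=; last first.
    rewrite d2 E2 /=; apply/eqP => /ainj; case=> //; lia.
  by rewrite lerDl sumr_ge0 // => w _; apply: sqr_ge0.
rewrite (eq_bigr (fun j : 'I_J => \sum_(i < J | (i < j.+1)%N) local_energy E D f (a i (j - i)%N))).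
  rewrite pair_big_dep /=.
  pose S := [set p : 'I_J * 'I_J | (p.2 < p.1.+1)%N].
  pose phi (p : 'I_J * 'I_J) := a p.2 (p.1 - p.2)%N.
  have inj : {in S &, injective phi}.
    move=> [j i] [j' i']; rewrite !inE /= => h h' /ainj /= H.
    have := ltn_ord j; have := ltn_ord j'; have := ltn_ord i; have := ltn_ord i'.
    move=> l1 l2 l3 l4; have {H} [||||e3 e4] := H; try lia.
    by congr pair; apply: val_inj => /=; lia.
  rewrite (eq_bigl (fun p => p \in S)) => [|p]; last by rewrite inE.
  rewrite -(big_imset (fun v => local_energy E D f v) inj) /=.
  rewrite [leRHS](bigID (mem (phi @: S))) /= ler_wpDr //.
    by apply: sumr_ge0 => w _; apply: local_energy_ge0.
  rewrite le_eqVlt; apply/orP; left; apply/eqP; apply: eq_bigl => v.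
  apply/esym/andb_idl => /imsetP[[j i]]; rewrite inE /= => h ->.
  have jl := ltn_ord j; have il := ltn_ord i.
  by have [] : a i (j - i)%N \in D /\ (nv (a i (j - i)%N) <= rho)%N by apply: aD; lia.
by move=> j _; rewrite (big_ord_widen J (fun i => local_energy E D f (a i (j - i)%N))).
Qed.

Lemma site_hop z s1 s2 J tau : 0 < tau -> s1 ^+ 2 = 1 -> s2 ^+ 2 = 1 ->
  (nm z <= rho)%N -> (nm (on_square z s1 s2 J J) <= rho)%N ->
  `|at_or0 (on_square z s1 s2 J J) - at_or0 z| <= 2 * tau * harm R J + 2 * Phi / tau.
Proof.
move=> t0 e1 e2 z1 z2.
have z00 : on_square z s1 s2 0 0 = z by rewrite /on_square !mulr0 !addr0; case: z {z1 z2}.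
have := @square_hop R (fun i k => at_or0 (on_square z s1 s2 i k)) tau (2 * Phi) J t0.
rewrite z00; apply; first exact: antidiag_energy_le.
have n1 : (- s1) ^+ 2 = 1 by rewrite sqrrN.
have n2 : (- s2) ^+ 2 = 1 by rewrite sqrrN.
have back i k : (i <= J)%N -> (k <= J)%N ->
    on_square z s1 s2 (J - i) (J - k) = on_square (on_square z s1 s2 J J) (- s1) (- s2) i k.
  move=> iJ kJ; rewrite /on_square /=; congr pair.
    have := sq_unit e1; case=> ->; rewrite ?opprK ?mul1r ?mulN1r; lia.
  have := sq_unit e2; case=> ->; rewrite ?opprK ?mul1r ?mulN1r; lia.
have h2 := @antidiag_energy_le _ _ _ J n1 n2 z2; apply: le_trans (h2 _); last first.
  by rewrite -back // subnn z00.
rewrite le_eqVlt; apply/orP; left; apply/eqP; apply: eq_bigr => j _; apply: eq_bigr => i _.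
have := ltn_ord j; have ij : (i <= j)%N := ltn_ord i => jJ.
by rewrite !back //; lia.
Qed.

Lemma harm_le J : (J <= rho)%N -> harm R J <= harm R rho.
Proof.
move=> le; rewrite /harm (big_ord_widen rho (fun j => j.+1%:R^-1) le).
rewrite [leRHS](bigID (fun j : 'I_rho => (j < J)%N)) /= lerDl sumr_ge0 //.
Qed.

(** Two diagonal hops lead from the origin to [(a, a)] and on to [(a + b, a - b)]; such sites are
    exactly those of even coordinate sum. *)
Lemma site_even z tau : 0 < tau -> (nm z <= rho)%N -> ~~ odd (absz (z.1 + z.2)) ->
  `|at_or0 z - at_or0 origin| <= 4 * tau * harm R rho + 4 * Phi / tau.
Proof.
move=> t0; case: z => p q /= zr ev.
have [a ea] : exists a : int, p + q = a + a.
  by exists (divz (p + q) 2); have := divz_eq (p + q) 2; rewrite /=; lia.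
pose b : int := p - a.
have pq : p = a + b /\ q = a - b by rewrite /b; split; lia.
have sgn (x : int) : exists s : int, s ^+ 2 = 1 /\ x = s * (absz x)%:Z.
  have [x0|x0] := leP 0 x; first by exists 1; rewrite expr1n mul1r; split=> //; lia.
  by exists (-1); rewrite sqrrN expr1n mulN1r; split=> //; lia.
have [s [s1 sa]] := sgn a; have [t [t1 tb]] := sgn b.
have nt : (- t) ^+ 2 = 1 by rewrite sqrrN.
have e1 : on_square origin s s `|a|%N `|a|%N = (a, a) by rewrite /on_square -sa !add0r.
have e2 : on_square (a, a) t (- t) `|b|%N `|b|%N = (p, q).
  by rewrite /on_square /= mulNr -tb; congr pair; case: pq => h1 h2; [exact: esym h1 | exact: esym h2].
have ar : (nm (a, a) <= rho)%N by move: zr; rewrite /nm /=; lia.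
have h1 := @site_hop origin s s `|a|%N tau t0 s1 s1 (leq0n _).
have h2 := @site_hop (a, a) t (- t) `|b|%N tau t0 t1 nt ar.
rewrite e1 in h1; rewrite e2 in h2; have {h1} h1 := h1 ar; have {h2} h2 := h2 zr.
have k1 : harm R `|a|%N <= harm R rho by apply: harm_le; move: ar; rewrite /nm /=; lia.
have k2 : harm R `|b|%N <= harm R rho by apply: harm_le; move: zr ar; rewrite /nm /=; lia.
have m1 : 2 * tau * harm R `|a|%N <= 2 * tau * harm R rho by rewrite ler_pM2l // mulr_gt0.
have m2 : 2 * tau * harm R `|b|%N <= 2 * tau * harm R rho by rewrite ler_pM2l // mulr_gt0.
rewrite (_ : _ - _ = (at_or0 (p, q) - at_or0 (a, a)) + (at_or0 (a, a) - at_or0 origin)); last by ring.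
by apply: le_trans (ler_normD _ _) _; move: h1 h2; lra.
Qed.

End SiteHop.

Lemma adj_parity x z : adj x z -> odd (absz (x.1 + x.2)) -> ~~ odd (absz (z.1 + z.2)).
Proof.
by rewrite adj_nbrs !inE => /or4P[]/eqP -> /=; case: x => p q /=; lia.
Qed.

Lemma adj_inward N (v : V N) : odd (absz ((val v).1 + (val v).2)) ->
  exists2 z, (nm z <= nv v)%N & adj (val v) z.
Proof.
rewrite /nv; case: (val v) => p q /= od; have [p0|p0] := eqVneq p 0.
  have [q0|q0] := leP q 0; [exists (p, q + 1) | exists (p, q - 1)];
    rewrite ?/nm ?/adj /=; lia.
by have [q0|q0] := leP p 0; [exists (p + 1, q) | exists (p - 1, q)];
  rewrite ?/nm ?/adj /=; lia.
Qed.

(** The values of [f] rise from 0 at [o] to 1 in the sink through two hops to an even site [w], at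
    most one edge to [v], and one arc to the sink. Each increment is bounded in terms of the
    flux. *)
Lemma flux_lower (R : realType) N rho (D : {set V N}) o (f : V N -> R) v u :
  (0 < rho < N)%N -> val o = origin -> (forall v, (nv v <= rho)%N -> v \in D) ->
  f o = 0 -> (forall v, v \notin D -> f v = 1) ->
  (forall v, v \in D :\ o -> (deg (sink_graph rho D) v)%:R * f v =
     \sum_(w | sink_graph rho D v w) f w) ->
  v \in D -> u \notin D -> sink_graph rho D v u ->
  1 <= 120 * harm R rho * flux (sink_graph rho D) o f.
Proof.
move=> /andP[r0 rN] oo rD fo f1 fh vD uD Evu; set E := sink_graph rho D in fh Evu *.
have oD : o \in D by apply: rD; rewrite /nv oo.
have symE : {in D &, symmetric E}.
  by move=> x y xD yD; rewrite /E /sink_graph xD yD /= andbT /adjN adj_sym andbT.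
set Phi := flux E o f.
have en := sum_local_energy symE oD fo f1 fh.
have vr : (nv v <= rho)%N by move: Evu; rewrite /E /sink_graph (negbTE uD) vD /= => /andP[].
have H1 : 1 <= harm R rho.
  rewrite /harm -(big_mkord xpredT (fun j => j.+1%:R^-1)) big_ltn // invr1 lerDl sumr_ge0 //.
(* With this [tau] the terms without [Phi] add up to at most 1/2 and the others to
   [55 * harm R rho * Phi]. *)
pose tau : R := (10 * harm R rho)^-1.
have H0 : 0 < harm R rho by lra.
have t0 : 0 < tau by rewrite invr_gt0 mulr_gt0.
have ti0 : 0 < tau^-1 by rewrite invrK mulr_gt0.
have Y (x c : R) : x ^+ 2 <= c -> x <= 2^-1 * (tau + c / tau).
  move=> xc; have := young 1 x t0; rewrite mul1r expr1n mulr1 => h.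
  apply: le_trans (ler_norm _) _; apply: le_trans h _.
  by apply: ler_wpM2l; rewrite ?invr_ge0 // lerD2l ler_pM2r.
have sk : 1 - f v <= 2^-1 * (tau + Phi / tau).
  by apply: Y; exact: (sink_energy symE oD fo f1 fh vD uD Evu).
have [w [wr wev wv]] : exists w : V N, [/\ (nv w <= rho)%N, ~~ odd (absz ((val w).1 + (val w).2)) &
    f v - f w <= 2^-1 * (tau + 2 * Phi / tau)].
  have [ev|od] := boolP (odd (absz ((val v).1 + (val v).2))); last first.
    exists v; split=> //; rewrite subrr.
    have : 0 <= Phi by apply: le_trans (sink_energy symE oD fo f1 fh vD uD Evu); apply: sqr_ge0.
    by move=> h; rewrite mulr_ge0 ?addr_ge0 ?divr_ge0 ?mulr_ge0 // ltW.
  have [z zr za] := adj_inward ev; have {}zr := leq_trans zr vr.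
  have zN : (nm z <= N)%N by apply: leq_trans zr (ltnW rN).
  have wD : at_site zN \in D by apply: rD.
  exists (at_site zN); split => //; first by rewrite val_at; apply: adj_parity za ev.
  have Evw : E v (at_site zN) by rewrite /E /sink_graph vD wD /= andbT.
  rewrite -opprB; apply: Y; rewrite sqrrN.
  exact: (edge_energy symE oD fo f1 fh vD wD Evw).
have := site_even rN rD en t0 wr wev; rewrite at_or0E.
have -> : at_or0 f origin = f o by rewrite -[origin]oo at_or0E.
rewrite fo subr0 => /(le_trans (ler_norm _)) hw.
have tH : tau * harm R rho = 10^-1 by rewrite /tau; field; rewrite gt_eqF.
have ti : Phi / tau = 10 * harm R rho * Phi by rewrite /tau invrK mulrC.
have tl : tau <= 10^-1 by rewrite /tau lef_pV2 ?posrE ?mulr_gt0 //; lra.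
by move: sk wv hw; rewrite -!mulrA ti tH; lra.
Qed.

(** Normalized, [off_root] is the harmonic function equal to 0 at [o] and 1 on the sink; by
    [forest_attach_le] its flux is at most the ratio of the two forest counts. *)
Lemma resistance_bound (R : realType) N rho (D : {set V N}) o :
  (0 < rho < N)%N -> val o = origin -> (forall v, (nv v <= rho)%N -> v \in D) ->
  (0 < #|rec (sink_graph rho D) D|)%N ->
  #|rec (sink_graph rho D) (D :\ o)|%:R <=
    120 * harm R rho * #|rec (sink_graph rho D) D|%:R :> R.
Proof.
move=> hr oo rD; rewrite card_gt0 => /set0Pn[xi xir]; set E := sink_graph rho D in xir *.
have oD : o \in D by apply: rD; rewrite /nv oo.
have symE : {in D &, symmetric E}.
  by move=> x y xD yD; rewrite /E /sink_graph xD yD /= andbT /adjN adj_sym andbT.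
(* A recurrent configuration exists, so [D] itself is not forbidden and some vertex of [D] has an
   arc to the sink. *)
have [v vD [u uD Evu]] : exists2 v, v \in D & exists2 u, u \notin D & E v u.
  have /recP[st _ al] := xir; have D0 : D != set0 by apply/set0Pn; exists o.
  have [v vD le] := allowedP _ _ _ al D (subxx _) D0; exists v => //.
  have : (0 < nb E (~: D) v)%N by have := st v vD; have := nbC E D v; lia.
  by rewrite card_gt0 => /set0Pn[u]; rewrite !inE => /andP[uD Evu]; exists u.
have f0 : (0 < #|forest E (D :\ o)|)%N.
  by rewrite -rec_forest card_gt0; apply/set0Pn; exists (cut_cfg o xi); apply: rec_cut.
rewrite !rec_forest; set m := #|forest E (D :\ o)|; rewrite -/m in f0.
have m0 : 0 < m%:R :> R by rewrite ltr0n.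
pose f w : R := (off_root E D o w)%:R / m%:R.
have oA : o \notin D :\ o by rewrite !inE eqxx.
have h := @flux_lower R N rho D o f v u hr oo rD _ _ _ vD uD Evu.
have {h} h : 1 <= 120 * harm R rho * flux E o f.
  apply: h.
  - by rewrite /f /off_root nbad_dead // inE eqxx mul0n mul0r.
  - move=> w wD; rewrite /f /off_root nbad_dead; last by rewrite !inE negb_and wD orbT.
    rewrite inE (_ : w == o = false) ?mul1n ?divff ?gt_eqF //.
    by apply: contraNF wD => /eqP ->.
  move=> w wA; rewrite /f mulrA -natrM off_root_harmonic // natr_sum mulr_suml.
  by [].
have -> : #|forest E (D :\ o)|%:R = m%:R * 1 :> R by rewrite mulr1.
apply: le_trans (ler_wpM2l (ltW m0) h) _.
have -> : m%:R * (120 * harm R rho * flux E o f) =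
  120 * harm R rho * (\sum_(w | E o w) off_root E D o w)%N%:R.
  rewrite mulrCA; congr (_ * _); rewrite natr_sum /flux mulr_sumr.
  by apply: eq_bigr => w _; rewrite /f mulrCA divff ?mulr1 // gt_eqF.
rewrite ler_wpM2l //.
  by rewrite mulr_ge0 // sumr_ge0.
rewrite ler_nat; apply: (leq_trans _ (forest_attach_le E oD)).
by apply: leq_sum => w _; rewrite off_rootE.
Qed.

Lemma harm_pow2 (R : realType) l J : (J <= 2 ^ l)%N -> harm R J <= l%:R + 1.
Proof.
move=> J2; apply: le_trans (harm_le R J2) _; elim: l {J2} => [|l IH].
  by rewrite /harm expn0 big_ord1 invr1 add0r.
have e : (2 ^ l.+1 = 2 ^ l + 2 ^ l)%N by rewrite expnS mul2n addnn.
rewrite /harm -(big_mkord xpredT (fun j => j.+1%:R^-1)) e.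
rewrite (@big_cat_nat _ _ _ (2 ^ l)) ?leq_addr //= -[l.+1%:R]natr1.
have : \sum_(2 ^ l <= j < 2 ^ l + 2 ^ l) j.+1%:R^-1 <= 1 :> R.
  apply: (@le_trans _ _ (\sum_(2 ^ l <= j < 2 ^ l + 2 ^ l) ((2 ^ l)%N%:R)^-1)).
    apply: ler_sum_nat => j /andP[lj _]; rewrite lef_pV2 ?posrE ?ltr0n ?expn_gt0 // ler_nat.
    exact: leqW.
  rewrite sumr_const_nat addKn -[leLHS]mulr_natr mulVf ?lexx // pnatr_eq0 -lt0n expn_gt0.
by move: IH; rewrite /harm -(big_mkord xpredT (fun j => j.+1%:R^-1)); lra.
Qed.

Local Close Scope ring_scope.

Section BadBurning.
Variable T : finType.
Implicit Types (E : rel T) (A B R : {set T}).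

Lemma good_mono E A B B' R F y : B \subset B' -> good A B R F y -> good A B' R F y.
Proof.
move=> BB /goodP[h1 h2]; apply/goodP; split=> // x xy xA.
by apply: (subsetP BB); apply: h2.
Qed.

(** A difference of two instances of [card_burn_good], since both the fire and the good paths are
    monotone in the confining set. *)
Lemma card_burn_escapes E A B o y : o \notin A -> y \in A ->
  #|[set xi in rec E A | (y \in burn E A setT [set o] (hgt xi)) &&
                         (y \notin burn E A B [set o] (hgt xi))]| =
  #|[set F in forest E A | escapes A B o y F]|.
Proof.
move=> oA yA; have oR : [set o] \subset ~: A by rewrite sub1set inE.
have yo : y \notin [set o] by rewrite inE; apply: contraNneq oA => <-.
have c C : #|[set xi in rec E A | y \in burn E A C [set o] (hgt xi)]| =
          #|[set F in forest E A | good A C [set o] F y]|.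
  rewrite -(@card_burn_good _ E A C [set o] y oR) ?inE ?yA //.
  by apply: eq_card => xi; rewrite !in_set; move: yo; rewrite inE => /negbTE ->.
have := c setT; have := c B.
have s1 : #|[set xi in rec E A | y \in burn E A setT [set o] (hgt xi)]| =
   #|[set xi in rec E A | y \in burn E A B [set o] (hgt xi)]| +
   #|[set xi in rec E A | (y \in burn E A setT [set o] (hgt xi)) &&
                         (y \notin burn E A B [set o] (hgt xi))]|.
  rewrite -(cardsID [set xi | y \in burn E A B [set o] (hgt xi)]).
  congr (_ + _); apply: eq_card => xi; rewrite !in_set; last by rewrite andbC -andbA.
  rewrite -andbA; congr (_ && _); apply: andb_idl.
  by apply: (subsetP (burn_monoB _ _ _ _ (subsetT B))).
have s2 : #|[set F in forest E A | good A setT [set o] F y]| =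
   #|[set F in forest E A | good A B [set o] F y]| +
   #|[set F in forest E A | escapes A B o y F]|.
  rewrite -(cardsID [set F | good A B [set o] F y]).
  congr (_ + _); apply: eq_card => F; rewrite !in_set; last first.
    by rewrite /escapes andbC -andbA.
  rewrite -andbA; congr (_ && _); apply: andb_idl.
  exact: (good_mono E (subsetT B)).
lia.
Qed.

End BadBurning.

(** * Confined waves *)

Section Legal.
Variables (T : eqType) (nbr : rel T).
Implicit Types (c : T -> nat) (l : seq T) (x y : T).

(* Toppling sequences with the last toppling at the head of the list. *)
Fixpoint legal c l : bool :=
  if l is x :: l' then
    legal c l' && (4 + 4 * count_mem x l' <= c x + count (fun y => nbr y x) l')
  else true.

Lemma eq_legal c c' l : {in l, c =1 c'} -> legal c l = legal c' l.
Proof.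
elim: l => //= x l IH h; rewrite h ?mem_head // IH // => y yl.
by rewrite h // inE yl orbT.
Qed.

End Legal.

Lemma count_sum (T : finType) (P : pred T) (l : seq T) :
  count P l = \sum_(w | P w) count_mem w l.
Proof.
elim: l => [|x l IH] /=; first by rewrite big1.
rewrite big_split /= -IH; congr addn.
have [Px|Px] := boolP (P x).
  by rewrite (bigD1 x) //= eqxx big1 ?addn0 // => w /andP[_ wx]; rewrite eq_sym (negbTE wx).
rewrite big1 // => w Pw; case: eqP => // xw.
by rewrite xw Pw in Px.
Qed.

(* A waves-by-waves comparison on shrinking regions [Z k]: as long as the k-th
   wave restricted to [Y k] covers [Z k.+1], the toppling numbers on [Z k.+1] can
   be realised by toppling only sites of the initial region. *)
Section Cascade.
Variables (T : finType) (E adjT : rel T) (D : {set T}) (o : T) (C : {set T}).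
Hypotheses (symE : {in D &, symmetric E}) (oD : o \in D) (CD : C \subset D).
Hypothesis symA : symmetric adjT.
Hypothesis EC : forall v w, v \in C -> E v w = adjT v w.
Hypothesis degC : forall v, v \in C -> deg E v = 4.
Variables (K : nat) (Z Y : nat -> {set T}).
Hypotheses (ZC : forall k, k < K -> Z k \subset C) (YZ : forall k, k < K -> Y k \subset Z k).
Hypothesis oY : forall k, k < K -> o \in Y k.
Hypothesis YZ1 : forall k v w, k < K -> v \in Y k -> adjT v w -> (w \in Z k) || (w \notin D).
Hypothesis ZY : forall k, k < K -> Z k.+1 \subset Y k.

Definition bad_wave k (xi : cfg T) := [exists y in Z k.+1,
  (y \in burn E (D :\ o) setT [set o] (hgt xi)) &&
  (y \notin burn E (D :\ o) (Y k) [set o] (hgt xi))].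

Lemma card_bad_wave k : k < K ->
  #|[set xi in rec E (D :\ o) | bad_wave k xi]| <=
  \sum_(y in Z k.+1) #|[set F in forest E (D :\ o) | escapes (D :\ o) (Y k) o y F]|.
Proof.
move=> kK; have oA : o \notin D :\ o by rewrite !inE eqxx.
pose X y := [set xi in rec E (D :\ o) | (y \in burn E (D :\ o) setT [set o] (hgt xi)) &&
  (y \notin burn E (D :\ o) (Y k) [set o] (hgt xi))].
apply: (@leq_trans (\sum_(y in Z k.+1) #|X y|)).
  apply: (@leq_trans #|\bigcup_(y in Z k.+1) X y|).
    apply/subset_leq_card/subsetP => xi; rewrite inE => /andP[xr /existsP[y /andP[yZ hy]]].
    by apply/bigcupP; exists y => //; rewrite inE xr.
  elim/big_rec2: _ => [|z m B _ hB]; first by rewrite cards0.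
  by rewrite (leq_trans (leq_card_setU _ _)) // leq_add2l.
apply: leq_sum => y yZ; have [->|yo] := eqVneq y o.
  rewrite (_ : #|X o| = 0) //; apply/eqP; rewrite cards_eq0; apply/eqP/setP => xi.
  rewrite in_set0; apply/negP; rewrite inE => /and3P[_ ob _].
  by have := subsetP (burn_sub _ _ _ _ _) o ob; rewrite !inE eqxx.
rewrite (card_burn_escapes _ _ oA) // !inE yo; apply: (subsetP CD).
by apply: (subsetP (ZC kK)); apply: (subsetP (YZ kK)); apply: (subsetP (ZY kK)).
Qed.

Variable eta : cfg T.
Hypothesis etar : eta \in rec E D.

(** Wave [k] is appended as [o] followed by the confined fire in a burning order. Toppling numbers
    are exact on [Z k], which contains all neighbours in [D] of [Y k], so the burning inequality
    gives legality. They stay exact on [Z k.+1], where the confined fire misses nothing. *)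
Lemma cascade : (forall k, k < K -> active E D o eta k -> ~~ bad_wave k (cut_state E D o eta k)) ->
  forall k, k <= K -> exists l, [/\ legal adjT (start o eta) l, all (mem C) l,
    forall v, v \in Z k -> count_mem v l = fires E D o eta k v &
    forall v, count_mem v l <= fires E D o eta k v].
Proof.
move=> ok; elim=> [|k IH] kK.
  by exists [::]; split=> // v _; rewrite /fires big_ord0.
have [l [ll lC lZ lle]] := IH (ltnW kK).
have [act|nact] := boolP (active E D o eta k); last first.
  exists l; split=> // v; rewrite firesS (negbTE nact) addn0 // => vZ.
  by apply: lZ; apply: (subsetP (YZ kK)); apply: (subsetP (ZY kK)).
pose c := state E D o eta k; pose B := burn E (D :\ o) (Y k) [set o] c.
have eB C' : burn E (D :\ o) C' [set o] (hgt (cut_state E D o eta k)) = burn E (D :\ o) C' [set o] c.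
  by apply: eq_burn => v vA; rewrite hgt_cut_state // vA.
have BA : B \subset (D :\ o) :&: Y k by apply: burn_sub.
have oB : o \notin B.
  by apply/negP => /(subsetP BA); rewrite !inE eqxx.
have YC v : v \in Y k -> v \in C by move=> h; apply: (subsetP (ZC kK)); apply: (subsetP (YZ kK)).
have lap v : v \in Y k ->
    c v + 4 * count_mem v l = start o eta v + count (fun y => adjT y v) l.
  move=> vY; have := laplacian_state E oD eta k v; rewrite degC ?YC // lZ ?(subsetP (YZ kK)) //.
  move=> ->; congr addn; rewrite count_sum; apply: eq_big => w.
    by rewrite EC ?YC // symA.
  rewrite EC ?YC // => vw; have /orP[wZ|wD] := YZ1 kK vY vw; first by rewrite lZ.
  by have := lle w; rewrite fires_out // leqn0 => /eqP ->.
have oYk := oY kK.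
have l0 : legal adjT (start o eta) (o :: l).
  by rewrite /= ll -lap //= -(degC (YC o oYk)); rewrite leq_add2r.
have [s [sl sC sc]] : exists s, [/\ legal adjT (start o eta) (s ++ o :: l),
    all (mem C) s & forall v, count_mem v s = (v \in B)].
  rewrite /B; apply: (burn_ind (P := fun X => exists s, [/\ legal adjT (start o eta) (s ++ o :: l),
    all (mem C) s & forall v, count_mem v s = (v \in X)])).
    by exists [::]; split=> // v; rewrite inE.
  move=> X v XB [s [sl sC sX]] vB vX le; have := subsetP BA v vB; rewrite inE => /andP[vA vY].
  have vo : v != o by move: vA; rewrite !inE => /andP[].
  have oX : o \notin X by apply: contra oB; apply: (subsetP XB).
  exists (v :: s); split=> [||w] /=; last 1 first.
  - by rewrite sX !inE eq_sym; case: (eqVneq w v) => [->|] //=; rewrite (negbTE vX).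
  - rewrite sl !count_cat /= sX (negbTE vX) add0n eq_sym (negbTE vo) add0n.
    have := lap v vY; have := le; rewrite degC ?YC //.
    have -> : nb E ([set o] :|: X) v = adjT o v + count (fun y => adjT y v) s.
      rewrite (nbD1 _ _ (u := o)) ?inE ?eqxx // EC ?YC // symA; congr addn.
      rewrite count_sum nb_sum big_mkcond [RHS]big_mkcond /=; apply: eq_bigr => w _.
      rewrite sX !inE EC ?YC // symA; case: (eqVneq w o) => [->|] /=.
        by rewrite (negbTE oX); case: (adjT _ _).
      by case: (w \in X); case: (adjT w v).
    rewrite -/c; move: (c v) (count_mem v l) (start _ _ _) (count _ s) (count _ l) => a1 a2 a3 a4 a5.
    by clear; lia.
  by rewrite YC.
have cE v : count_mem v (s ++ o :: l) = (v \in B) + ((o == v) + count_mem v l).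
  by rewrite count_cat sc.
have wE v : (v \in wave E D o c) = (o == v) || (v \in burn E (D :\ o) setT [set o] c).
  by rewrite in_setU1 eq_sym.
have BW v : v \in B -> v \in burn E (D :\ o) setT [set o] c.
  by apply: (subsetP (burn_monoB _ _ _ _ (subsetT _))).
exists (s ++ o :: l); split=> //.
- by rewrite all_cat sC /= YC.
- move=> v vZ; rewrite cE firesS act /= wE.
  have vY : v \in Y k by apply: (subsetP (ZY kK)).
  rewrite lZ ?(subsetP (YZ kK)) // addnA addnC; congr addn.
  have [<-|vo] := eqVneq o v; first by rewrite (negbTE oB).
  rewrite addn0 /=; congr nat_of_bool; apply/idP/idP; first exact: BW.
  move=> vb; have := ok k kK act; rewrite negb_exists => /forallP/(_ v).
  by rewrite vZ /= !eB -/c -/B vb /= negbK.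
move=> v; rewrite cE firesS act /= wE addnA addnC leq_add //.
have [<-|vo] := eqVneq o v; first by rewrite (negbTE oB).
by rewrite addn0 /=; case: (boolP (v \in B)) => // /BW ->.
Qed.

End Cascade.

(** Active waves form an initial segment, so their number among the first [K] is the smaller of [K]
    and the number of topplings at [o]. *)
Lemma sum_active_ge (T : finType) (E : rel T) (D : {set T}) (o : T) eta K m :
  {in D &, symmetric E} -> o \in D -> eta \in rec E D ->
  m <= K -> m <= fires E D o eta (wave_bound E D o) o ->
  m <= \sum_(k < K) active E D o eta k.
Proof.
move=> symE oD er mK mn; have mono := @active_le _ E D o eta.
case: K mK => [|K] mK; first by rewrite (leq_trans mK).
have [a|na] := boolP (active E D o eta K).
  rewrite (eq_bigr (fun=> 1)) ?sum1_card ?card_ord // => k _.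
  by rewrite (mono k K) // -ltnS.
apply: leq_trans mn _; rewrite fires_o; set w := wave_bound E D o.
have z k : K <= k -> (active E D o eta k : nat) = 0.
  by move=> Kk; case: (boolP (active _ _ _ _ k)) => // /(mono K k Kk) a; rewrite a in na.
rewrite -!(big_mkord xpredT (fun k => active E D o eta k : nat)).
have [wK|Kw] := leqP w K.+1; first by rewrite [leqRHS](@big_cat_nat _ _ _ w) //= leq_addr.
rewrite [leqLHS](@big_cat_nat _ _ _ K.+1) ?(ltnW Kw) //= [X in _ + X](_ : _ = 0) ?addn0 //.
rewrite big_nat big1 // => k /andP[h _].
by rewrite z // ltnW.
Qed.

Local Open Scope ring_scope.

(** * Logarithmic growth of the mean toppling numbers *)

Section GreenGrowth.
Variables (R : realType) (N rho : nat) (D : {set V N}) (o : V N).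
Hypotheses (rhoN : (rho < N)%N) (oo : val o = origin).
Hypothesis rhoD : forall v, (nv v <= rho)%N -> v \in D.
Let E := sink_graph rho D.

Lemma sink_in v u : (nv v <= rho)%N -> E v u = adjN v u.
Proof. by move=> vr; rewrite /E /sink_graph rhoD // vr orbT andbT. Qed.

Lemma sink_deg v : (nv v <= rho)%N -> deg E v = 4%N.
Proof.
move=> vr; rewrite -(card_adj (v := v)); last exact: leq_ltn_trans vr rhoN.
by rewrite /deg /nb; apply: eq_card => u; rewrite !inE sink_in.
Qed.

Lemma sink_sym : {in D &, symmetric E}.
Proof. by move=> x y xD yD; rewrite /E /sink_graph xD yD /= !andbT /adjN adj_sym. Qed.

Lemma sink_o : o \in D. Proof. by apply: rhoD; rewrite /nv oo. Qed.

(** Normalizes [qk] to unit charge at the origin, see [qk_origin]. *)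
Definition kap : R := (4 * ln 63)^-1.

Lemma kap_gt0 : 0 < kap.
Proof. by rewrite invr_gt0 mulr_gt0 // ln_gt0 // ltr1n. Qed.

(** In [A] the charges of [U] and [B] at [o] cancel; elsewhere [U] is harmonic and [B]
    superharmonic. Hence [A] is subharmonic, and its value 0 at [o] is at most its maximum over the
    level [r.+1]. *)
Lemma green_growth r : (r < rho)%N ->
  exists2 y, nv y = r.+1 &
    kap * ln r.+1%:R * #|rec E D|%:R <=
    (total_fires E D o o)%:R - (total_fires E D o y)%:R.
Proof.
move=> rr; pose U v : R := (total_fires E D o v)%:R.
pose m : R := #|rec E D|%:R.
pose B (v : V N) : R := kap * m * (qk R (val v) - qk R origin).
pose A v : R := U o - U v - B v.
have yN : (nm (r.+1%:Z, 0%R) <= N)%N by rewrite /nm /=; lia.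
pose S := [set v : V N | nv v == r.+1].
have y0S : at_site yN \in S by rewrite inE /nv val_at /nm /=; lia.
have [y yS hy] := @Order.TotalTheory.arg_maxP _ _ _ (at_site yN) (mem S) A y0S.
have k0 := kap_gt0; have m0 : 0 <= m by [].
have k4 : kap * (4 * ln 63) = 1.
  by rewrite /kap mulVf // mulf_neq0 // gt_eqF // ln_gt0 // ltr1n.
have ye : nv y = r.+1 by have : y \in S by []; rewrite inE => /eqP.
exists y => //; have main : A o - A y <= 0.
  apply: (@max_principle R _ E [set v | (nv v <= r)%N] (fun v => A v - A y)) => [v|X XY X0|v u|].
  - rewrite inE => vr; have vrho : (nv v <= rho)%N by lia.
    have vN : (nv v < N)%N by lia.
    have := @total_firesE _ E D o sink_o v (rhoD vrho).
    rewrite sink_deg // => /(congr1 (fun n => n%:R : R)).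
    rewrite natrM natrD natrM natr_sum -/m => eU0.
    have {eU0} eU : 4 * U v = (v == o)%:R * m + \sum_(u | E v u) U u := eU0.
    have eE : (fun u => E v u) =1 adjN v by move=> u; apply: sink_in.
    have sB : \sum_(u | E v u) B u = kap * m * (lap4 (qk R) (val v) - 4 * qk R origin).
      rewrite (eq_bigl _ _ eE) (sum_lap (fun z => kap * m * (qk R z - qk R origin))) //.
      by rewrite /lap4; ring.
    have sc (x : R) : \sum_(u | E v u) x = 4 * x.
      rewrite sumr_const (_ : #|_| = 4%N) ?mulr_natl // -(sink_deg vrho).
      by apply: eq_card => u; rewrite !inE.
    have -> : \sum_(u | E v u) (A u - A y) = 4 * U o - \sum_(u | E v u) U u - \sum_(u | E v u) B u - 4 * A y.
      by rewrite /A !big_split /= !sumrN !sc; ring.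
    rewrite sB mulrBr lerD2r /A /B; move: eU; case: (eqVneq v o) => [->|vo].
      rewrite mul1r oo; have := qk_origin R; move: k4.
      set a := lap4 _ _; set q := qk R origin; set b := ln _ => k4 ha.
      have -> : kap * m * (a - 4 * q) = m by rewrite ha mulrAC k4 mul1r.
      by rewrite (subrr q) mulr0 subr0 subrr mulr0; lra.
    rewrite mul0r add0r => eU; have /(qk_super R) : val v != origin.
      by rewrite -[origin]oo; apply: contra vo => /eqP /val_inj ->.
    set a := lap4 _ _; set q := qk R origin => h.
    have : kap * m * a <= kap * m * (4 * qk R (val v)) by rewrite ler_wpM2l // mulr_ge0 // ltW.
    by lra.
  - have rN : (r.+1 <= N)%N by lia.
    have Xr v : v \in X -> (nv v <= r)%N by move=> vX; have := subsetP XY v vX; rewrite inE.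
    apply: (box_exit rN _ _ X0) => v; last by move=> vX; rewrite ltnS; apply: Xr.
    by move=> u vX; apply: sink_in; have := Xr v vX; lia.
  - rewrite !inE -ltnNge => vr Evu ur.
    have uS : u \in S.
      rewrite inE eqn_leq ur andbT; apply: leq_trans (_ : (nv v).+1 <= _)%N; last by [].
      by apply: adj_nm; rewrite -/(adjN v u) -sink_in //; lia.
    by rewrite subr_le0; apply: hy.
  by rewrite inE /nv oo.
have Ao : A o = 0 by rewrite /A /B subrr oo subrr mulr0 subrr.
move: main; rewrite Ao sub0r oppr_le0 /A subr_ge0 => /(le_trans _); apply.
rewrite /B -/m mulrAC; apply: ler_wpM2l; first by rewrite mulr_ge0 // ltW.
have y1 : val y != origin by rewrite -nm_eq0 -/(nv y) ye.
rewrite /qk /pk eqxx (negbTE y1) lnV ?posrE // opprK -lnM ?posrE //; last first.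
  by have := nm_gt0_sq R y1; lra.
have r1 : 1 <= r.+1%:R :> R by rewrite ler1n.
have /andP[hs _] := nm_sq R (val y); rewrite -/(nv y) ye in hs.
rewrite ler_ln ?posrE ?mulr_gt0 //; last by have := nm_gt0_sq R y1; lra.
by nra.
Qed.

(** [fires_gap] with degree 4, iterated along a lattice path of length [l] from the origin. *)
Fixpoint gap l := if l is l'.+1 then (4 * gap l' + 4)%N else 0%N.

Lemma gap_mono l l' : (l <= l')%N -> (gap l <= gap l')%N.
Proof.
elim: l' => [|l' IH]; first by rewrite leqn0 => /eqP ->.
by rewrite leq_eqVlt => /orP[/eqP ->//|/IH h] /=; lia.
Qed.

Lemma step_inward (v : V N) : val v != origin -> exists2 w : V N, adjN w v &
  (nv w <= nv v)%N /\ (`|(val w).1| + `|(val w).2| < `|(val v).1| + `|(val v).2|)%N.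
Proof.
move=> v0; have [z [z1 z2 z3]] : exists z, [/\ adj z (val v), (nm z <= nm (val v))%N &
   (`|z.1| + `|z.2| < `|(val v).1| + `|(val v).2|)%N].
  move: v0; case: (val v) => p q; rewrite /origin xpair_eqE /nm /adj /= => v0.
  have [p0|p0|p0] := ltgtP p 0.
  - by exists (p + 1, q); split=> /=; lia.
  - by exists (p - 1, q); split=> /=; lia.
  have [q0|q0|q0] := ltgtP q 0.
  - by exists (p, q + 1); split=> /=; lia.
  - by exists (p, q - 1); split=> /=; lia.
  by move: v0; rewrite p0 q0 !eqxx.
have zN : (nm z <= N)%N by apply: leq_trans z2 (nvN v).
by exists (at_site zN).
Qed.

Lemma fires_gap_le eta v : eta \in rec E D -> (nv v <= rho)%N ->
  (fires E D o eta (wave_bound E D o) o - fires E D o eta (wave_bound E D o) v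
    <= gap (2 * nv v))%N.
Proof.
move=> er vr; apply: leq_trans (_ : gap (`|(val v).1| + `|(val v).2|) <= _)%N; last first.
  by apply: gap_mono; rewrite /nv /nm; case: (val v) => p q /=; lia.
have [n] := ubnP (`|(val v).1| + `|(val v).2|)%N; elim: n v vr => // n IH v vr hn.
have [v0|v0] := eqVneq (val v) origin.
  have -> : v = o by apply: val_inj; rewrite v0 oo.
  by rewrite subnn.
have [w wv [w1 w2]] := step_inward v0.
have wr : (nv w <= rho)%N by apply: leq_trans w1 vr.
have h := IH w wr (leq_trans w2 hn).
have Ewv : E w v by rewrite sink_in.
have := fires_gap sink_o er (rhoD wr) Ewv; rewrite sink_deg // => hg.
apply: leq_trans hg _; apply: leq_trans (_ : gap (`|(val w).1| + `|(val w).2|).+1 <= _)%N.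
  by rewrite /= leq_add2r leq_mul2l h orbT.
exact: gap_mono.
Qed.

Lemma min_fires_growth r K : (r < rho)%N -> (gap (2 * r.+1) <= K)%N ->
  kap * ln r.+1%:R * #|rec E D|%:R <=
    (\sum_(eta in rec E D) \sum_(k < K) active E D o eta k)%N%:R.
Proof.
move=> rr gK; have [y yr hy] := green_growth rr; apply: le_trans hy _.
rewrite -natrB; last by apply: leq_sum => eta _; apply: fires_le.
rewrite ler_nat /total_fires -sumnB; last by move=> eta _; apply: fires_le.
apply: leq_sum => eta er; apply: (sum_active_ge sink_sym sink_o er); last exact: leq_subr.
apply: leq_trans gK; rewrite -yr; apply: fires_gap_le => //.
by rewrite yr.
Qed.

End GreenGrowth.

Lemma sum_ltn_ord K S : (S <= K)%N -> (\sum_(k < K) (k < S)%N)%N = S.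
Proof.
move=> SK; rewrite -[RHS]card_ord -sum1_card (big_ord_widen K (fun=> 1%N) SK) [RHS]big_mkcond.
by apply: eq_bigr => k _; case: (k < S)%N.
Qed.

Lemma exists_small (R : realType) (C eps : R) (a n0 : nat) : 0 < eps -> 0 <= C ->
  exists2 n, (n0 <= n)%N & C * ((a * n)%N%:R + 1) * 2^-1 ^+ n <= eps.
Proof.
move=> e0 C0; pose D := C * (2 * a%:R + 1) + 1.
have D0 : 0 < D by rewrite /D; have : 0 <= a%:R :> R by []; nra.
have [||q hq] := @exists_lam_pow R (2^-1) (eps / D); first by lra.
  by rewrite divr_gt0.
(* With [n = m + m], one factor [2^-1 ^+ m] absorbs the linear growth and the other the constant. *)
pose m := (q + n0)%N; exists (m + m)%N; first by rewrite /m; lia.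
have hm : 2^-1 ^+ m <= eps / D.
  by apply: le_trans hq; apply: ler_wiXn2l; [lra | lra | apply: leq_addr].
have m2 : m%:R * 2^-1 ^+ m <= 1 :> R.
  by rewrite exprVn ler_pdivrMr ?exprn_gt0 // mul1r -natrX ler_nat ltnW // ltn_expl.
have x0 : 0 <= 2^-1 ^+ m :> R by rewrite exprn_ge0.
have x1 : 2^-1 ^+ m <= 1 :> R by rewrite exprn_ile1 //; lra.
rewrite exprD natrM natrD; rewrite ler_pdivlMr // in hm; rewrite /D in hm.
have a0 : 0 <= a%:R :> R by [].
move: (2^-1 ^+ m) x0 x1 hm m2 => x x0 x1 hm m2.
apply: le_trans hm; rewrite (_ : _ * (x * x) = x * (C * (2 * a%:R * (m%:R * x) + x))); last by ring.
apply: ler_wpM2l => //; rewrite -[leLHS]addr0; apply: lerD => //.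
apply: ler_wpM2l => //; apply: lerD => //.
by rewrite -[leRHS]mulr1; apply: ler_wpM2l => //; rewrite mulr_ge0.
Qed.

Lemma waves_in_box (R : realType) (M : R) : 0 < M -> exists rho K : nat,
  forall N (D : {set V N}) o, (rho < N)%N -> val o = origin ->
    (forall v, (nv v <= rho)%N -> v \in D) ->
  M * #|rec (sink_graph rho D) D|%:R <=
  (\sum_(eta in rec (sink_graph rho D) D) \sum_(k < K)
    `[< exists l, [/\ legal (@adjN N) (start o eta) l, all (mem (ball N rho)) l
                    & (k < count_mem o l)%N] >])%N%:R.
Proof.
move=> M0; have [Lam [Q [L16 Q0 hE]]] := sum_escapes R.
have k0 := kap_gt0 R.
(* Twice [M], because up to [M] will be lost to bad waves. *)
have [r hr] : exists r, 2 * M <= kap R * ln r.+1%:R.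
  exists (Num.bound (expR (2 * M / kap R))).
  rewrite -ler_pdivrMl // [leLHS]mulrC -ler_expR lnK ?posrE //.
  apply: le_trans (ltW (archi_boundP _)) _; first exact: expR_ge0.
  by rewrite ler_nat.
(* [a * i0] equals [Lam * e 0], which bounds the binary logarithm of [rho]; the factor [a] is fixed
   before [i0]. *)
pose K := gap (2 * r.+1); pose a := (Lam * (Q + 1) ^ K)%N.
(* One [K] counts the waves that may be bad, the other is the trivial bound on what one bad
   configuration loses; 120 comes from [resistance_bound]. *)
have [||i0 ri hi] := @exists_small R ((K * K)%N%:R * 120) M a r.+1 => //.
(* Exponents drop by the factor [Q + 1] at each wave: [Q] for the detour estimate, one more to keep
   [Y k] strictly inside [Z k]. *)
pose e k := ((Q + 1) ^ (K - k) * i0)%N.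
have i00 : (0 < i0)%N by apply: leq_trans ri.
have eS k : (k < K)%N -> e k = ((Q + 1) * e k.+1)%N.
  by move=> kK; rewrite /e -(subnSK kK) expnS mulnA.
have ei k : (i0 <= e k)%N by rewrite /e leq_pmull // expn_gt0 addn1.
have e0 k : (k <= K)%N -> (e k <= e 0)%N.
  by move=> kK; rewrite /e leq_mul2r leq_exp2l ?subn0 ?leq_subr ?orbT // addn1.
have Lle i j : (i <= j)%N -> (Lam ^ i <= Lam ^ j)%N.
  by move=> ij; apply: leq_pexp2l => //; apply: leq_trans L16.
have Llt i j : (i < j)%N -> (Lam ^ i < Lam ^ j)%N.
  by move=> ij; rewrite ltn_exp2l //; apply: leq_trans L16.
exists (Lam ^ e 0)%N, K; set rho := (Lam ^ e 0)%N => N D o rN oo rD.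
set E := sink_graph rho D.
have rr : (r < rho)%N.
  apply: leq_trans ri _; apply: leq_trans (ei 0%N) _; apply: ltnW; apply: ltn_expl.
  exact: leq_trans L16.
have symE : {in D &, symmetric E} by apply: (@sink_sym N rho D).
have oD : o \in D by apply: sink_o oo rD.
have [m0|m0] := posnP #|rec E D|; first by rewrite m0 mulr0.
pose Z k := ball N (Lam ^ e k); pose Y k := ball N (Lam ^ (Q * e k.+1)).
have CD : ball N rho \subset D by apply/subsetP => v; rewrite inE; apply: rD.
have ZC k : (k < K)%N -> Z k \subset ball N rho.
  move=> kK; apply/subsetP => v; rewrite !inE => /leq_trans; apply.
  by apply: Lle; apply: e0; apply: ltnW.
have YZlt k : (k < K)%N -> (Lam ^ (Q * e k.+1) < Lam ^ e k)%N.
  by move=> kK; apply: Llt; rewrite (eS k kK) ltn_pmul2r ?addn1 //; apply: leq_trans (ei k.+1).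
have YZ k : (k < K)%N -> Y k \subset Z k.
  by move=> kK; apply/subsetP => v; rewrite !inE => h; apply: leq_trans h (ltnW (YZlt k kK)).
have oY k : (k < K)%N -> o \in Y k by move=> kK; rewrite inE /nv oo.
have YZ1 k v w : (k < K)%N -> v \in Y k -> adjN v w -> (w \in Z k) || (w \notin D).
  move=> kK; rewrite !inE => h vw; apply/orP; left; apply: leq_trans (YZlt k kK).
  by apply: leq_trans (adj_nm vw) _; rewrite ltnS.
have ZY k : (k < K)%N -> Z k.+1 \subset Y k.
  move=> kK; apply/subsetP => v; rewrite !inE => h; apply: leq_trans h _.
  by apply: Lle; rewrite leq_pmull.
have EC v w : v \in ball N rho -> E v w = adjN v w by rewrite inE => h; apply: sink_in.
have degC v : v \in ball N rho -> deg E v = 4%N by rewrite inE => h; apply: sink_deg.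
have symA : symmetric (@adjN N) by move=> x y; rewrite /adjN adj_sym.
pose bad k := bad_wave E D o Z Y k.
set A := D :\ o.
have cbad k : (k < K)%N -> #|[set xi in rec E A | bad k xi]|%:R <= 2^-1 ^+ i0 * #|rec E A|%:R :> R.
  move=> kK; have := card_bad_wave E o CD ZC YZ ZY kK; rewrite -(ler_nat R) => /le_trans; apply.
  have ek0 : (0 < e k.+1)%N by apply: leq_trans (ei k.+1).
  have ekr : (Lam ^ (Q * e k.+1) <= rho)%N.
    by apply: leq_trans (ltnW (YZlt k kK)) _; apply: Lle; apply: e0; apply: ltnW.
  apply: le_trans (hE N rho D o (e k.+1) rN oo rD ek0 ekr) _.
  rewrite rec_forest; apply: ler_wpM2r => //.
  by apply: ler_wiXn2l; [lra | lra | apply: ei].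
pose act eta k := active E D o eta k.
pose b eta := (\sum_(k < K) (act eta k && bad k (cut_state E D o eta k)))%N.
pose TT eta := (\sum_(k < K) `[< exists l, [/\ legal (@adjN N) (start o eta) l,
   all (mem (ball N rho)) l & (k < count_mem o l)%N] >])%N.
have Sle eta : eta \in rec E D -> (\sum_(k < K) act eta k <= TT eta + K * b eta)%N.
  move=> er; have SK : (\sum_(k < K) act eta k <= K)%N.
    by rewrite -[leqRHS]card_ord -sum1_card; apply: leq_sum => k _; case: (act eta k).
  have [b0|b0] := posnP (b eta); last by apply: leq_trans SK _; rewrite (leq_trans _ (leq_addl _ _)) // leq_pmulr.
  have ok k : (k < K)%N -> act eta k -> ~~ bad k (cut_state E D o eta k).
    move=> kK ak; move/eqP: b0; rewrite /b sum_nat_eq0 => /forallP/(_ (Ordinal kK)) /=.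
    by rewrite ak /=; case: (bad _ _).
  have [l [ll lC lZ _]] := cascade oD symA EC degC ZC YZ oY YZ1 ZY er ok (leqnn K).
  rewrite b0 muln0 addn0 -[leqLHS](sum_ltn_ord SK); apply: leq_sum => k _.
  case: (boolP (k < _)%N) => // kS; rewrite (_ : `[< _ >] = true) //; apply/asboolP.
  exists l; split=> //; rewrite lZ; last by rewrite inE /nv oo.
  by rewrite fires_o.
have sb : (\sum_(eta in rec E D) b eta)%N%:R <= K%:R * (2^-1 ^+ i0 * #|rec E A|%:R) :> R.
  rewrite /b exchange_big /= natr_sum mulr_natl -[K in _ *+ K]card_ord -sumr_const.
  apply: ler_sum => k _; apply: le_trans (cbad k (ltn_ord k)); rewrite ler_nat.
  apply: leq_trans (sum_waves E oD k.+1 (bad k)); apply: leq_sum => eta _.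
  by rewrite big_ord_recr /= leq_addl.
have h1 := min_fires_growth R rN oo rD rr (leqnn _); rewrite -/E -/K in h1.
have h2 : (\sum_(eta in rec E D) \sum_(k < K) act eta k)%N%:R <=
   (\sum_(eta in rec E D) TT eta)%N%:R + K%:R * (\sum_(eta in rec E D) b eta)%N%:R :> R.
  rewrite -natrM -natrD ler_nat big_distrr /= -big_split /=.
  by apply: leq_sum => eta er; apply: Sle.
have hr0 : (0 < rho < N)%N by rewrite rN andbT (leq_trans _ rr).
have h3 := resistance_bound R hr0 oo rD m0; rewrite -/E -/A in h3.
have h4 : harm R rho <= (a * i0)%N%:R + 1.
  have -> : (a * i0 = Lam * e 0)%N by rewrite /a /e subn0 mulnA.
  apply: harm_pow2; rewrite /rho [leqRHS]expnM leq_exp2r; last exact: leq_trans (ei 0%N).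
  by apply: ltnW; apply: ltn_expl.
set m : R := #|rec E D|%:R in h1 h3 *; have mp : 0 < m by rewrite ltr0n.
have h5 : #|rec E A|%:R <= 120 * ((a * i0)%N%:R + 1) * m.
  apply: le_trans h3 _; apply: ler_wpM2r; first exact: ltW.
  by apply: ler_wpM2l.
have x0 : 0 <= 2^-1 ^+ i0 :> R by rewrite exprn_ge0.
have h6 : K%:R * (\sum_(eta in rec E D) b eta)%N%:R <= M * m.
  apply: le_trans (ler_wpM2l _ sb) _ => //.
  have KK : 0 <= K%:R * K%:R :> R by [].
  apply: (@le_trans _ _ (K%:R * K%:R * (2^-1 ^+ i0 * #|rec E A|%:R))); first by rewrite [leLHS]mulrA lexx.
  apply: le_trans (ler_wpM2l KK (ler_wpM2l x0 h5)) _.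
  rewrite [leLHS](_ : _ = (K * K)%N%:R * 120 * ((a * i0)%N%:R + 1) * 2^-1 ^+ i0 * m).
    by rewrite ler_wpM2r // ltW.
  by rewrite natrM; ring.
have h7 : 2 * M * m <= kap R * ln r.+1%:R * m by rewrite ler_wpM2r // ltW.
by move: h1 h2 h6 h7; rewrite /act /TT; lra.
Qed.

(** * The stationary distribution *)

Section UniformChain.
Variables (R : realType) (S X : finType) (a : X -> S -> S -> bool).
Variables (Rec : {set S}) (top : S) (rk : S -> nat) (p : S -> R).
Hypothesis aex : forall x s, s \in Rec -> exists2 t, t \in Rec & a x s t.
Hypothesis auniq : forall x s t t', s \in Rec -> a x s t -> a x s t' -> t = t'.
Hypothesis ainj : forall x s s' t, s \in Rec -> s' \in Rec -> a x s t -> a x s' t -> s = s'.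
Hypothesis adown : forall s, s != top -> exists x t, a x s t && (rk t < rk s)%N.
Hypothesis topR : top \in Rec.
Hypothesis X0 : (0 < #|X|)%N.
Let T s t : R := #|[set x | a x s t]|%:R / #|X|%:R.
Hypothesis p0 : forall s, 0 <= p s.
Hypothesis p1 : \sum_s p s = 1.
Hypothesis pT : forall t, \sum_s p s * T s t = p t.

Let X0R : 0 < #|X|%:R :> R. Proof. by rewrite ltr0n. Qed.

Lemma trans_ge0 s t : 0 <= T s t. Proof. by rewrite divr_ge0. Qed.

Lemma trans_gt0 x s t : a x s t -> 0 < T s t.
Proof.
move=> h; rewrite divr_gt0 // ltr0n card_gt0; apply/set0Pn.
by exists x; rewrite inE.
Qed.

Lemma act_sig x s : {t | s \in Rec -> (t \in Rec) && a x s t}.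
Proof.
case: (boolP (s \in Rec)) => [sR|]; last by exists s.
have h : exists t, (t \in Rec) && a x s t by have [t tR h] := aex x sR; exists t; rewrite tR.
by exists (xchoose h) => _; apply: (xchooseP h).
Qed.

Definition act x s := sval (act_sig x s).

Lemma actP x s : s \in Rec -> (act x s \in Rec) /\ a x s (act x s).
Proof. by move=> sR; have := svalP (act_sig x s) sR => /andP[]. Qed.

Lemma act_eq x s t : s \in Rec -> a x s t = (t == act x s).
Proof.
move=> sR; have [tR h] := actP x sR; apply/idP/eqP => [h'|->//].
exact: auniq sR h' h.
Qed.

Lemma act_inj x : {in Rec &, injective (act x)}.
Proof.
move=> s s' sR sR' e; have [_ h] := actP x sR; have [_ h'] := actP x sR'.
by apply: (ainj sR sR' h); rewrite e.
Qed.

Lemma act_surj x t : t \in Rec -> exists2 s, s \in Rec & act x s = t.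
Proof.
move=> tR; have : act x @: Rec = Rec.
  apply/eqP; rewrite eqEcard card_in_imset ?leqnn ?andbT; last exact: act_inj.
  by apply/subsetP => y /imsetP[s sR ->]; have [] := actP x sR.
by move/setP/(_ t); rewrite tR => /imsetP[s sR ->]; exists s.
Qed.

Lemma sum_trans s t (P : pred S) : T s t = (\sum_x a x s t)%N%:R / #|X|%:R.
Proof.
congr (_%:R / _); rewrite -sum1_card big_mkcond /=; apply: eq_bigr => x _.
by rewrite inE; case: (a x s t).
Qed.

Lemma row_sum s : s \in Rec -> \sum_(t in Rec) T s t = 1.
Proof.
move=> sR; rewrite (eq_bigr _ (fun t _ => sum_trans s t xpredT)) -mulr_suml -natr_sum.
rewrite exchange_big /= (eq_bigr (fun=> 1%N)) => [|x _].
  by rewrite sum1_card divff // gt_eqF.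
rewrite (bigD1 (act x s)) /=; last by have [] := actP x sR.
rewrite act_eq // eqxx big1 // => t /andP[_ ne].
by rewrite act_eq // (negbTE ne).
Qed.

Lemma col_sum t : t \in Rec -> \sum_(s in Rec) T s t = 1.
Proof.
move=> tR; rewrite (eq_bigr _ (fun s _ => sum_trans s t xpredT)) -mulr_suml -natr_sum.
rewrite exchange_big /= (eq_bigr (fun=> 1%N)) => [|x _].
  by rewrite sum1_card divff // gt_eqF.
have [s sR st] := act_surj x tR.
rewrite (bigD1 s) //= act_eq // -st eqxx big1 // => s' /andP[sR' ne].
rewrite act_eq //; case: eqP => // e.
by rewrite (act_inj sR sR' e) eqxx in ne.
Qed.

(** As [Rec] is closed, the mass balance forbids any flow into it from outside. By induction on
    [rk], a state outside [Rec] has a possible step into [Rec] or to a state of lower rank already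
    known to be null, so its own mass vanishes. *)
Lemma transient s : s \notin Rec -> p s = 0.
Proof.
have in0 s' t : s' \notin Rec -> t \in Rec -> p s' * T s' t = 0.
  have e : \sum_(t in Rec) \sum_(s | s \notin Rec) p s * T s t = 0.
    have : \sum_(t in Rec) p t = \sum_(t in Rec) \sum_(s in Rec) p s * T s t +
                                \sum_(t in Rec) \sum_(s | s \notin Rec) p s * T s t.
      rewrite -big_split /=; apply: eq_bigr => u _.
      by rewrite -pT [LHS](bigID (mem Rec)).
    rewrite exchange_big /=.
    have -> : \sum_(s in Rec) \sum_(t in Rec) p s * T s t = \sum_(s in Rec) p s.
      by apply: eq_bigr => u uR; rewrite -mulr_sumr row_sum // mulr1.
    by move/eqP; rewrite -subr_eq0 opprD addrA subrr sub0r oppr_eq0 => /eqP.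
  have ge u v : 0 <= p u * T u v by rewrite mulr_ge0 // trans_ge0.
  move=> sR tR; apply/eqP; rewrite eq_le ge andbT -e (bigD1 t) //= (bigD1 s') //=.
  rewrite -addrA lerDl addr_ge0 ?sumr_ge0 // => u _; exact: sumr_ge0.
have [n] := ubnP (rk s); elim: n s => // n IH s hn sR.
have st : s != top by apply: contraNneq sR => ->.
have [x [t /andP[axt rkt]]] := adown st.
have T0 := trans_gt0 axt.
have : p s * T s t = 0.
  have [tR|tR] := boolP (t \in Rec); first exact: in0.
  have := pT t; rewrite (IH t) //; last by apply: leq_trans rkt _.
  move=> h; apply/eqP; rewrite eq_le mulr_ge0 ?trans_ge0 // andbT -h (bigD1 s) //=.
  by rewrite lerDl sumr_ge0 // => u _; rewrite mulr_ge0 // trans_ge0.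
by move/eqP; rewrite mulf_eq0 (gt_eqF T0) orbF => /eqP.
Qed.

(** On [Rec] the matrix is doubly stochastic, so a maximum forces maxima at all predecessors. Each
    [act x] is a bijection, hence the set of maxima is also stable forwards, and steps of decreasing
    [rk] lead to [top]. *)
Lemma max_at_top (q : S -> R) :
  (forall t, t \in Rec -> \sum_(s in Rec) q s * T s t = q t) ->
  forall s, s \in Rec -> q s <= q top.
Proof.
move=> qT s0 s0R.
have [m mR hm] := @Order.TotalTheory.arg_maxP _ _ _ top (mem Rec) q topR.
pose M := [set s in Rec | q s == q m].
have back x s : s \in Rec -> act x s \in M -> s \in M.
  move=> sR; rewrite !inE sR => /andP[aR /eqP e]; have [_ h] := actP x sR.
  have T0 := trans_gt0 h; set t := act x s in e h aR T0.
  have z : \sum_(u in Rec) (q m - q u) * T u t = 0.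
    rewrite (eq_bigr (fun u => q m * T u t - q u * T u t)) => [|u _]; last by rewrite mulrBl.
    by rewrite sumrB -mulr_sumr col_sum // qT // e mulr1 subrr.
  have ge u : u \in Rec -> 0 <= (q m - q u) * T u t.
    by move=> uR; rewrite mulr_ge0 ?trans_ge0 // subr_ge0; apply: hm.
  have : (q m - q s) * T s t <= 0.
    rewrite -z (bigD1 s) //= lerDl; apply: sumr_ge0 => u /andP[uR _]; exact: ge.
  rewrite pmulr_lle0 // subr_le0 => le /=; apply/eqP/le_anti/andP.
  by split; [exact: hm | exact: le].
have forth x s : s \in M -> act x s \in M.
  move=> sM; pose P := [set s in Rec | act x s \in M].
  have PM : P \subset M by apply/subsetP => u; rewrite inE => /andP[]; apply: back.
  have imP : act x @: P = M.
    apply/setP => t; apply/imsetP/idP => [[u]|tM]; first by rewrite inE => /andP[_ h] ->.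
    have tR : t \in Rec by move: tM; rewrite inE => /andP[].
    by have [u uR ut] := act_surj x tR; exists u; rewrite // inE uR ut.
  have : P = M.
    apply/eqP; rewrite eqEcard PM -imP card_in_imset ?leqnn //.
    by move=> u v; rewrite !inE => /andP[uR _] /andP[vR _]; apply: act_inj.
  by move/setP/(_ s); rewrite sM inE => /andP[].
suff topM : top \in M by move: topM; rewrite inE => /andP[_ /eqP ->]; apply: hm.
have mM : m \in M by rewrite inE eqxx andbT.
suff desc n s : (rk s < n)%N -> s \in M -> top \in M by apply: (desc (rk m).+1 m).
elim: n s => // n IH s hn sM; have [<- //|st] := eqVneq s top.
have [x [t /andP[axt rt]]] := adown st.
have sR : s \in Rec by move: sM; rewrite inE => /andP[].
move: axt; rewrite act_eq // => /eqP te; apply: (IH t); first exact: leq_trans rt _.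
by rewrite te; apply: forth.
Qed.

Lemma uniform_on_rec s : p s = (s \in Rec)%:R / #|Rec|%:R.
Proof.
have pR t : t \in Rec -> \sum_(s in Rec) p s * T s t = p t.
  move=> _; rewrite -[RHS]pT [RHS](bigID (mem Rec)) /= [X in _ + X]big1 ?addr0 // => u uR.
  by rewrite transient // mul0r.
have c t : t \in Rec -> p t = p top.
  move=> tR; apply: le_anti; rewrite max_at_top //=.
  rewrite -lerN2; apply: (@max_at_top (fun s => - p s)) => // u uR.
  by rewrite -(pR u uR) -sumrN; apply: eq_bigr => v _; rewrite mulNr.
have := p1; rewrite (bigID (mem Rec)) /= [X in _ + X]big1 ?addr0; last exact: transient.
rewrite (eq_bigr _ c) sumr_const => h; rewrite -mulr_natr in h.
have R0 : #|Rec|%:R != 0 :> R by rewrite pnatr_eq0 -lt0n card_gt0; apply/set0Pn; exists top.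
case: (boolP (s \in Rec)) => sR; last by rewrite transient // mul0r.
by rewrite c // -[LHS](mulfK R0) h.
Qed.

End UniformChain.

(** * Conditioning on the outside *)

Section Conditioning.
Variables (T : finType) (adjT : rel T) (D0 C : {set T}).
Hypothesis CD0 : C \subset D0.
Implicit Types (D X : {set T}) (xi : cfg T).

Definition full_graph : rel T := fun v u => (v \in D0) && adjT v u.
(** Outside [C], being unburnt bounds the height by the number of unburnt neighbours, as if the arcs
    to the burnt region were removed; a vertex of [C] is not tested by the fire and keeps them. *)
Definition part_graph D : rel T := fun v u => [&& v \in D, adjT v u & (u \in D) || (v \in C)].
Let E := full_graph.

(* The vertices burnt by a fire from the outside that may not enter [C]. *)
Definition burnt xi := burn E D0 (~: C) (~: D0) (hgt xi).
Definition unburnt xi := D0 :\: burnt xi.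
Definition frozen xi : {set T} * cfg T :=
  (unburnt xi, [ffun v => if v \in unburnt xi then ord0 else xi v]).
Definition restr D xi : cfg T := [ffun v => if v \in D then xi v else ord0].

Lemma burnt_sub xi : burnt xi \subset D0 :\: C.
Proof. by rewrite setDE; apply: burn_sub. Qed.

Lemma unburntC xi : ~: unburnt xi = ~: D0 :|: burnt xi.
Proof. by rewrite /unburnt setCD. Qed.

Lemma C_unburnt xi : C \subset unburnt xi.
Proof.
apply/subsetP => v vC; rewrite inE (subsetP CD0) // andbT; apply/negP => vb.
by have := subsetP (burnt_sub xi) v vb; rewrite inE vC.
Qed.

Lemma nb_part D X v : D \subset D0 -> X \subset D -> v \in D ->
  nb (part_graph D) X v = nb E X v.
Proof.
move=> DD XD vD; apply: eq_card => u; rewrite !inE /part_graph /E /full_graph vD (subsetP DD) //=.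
by case: (boolP (u \in X)) => // uX; rewrite (subsetP XD) // andbT.
Qed.

Lemma deg_part D v : D \subset D0 -> v \in D ->
  deg (part_graph D) v = if v \in C then deg E v else nb E D v.
Proof.
move=> DD vD; case: ifP => vC; apply: eq_card => u;
  rewrite !inE /part_graph /E /full_graph vD (subsetP DD) //= vC ?orbT ?orbF ?andbT //.
by rewrite andbC.
Qed.

Lemma hgt_restr D xi v : hgt (restr D xi) v = if v \in D then hgt xi v else 0%N.
Proof. by rewrite /hgt ffunE; case: ifP. Qed.

Lemma restr_rec xi : xi \in rec E D0 ->
  restr (unburnt xi) xi \in rec (part_graph (unburnt xi)) (unburnt xi).
Proof.
move=> /recP[st z al]; set D := unburnt xi.
have DD : D \subset D0 by apply: subsetDl.
apply/recP; split=> [v vD|v vD|].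
- rewrite hgt_restr vD deg_part //; case: ifP => vC; first by apply: st; apply: (subsetP DD).
  move: (vD); rewrite inE => /andP[vb v0]; rewrite ltnNge; apply: contra vb => le.
  apply: (bclosedP _ _ _ _ _ _ (burn_closed E D0 (~: C) (~: D0) (hgt xi))) => //.
    by rewrite inE vC.
  by rewrite -unburntC -/D -(nbC E D v) leq_add2r.
- by rewrite hgt_restr (negbTE vD).
apply/allowedP => X XD X0; have [v vX le] := allowedP _ _ _ al X (subset_trans XD DD) X0.
exists v => //; have vD := subsetP XD v vX.
by rewrite nb_part // hgt_restr vD.
Qed.

Section Glue.
Variables (xi0 ze : cfg T).
Hypothesis h0 : xi0 \in rec E D0.
Let D := unburnt xi0.
Hypothesis hz : ze \in rec (part_graph D) D.
Definition glue_cfg : cfg T := [ffun v => if v \in D then ze v else xi0 v].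

Lemma hgt_glue v : hgt glue_cfg v = if v \in D then hgt ze v else hgt xi0 v.
Proof. by rewrite /hgt ffunE; case: ifP. Qed.

Lemma glue_unburnt : unburnt glue_cfg = D.
Proof.
have DD : D \subset D0 by apply: subsetDl.
have [st _ _] := recP _ _ _ hz.
have sub : burnt glue_cfg \subset burnt xi0.
  apply: burn_min; apply/bclosedP => v v0 vC; rewrite -unburntC -/D hgt_glue => le.
  apply: contraLR le => vb; have vD : v \in D by rewrite inE vb.
  have := st v vD; rewrite deg_part //; move: vC; rewrite inE => /negbTE ->.
  by rewrite vD -ltnNge -(nbC E D v) ltn_add2r.
rewrite /unburnt; congr (_ :\: _); apply/eqP; rewrite eqEsubset sub /=.
apply: burn_min; apply/bclosedP => v v0 vC le.
have [vb|vb] := boolP (v \in burnt xi0).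
  apply: (bclosedP _ _ _ _ _ _ (burn_closed E D0 (~: C) (~: D0) (hgt glue_cfg))) => //.
  by rewrite hgt_glue (_ : v \in D = false) // inE vb.
case/negP: vb; apply: (bclosedP _ _ _ _ _ _ (burn_closed E D0 (~: C) (~: D0) (hgt xi0))) => //.
by apply: leq_trans le _; rewrite leq_add2l; apply: nbS; apply: setUS.
Qed.

(** A set meeting the burnt region is served by its first vertex to burn, any other set by the
    recurrence of [ze]. *)
Lemma glue_rec : glue_cfg \in rec E D0.
Proof.
have DD : D \subset D0 by apply: subsetDl.
have [st _ al] := recP _ _ _ hz; have [st0 z0 _] := recP _ _ _ h0.
apply/recP; split=> [v vD|v vD|].
- rewrite hgt_glue; case: ifP => vD'; last exact: st0.
  apply: leq_trans (st v vD') _; rewrite deg_part //; case: ifP => // _; exact: nb_deg.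
- by rewrite hgt_glue (_ : v \in D = false) ?z0 //; apply: contraNF vD; apply: (subsetP DD).
apply/allowedP => X XD X0; have [XB|XB] := eqVneq (burnt xi0 :\: X) (burnt xi0); last first.
  have [v [vB vX le]] := burn_step (subsetDl _ _) XB.
  have vX' : v \in X by move: vX; rewrite inE vB andbT negbK.
  exists v => //; rewrite hgt_glue (_ : v \in D = false); last by rewrite inE vB.
  have : (nb E X v + nb E (~: D0 :|: burnt xi0 :\: X) v <= deg E v)%N.
    rewrite -nbU; last by rewrite -setI_eq0; apply/eqP/setP => x; rewrite !inE;
      case: (boolP (x \in X)) => //= xX; rewrite orbF (subsetP XD).
    exact: nb_deg.
  by rewrite -/(burnt xi0) in le *; lia.
have XD' : X \subset D.
  apply/subsetP => x xX; rewrite inE (subsetP XD) // andbT; apply/negP => xb.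
  by move: xb; rewrite -XB inE xX.
have [v vX le] := allowedP _ _ _ al X XD' X0; have vD := subsetP XD' v vX.
by exists v => //; rewrite hgt_glue vD -(nb_part DD XD' vD).
Qed.

Lemma glue_frozen : frozen glue_cfg = frozen xi0.
Proof.
rewrite /frozen glue_unburnt; congr pair; apply/ffunP => v; rewrite !ffunE.
by case: ifP => // ->.
Qed.

Lemma restr_glue : restr D glue_cfg = ze.
Proof.
have [_ z _] := recP _ _ _ hz; apply/ffunP => v; rewrite !ffunE.
have [vD|vD] := boolP (v \in D); first by [].
by apply: val_inj; have e := z v vD; exact: esym e.
Qed.

End Glue.

(** Restriction to [D] is a bijection from the fibre onto the recurrent configurations of the part
    graph, with inverse [glue_cfg]; [phi] depends only on [C], which lies in [D]. *)
Lemma fiber_sum (R : realType) xi0 (phi : cfg T -> R) : xi0 \in rec E D0 ->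
  (forall xi xi', {in C, hgt xi =1 hgt xi'} -> phi xi = phi xi') ->
  \sum_(xi in rec E D0 | frozen xi == frozen xi0) phi xi =
  \sum_(ze in rec (part_graph (unburnt xi0)) (unburnt xi0)) phi ze.
Proof.
move=> h0 hphi; set D := unburnt xi0.
pose Fb := [set xi in rec E D0 | frozen xi == frozen xi0].
have inj : {in Fb &, injective (restr D)}.
  move=> x y; rewrite !inE => /andP[_ /eqP[ux fx]] /andP[_ /eqP[uy fy]] e.
  apply/ffunP => v; have := congr1 (fun f : cfg T => f v) e; rewrite !ffunE.
  have := congr1 (fun f : cfg T => f v) fx; have := congr1 (fun f : cfg T => f v) fy.
  rewrite !ffunE ux uy -/D; case: ifP => // _ -> -> _; exact: erefl.
have im : restr D @: Fb = rec (part_graph D) D.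
  apply/setP => ze; apply/imsetP/idP => [[xi]|hz].
    rewrite inE => /andP[xr /eqP[ux _]] ->; rewrite /D -ux; exact: restr_rec.
  exists (glue_cfg xi0 ze); last by rewrite restr_glue.
  by rewrite inE glue_rec // glue_frozen // eqxx.
rewrite -im big_imset //=; apply: eq_big => [xi|xi _]; first by rewrite inE.
apply: hphi => v vC; rewrite hgt_restr (subsetP (C_unburnt xi0)) //.
Qed.

Lemma conditioned_sum (R : realType) (M : R) (phi : cfg T -> R) :
  (forall xi xi', {in C, hgt xi =1 hgt xi'} -> phi xi = phi xi') ->
  (forall D, C \subset D ->
     M * #|rec (part_graph D) D|%:R <= \sum_(ze in rec (part_graph D) D) phi ze) ->
  M * #|rec E D0|%:R <= \sum_(xi in rec E D0) phi xi.
Proof.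
move=> hphi hM; rewrite -[#|rec E D0|]sum1_card natr_sum mulr_sumr.
rewrite (partition_big frozen xpredT) //= [leRHS](partition_big frozen xpredT) //=.
apply: ler_sum => k _.
case: (pickP [pred xi | (xi \in rec E D0) && (frozen xi == k)]) => [xi0|no]; last first.
  by rewrite !big_pred0.
move=> /andP[h0 /eqP <-]; rewrite (fiber_sum h0 hphi).
have e := fiber_sum (phi := fun=> M * 1%:R) h0 (fun _ _ _ => erefl); cbv beta in e.
rewrite {}e.
apply: le_trans (hM _ (C_unburnt xi0)).
by rewrite sumr_const mulr1 mulr_natr.
Qed.

End Conditioning.

(** The last toppling of [u] had enough particles and the later ones only add to [u]. This makes the
    subtraction in [after_list] exact. *)
Lemma legal_ge (T : eqType) (nbr : rel T) c l u : legal nbr c l ->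
  (4 * count_mem u l <= c u + count (fun y => nbr y u) l)%N.
Proof.
elim: l => //= x l IH /andP[/IH h le]; case: (eqVneq x u) le => [->|_]; last by lia.
by lia.
Qed.

(** * The sandpile chain in the box *)

Section BoxChain.
Variable L : nat.
Let N := L.+1.
Implicit Types (c : V L -> nat) (x y : V L) (v u : V N).

(** The box sits inside the box of radius [L.+1], whose outer layer is the sink, so every vertex of
    [D0] has four neighbours. *)
Definition D0 : {set V N} := ball N L.
Definition E0 : rel (V N) := sink_graph L D0.

Lemma up_proof y : (nm (val y) <= N)%N.
Proof. by apply: leq_trans (nvN y) _. Qed.

Definition up y : V N := at_site (up_proof y).

Lemma val_up y : val (up y) = val y. Proof. by []. Qed.

Lemma up_inj : injective up.
Proof. by move=> x y /(congr1 val); rewrite !val_up => /val_inj. Qed.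

Lemma up_D0 y : up y \in D0.
Proof. by rewrite inE /nv val_up; apply: nvN. Qed.

Lemma D0_up v : v \in D0 -> exists y, v = up y.
Proof.
by rewrite inE => h; exists (at_site h); apply: val_inj; rewrite val_up !val_at.
Qed.

Lemma D0P v : (nv v <= L)%N -> v \in D0. Proof. by rewrite inE. Qed.

Lemma LN : (L < N)%N. Proof. by []. Qed.

Lemma E0E v u : v \in D0 -> E0 v u = adjN v u.
Proof. by rewrite inE => h; apply: (@sink_in N L D0 D0P). Qed.

Lemma deg0 v : v \in D0 -> deg E0 v = 4%N.
Proof. by rewrite inE => h; apply: (@sink_deg N L D0 LN D0P). Qed.

Lemma E0_sym : {in D0 &, symmetric E0}.
Proof. exact: sink_sym. Qed.

Lemma adjN_up x y : adjN (up x) (up y) = adjV x y. Proof. by []. Qed.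

Definition ext c v : nat := if insub (val v) is Some y then c y else 0%N.

Lemma ext_up c y : ext c (up y) = c y.
Proof. by rewrite /ext val_up valK. Qed.

Definition lift_cfg (eta : stableV L) : cfg (V N) :=
  [ffun v => inord (ext (fun y => nat_of_ord (eta y)) v)].

Lemma card_gt4 : (4 <= #|{: V N}|)%N.
Proof.
have h : (nm origin <= L)%N by [].
rewrite -(deg0 (up_D0 (at_site h))) /deg /nb; apply: max_card.
Qed.

Lemma hgt_up eta y : hgt (lift_cfg eta) (up y) = eta y.
Proof.
rewrite /hgt ffunE ext_up inordK //; have := card_gt4; have := ltn_ord (eta y).
by move: (#|{: V N}|) => n; lia.
Qed.

Lemma hgt_out eta v : v \notin D0 -> hgt (lift_cfg eta) v = 0%N.
Proof.
move=> vD; rewrite /hgt ffunE /ext; case: insubP => [y _ e|_]; last by rewrite inordK.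
case/negP: vD; rewrite inE /nv -e; exact: nvN.
Qed.

Lemma lift_inj : injective lift_cfg.
Proof.
move=> eta eta' e; apply/ffunP => y; apply: val_inj.
by rewrite /= -[LHS]hgt_up e hgt_up.
Qed.

Definition recV : {set stableV L} := [set eta | lift_cfg eta \in rec E0 D0].

Lemma recVP eta : (eta \in recV) = allowed E0 D0 (hgt (lift_cfg eta)).
Proof.
rewrite inE; apply/recP/idP => [[]//|al]; split=> // v vD; last exact: hgt_out.
by have [y ->] := D0_up vD; rewrite hgt_up deg0 ?up_D0.
Qed.

Lemma lift_surj xi : xi \in rec E0 D0 -> exists2 eta, eta \in recV & lift_cfg eta = xi.
Proof.
move=> xr; have [st z al] := recP _ _ _ xr.
pose eta : stableV L := [ffun y => inord (hgt xi (up y))].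
have e v : hgt (lift_cfg eta) v = hgt xi v.
  have [vD|vD] := boolP (v \in D0); last by rewrite hgt_out // z.
  have [y ->] := D0_up vD; rewrite hgt_up ffunE inordK //.
  by rewrite -(deg0 (up_D0 y)); apply: st; apply: up_D0.
have le : lift_cfg eta = xi by apply/ffunP => v; apply: val_inj; apply: e.
by exists eta => //; rewrite inE le.
Qed.

Definition goes x (eta xi : stableV L) : bool :=
  `[< stabilizes_to (@adjV L) (add_particle x (fun y => nat_of_ord (eta y)))
        (fun y => nat_of_ord (xi y)) >].

Lemma sum_pred1 (T : finType) (P : pred T) (a : T) : (\sum_(u | P u) (u == a) = P a)%N.
Proof.
rewrite big_mkcond (bigD1 a) //= eqxx big1 ?addn0 => [|u /negbTE ->]; last by case: ifP.
by case: (P a).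
Qed.

Lemma topples_ext c c' : topples_to (@adjV L) c c' ->
  (exists w : V N -> nat, (forall v, v \notin D0 -> w v = 0%N) /\
     forall v, v \in D0 -> (ext c' v + 4 * w v = ext c v + \sum_(u | E0 v u) w u)%N) /\
  (allowed E0 D0 (ext c) -> allowed E0 D0 (ext c')).
Proof.
elim=> [|xi x _ [[w [w0 hw]] al] uns].
  by split=> //; exists (fun=> 0%N); split=> // v _; rewrite muln0 big1.
have irr : {in D0, irreflexive E0} by move=> v vD; rewrite E0E // /adjN adj_irr.
have irrV y : adjV y y = false by apply: adj_irr.
split.
  exists (fun u => w u + (u == up x))%N; split=> [v vD|v vD].
    rewrite w0 //; case: eqP => // e; by rewrite e up_D0 in vD.
  have := hw v vD; rewrite big_split /= sum_pred1 E0E //.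
  have [y ->] := D0_up vD; rewrite !ext_up adjN_up (inj_eq up_inj) /topple.
  case: (eqVneq y x) uns => [->|yx]; rewrite /unstable ?irrV; first by lia.
  by rewrite (_ : adjV x y = adjV y x); [lia | apply: adj_sym].
move/al; apply: (@allowed_topple _ E0 D0 _ _ (up x) E0_sym irr (up_D0 x)) => u uD.
have [y ->] := D0_up uD; rewrite (inj_eq up_inj) !ext_up /topple => /negbTE ->.
by rewrite E0E ?up_D0.
Qed.

Lemma ext_add x (eta : stableV L) v : v \in D0 ->
  ext (add_particle x (fun y => nat_of_ord (eta y))) v = (hgt (lift_cfg eta) v + (v == up x))%N.
Proof.
by move=> vD; have [y ->] := D0_up vD; rewrite ext_up hgt_up /add_particle (inj_eq up_inj).
Qed.

Lemma ext_hgt (eta : stableV L) v : v \in D0 -> ext (fun y => nat_of_ord (eta y)) v = hgt (lift_cfg eta) v.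
Proof. by move=> vD; have [y ->] := D0_up vD; rewrite ext_up hgt_up. Qed.

Lemma goes_rec x eta xi : eta \in recV -> goes x eta xi -> xi \in recV.
Proof.
rewrite !recVP => al /asboolP[/topples_ext[_ h] _].
rewrite -(@eq_allowed _ E0 D0 (ext (fun y => nat_of_ord (xi y))) _ (fun v vD => ext_hgt xi vD)).
apply: h; apply: allowed_le al => v vD; rewrite ext_add //; exact: leq_addr.
Qed.

Lemma recV_class eta eta' (w : V N -> int) : eta \in recV -> eta' \in recV ->
  (forall v, v \notin D0 -> w v = 0) ->
  (forall v, v \in D0 -> (hgt (lift_cfg eta) v)%:Z =
     (hgt (lift_cfg eta') v)%:Z + 4 * w v - \sum_(u | E0 v u) w u) -> eta = eta'.
Proof.
rewrite !inE => /recP[s1 z1 a1] /recP[s2 z2 a2] w0 hw; apply: lift_inj.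
have [|_ e] := class_eq w0 s1 s2 a1 a2; first by move=> v vD; rewrite hw // deg0.
apply/ffunP => v; apply: val_inj; have [vD|vD] := boolP (v \in D0); first exact: e.
by have e1 := z1 v vD; have e2 := z2 v vD; exact: etrans e1 (esym e2).
Qed.

Lemma goes_class x eta eta' xi xi' : goes x eta xi -> goes x eta' xi' ->
  exists w : V N -> int, (forall v, v \notin D0 -> w v = 0) /\
    forall v, v \in D0 -> (hgt (lift_cfg xi) v)%:Z - (hgt (lift_cfg xi') v)%:Z +
      (4 * w v - \sum_(u | E0 v u) w u) =
      (hgt (lift_cfg eta) v)%:Z - (hgt (lift_cfg eta') v)%:Z.
Proof.
move=> /asboolP[/topples_ext[[w [w0 hw]] _] _] /asboolP[/topples_ext[[w' [w0' hw']] _] _].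
exists (fun v => (w v)%:Z - (w' v)%:Z); split=> [v vD|v vD]; first by rewrite w0 // w0'.
have := hw v vD; have := hw' v vD; rewrite !ext_add // !ext_hgt // sumrB.
rewrite -!(big_morph Posz PoszD (erefl _)).
move: (\sum_(u | E0 v u) w u)%N (\sum_(u | E0 v u) w' u)%N => s s'.
by rewrite mulrBr; lia.
Qed.

(** Two stabilizations of the same configuration differ by a Laplacian, so [recV_class] identifies
    them and no exchange of topplings has to be made. *)
Lemma goes_uniq x eta xi xi' : eta \in recV -> goes x eta xi -> goes x eta xi' -> xi = xi'.
Proof.
move=> er g g'; have [w [w0 hw]] := goes_class g g'.
apply: (@recV_class xi xi' (fun v => - w v)); rewrite ?(goes_rec er g) ?(goes_rec er g') //.
  by move=> v vD; rewrite w0 ?oppr0.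
move=> v vD; have := hw v vD; rewrite sumrN mulrN opprK subrr => h.
by move: h; move: (\sum_(u | E0 v u) w u) => s; lia.
Qed.

Lemma goes_inj x eta eta' xi : eta \in recV -> eta' \in recV ->
  goes x eta xi -> goes x eta' xi -> eta = eta'.
Proof.
move=> er er' g g'; have [w [w0 hw]] := goes_class g g'.
apply: (@recV_class eta eta' w) => // v vD; have := hw v vD; rewrite subrr add0r => h.
by rewrite -addrA h; ring.
Qed.

Definition after_list (c : V N -> nat) l : V L -> nat :=
  fun y => (c (up y) + count (fun z => adjN z (up y)) l - 4 * count_mem (up y) l)%N.

Lemma legal_topples (c : V N -> nat) l : legal (@adjN N) c l -> all (mem D0) l ->
  topples_to (@adjV L) (fun y => c (up y)) (after_list c l).
Proof.
elim: l => [|v l IH] /=.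
  move=> _ _; rewrite (_ : after_list c [::] = fun y => c (up y)); first exact: topples_refl.
  by apply: funext => y; rewrite /after_list /= addn0 subn0.
move=> /andP[ll le] /andP[vD lD]; have [x vx] := D0_up vD.
rewrite (_ : after_list c (v :: l) = topple (@adjV L) x (after_list c l)).
  apply: topples_step; first exact: IH.
  rewrite /unstable /after_list -vx; have := legal_ge v ll.
  by move: (count _ l) (count_mem v l) (c v) le => a b d; lia.
apply: funext => y; rewrite /topple /after_list /= vx (inj_eq up_inj) eq_sym adjN_up.
have := legal_ge (up y) ll.
case: (eqVneq y x) => [->|yx].
  rewrite (_ : adjV x x = false); last exact: adj_irr.
  by move: (count _ l) (count_mem (up x) l) (c (up x)) => a b d; lia.
by move: (count _ l) (count_mem (up y) l) (c (up y)) (adjV x y) => a b d []; lia.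
Qed.

(** A cascade with both regions constantly equal to [D0] confines nothing; no wave is bad, and the
    whole stabilization is carried out. *)
Lemma goes_ex x eta : eta \in recV -> exists2 xi, xi \in recV & goes x eta xi.
Proof.
move=> er; set o := up x; have oD : o \in D0 by apply: up_D0.
have her : lift_cfg eta \in rec E0 D0 by move: er; rewrite inE.
have symA : symmetric (@adjN N) by move=> u v; rewrite /adjN adj_sym.
pose K := wave_bound E0 D0 o; pose Z (k : nat) := D0.
have bnd v w : v \in D0 -> adjN v w -> (w \in D0) || (w \notin D0) by rewrite orbN.
have ok k : (k < K)%N -> active E0 D0 o (lift_cfg eta) k ->
    ~~ bad_wave E0 D0 o Z Z k (cut_state E0 D0 o (lift_cfg eta) k).
  move=> _ _; apply/negP => /existsP[y /and3P[_ yb /negP[]]]; move: yb.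
  apply: (subsetP _); apply: burn_min; apply/bclosedP => v vA _ le.
  apply: (bclosedP _ _ _ _ _ _ (burn_closed E0 (D0 :\ o) (Z k) [set o] _)) => //.
  by move: vA; rewrite in_setD1 => /andP[].
have [l [ll lD lZ _]] := cascade (Z := Z) (Y := Z) oD symA E0E deg0 (fun _ _ => subxx _)
  (fun _ _ => subxx _) (fun _ _ => oD) (fun k v w _ => bnd v w) (fun _ _ => subxx _) her ok (leqnn K).
pose c := start o (lift_cfg eta).
have cE : (fun y => c (up y)) = add_particle x (fun y => nat_of_ord (eta y)).
  by apply: funext => y; rewrite /c /start hgt_up /add_particle (inj_eq up_inj).
have fin y : after_list c l y = state E0 D0 o (lift_cfg eta) K (up y).
  have := laplacian_state E0 oD (lift_cfg eta) K (up y); rewrite deg0 ?up_D0 //.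
  rewrite /after_list lZ ?up_D0 // -/c => h.
  rewrite (_ : count _ l = \sum_(w | E0 (up y) w) fires E0 D0 o (lift_cfg eta) K w)%N.
    by rewrite -h addnK.
  rewrite count_sum; apply: eq_big => w; first by rewrite E0E ?up_D0 // symA.
  move=> _; have [wD|wD] := boolP (w \in D0); first by rewrite lZ.
  rewrite fires_out //; apply/eqP; rewrite -leqn0 leqNgt -has_count; apply/negP => /hasP[z zl /eqP zw].
  by have := allP lD z zl; rewrite zw /= (negbTE wD).
have st y : (after_list c l y < 4)%N.
  by rewrite fin -(deg0 (up_D0 y)); apply: final_stable => //; apply: up_D0.
pose xi : stableV L := [ffun y => inord (after_list c l y)].
have xiE : (fun y => nat_of_ord (xi y)) = after_list c l.
  by apply: funext => y; rewrite ffunE inordK.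
have g : goes x eta xi.
  apply/asboolP; rewrite -cE xiE; split; first exact: legal_topples.
  by move=> y; rewrite /unstable -ltnNge.
by exists xi => //; apply: goes_rec er g.
Qed.

Definition full : stableV L := [ffun=> ord_max].

Lemma full_rec : full \in recV.
Proof.
rewrite recVP; apply/allowedP => X XD X0.
have [||v vX [u Evu uX]] := @box_exit N E0 N X (leqnn _) _ _ X0.
- by move=> v u vX; apply: E0E; apply: (subsetP XD).
- by move=> v vX; have := subsetP XD v vX; rewrite inE ltnS.
exists v => //; have vD := subsetP XD v vX.
have [y e] := D0_up vD; rewrite [in X in (_ <= X)%N]e hgt_up ffunE /=.
have : (0 < nb E0 (~: X) v)%N.
  by rewrite card_gt0; apply/set0Pn; exists u; rewrite !inE uX.
by have := nbC E0 X v; rewrite deg0 //; lia.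
Qed.

Definition missing (eta : stableV L) := (\sum_y (3 - eta y))%N.

Lemma goes_down eta : eta != full -> exists x xi, goes x eta xi && (missing xi < missing eta)%N.
Proof.
move=> ne; have [x hx] : exists x, (eta x < 3)%N.
  apply/existsP; rewrite -[X in is_true X]negbK negb_exists; apply: contra ne => /forallP h.
  apply/eqP/ffunP => y; apply: val_inj; rewrite ffunE /=.
  have := h y; rewrite -leqNgt => h3; apply/eqP; rewrite eqn_leq h3 andbT -ltnS.
  exact: ltn_ord.
pose xi : stableV L := [ffun y => inord (eta y + (y == x))].
have xiE y : xi y = (eta y + (y == x))%N :> nat.
  by rewrite ffunE inordK //; have := ltn_ord (eta y); case: eqP => [->|_]; lia.
exists x, xi; apply/andP; split.
  apply/asboolP; split; last by move=> y; rewrite /unstable -ltnNge.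
  rewrite (_ : (fun y => nat_of_ord (xi y)) = add_particle x (fun y => nat_of_ord (eta y))).
    exact: topples_refl.
  by apply: funext => y; rewrite xiE.
rewrite /missing (bigD1 x) //= [ltnRHS](bigD1 x) //= xiE eqxx.
rewrite (eq_bigr (fun y => 3 - eta y)%N) => [|y /negbTE yx]; last by rewrite xiE yx addn0.
by rewrite ltn_add2r addn1; move: (nat_of_ord (eta x)) hx => n hx; lia.
Qed.

Lemma stationary_uniform (R : realType) (p : stableV L -> R) : stationary p ->
  forall eta, p eta = (eta \in recV)%:R / #|recV|%:R.
Proof.
move=> [p0 p1 pT]; have X0 : (0 < #|{: V L}|)%N.
  by have h : (nm origin <= L)%N by []; apply/card_gt0P; exists (at_site h).
move=> eta; have H := (@uniform_on_rec R (stableV L) (V L) goes recV full missing p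
  (@goes_ex) (@goes_uniq) (@goes_inj) (@goes_down) full_rec X0 p0 p1 pT).
exact: H.
Qed.

End BoxChain.

(** * Events decided in a finite box *)

Definition can_topple rho k (eta : config) : Prop :=
  exists l : seq site, [/\ legal adj (add_particle origin (fun z => nat_of_ord (eta z))) l,
    all (fun z => nm z <= rho)%N l & (k < count_mem origin l)%N].

(** Burning the outside of the box of radius [rho] reduces the uniform law to the graphs of
    [waves_in_box]. That bound holds for every unburnt region, so it survives averaging, with
    constants independent of [L]. *)
Lemma prV_can_topple (R : realType) (M : R) : 0 < M -> exists rho K : nat,
  forall L (p : stableV L -> R), (rho <= L)%N -> stationary p ->
  M <= \sum_(k < K) prV p (can_topple rho k).
Proof.
move=> M0; have [rho [K hK]] := waves_in_box M0; exists rho, K => L p rL st.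
have pE := stationary_uniform st; set N := L.+1.
have oN : (nm origin <= N)%N by []; pose o : V N := at_site oN.
have rN : (rho < N)%N by [].
have CD0 : ball N rho \subset D0 L by apply/subsetP => v; rewrite !inE => /leq_trans; apply.
pose tl k (xi : cfg (V N)) := `[< exists l, [/\ legal (@adjN N) (start o xi) l,
  all (mem (ball N rho)) l & (k < count_mem o l)%N] >].
pose phi (xi : cfg (V N)) : R := (\sum_(k < K) tl k xi)%N%:R.
have EF : @E0 L = full_graph (@adjN N) (D0 L).
  apply: funext => v; apply: funext => u; rewrite /E0 /sink_graph /full_graph.
  case: (boolP (v \in D0 L)) => //=; rewrite inE => ->.
  by rewrite orbT andbT.
have EP D : part_graph (@adjN N) (ball N rho) D = sink_graph rho D.
  by apply: funext => v; apply: funext => u; rewrite /sink_graph /part_graph inE.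
have main : M * #|rec (@E0 L) (D0 L)|%:R <= \sum_(xi in rec (@E0 L) (D0 L)) phi xi.
  rewrite EF; apply: (conditioned_sum CD0) => [xi xi' e|D CD].
    congr (_%:R); apply: eq_bigr => k _; congr nat_of_bool; apply: asbool_equiv_eq.
    have inl l : all (mem (ball N rho)) l ->
        legal (@adjN N) (start o xi) l = legal (@adjN N) (start o xi') l.
      move=> lC; apply: eq_legal => v vl; rewrite /start e //; exact: (allP lC).
    by split=> -[l [ll lC lk]]; exists l; split=> //; [rewrite -inl | rewrite inl].
  rewrite EP /phi -natr_sum; apply: hK => //; move=> v vr.
  by apply: (subsetP CD); rewrite inE.
have R0 : (0 < #|recV L|)%N by apply/card_gt0P; exists (full L); apply: full_rec.
have im : @lift_cfg L @: recV L = rec (@E0 L) (D0 L).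
  apply/setP => xi; apply/imsetP/idP => [[eta]|xr]; first by rewrite inE => h ->.
  by have [eta er e] := lift_surj xr; exists eta.
move: main; rewrite -im (card_imset _ (@lift_inj L)) (big_imset _ (in2W (@lift_inj L))) /=.
rewrite -ler_pdivlMr ?ltr0n // => h; apply: le_trans h _.
rewrite /prV; under [leRHS]eq_bigr do rewrite big_mkcond /=.
rewrite exchange_big /= mulr_suml [leRHS](bigID (mem (recV L))) /= ler_wpDr //.
  apply: sumr_ge0 => eta _; apply: sumr_ge0 => k _; case: ifP => // _.
  by rewrite pE divr_ge0.
apply: ler_sum => eta er; rewrite /phi natr_sum mulr_suml; apply: ler_sum => k _.
case: (boolP (tl k (lift_cfg eta))) => [/asboolP[l [ll lC lk]]|_]; last first.
  by rewrite mul0r; case: ifP => // _; rewrite pE divr_ge0.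
rewrite asboolT ?pE ?er //; exists (map val l); split.
- elim: l ll lC {lk} => //= v l IH /andP[ll le] /andP[vC lC].
  rewrite IH //=; apply: leq_trans (leq_trans _ le) _.
    by rewrite leq_add2l leq_mul2l count_map /=; apply: sub_count => u /= /eqP/val_inj ->.
  rewrite count_map /start; apply: leq_add => //.
  move: vC; rewrite !inE => vr; have vL : v \in D0 L by rewrite inE (leq_trans vr).
  have [y ->] := D0_up vL; rewrite hgt_up val_up /add_particle /extend valK leq_add2l.
  by have -> : (up y == o) = (val y == origin) by rewrite -(inj_eq val_inj).
- by apply/allP => z /mapP[v vl ->]; have := allP lC v vl; rewrite /= inE.
rewrite count_map; apply: leq_trans lk _; apply: sub_count => u /= /eqP ->.
by rewrite val_at.
Qed.

(** * Toppling sequences in the plane *)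

Lemma count_nbrs (T : eqType) (r : seq T) (l : seq T) : uniq r ->
  count (fun y => y \in r) l = (\sum_(y <- r) count_mem y l)%N.
Proof.
move=> ur; elim: l => [|x l IH] /=; first by rewrite big1.
rewrite big_split /= -IH; congr addn.
rewrite -(count_uniq_mem x ur) -sum1_count big_mkcond /=.
by apply: eq_bigr => y _; rewrite eq_sym; case: eqP.
Qed.

Section Exhaustive.
Variable eta : sandpile site.
Implicit Types (s : nat -> option site) (x y : site).

Definition fired s n x := (\sum_(k < n) (s k == Some x))%N.

Lemma after_fired s n : exhaustive adj eta s -> forall y,
  (after adj s eta n y + 4 * fired s n y = eta y + \sum_(z <- nbrs y) fired s n z)%N.
Proof.
move=> [_ leg _] y; elim: n => [|n IH].
  by rewrite /fired big_ord0 muln0 big1 // => z _; rewrite big_ord0.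
rewrite /fired big_ord_recr /= -/(fired s n y).
rewrite (eq_bigr (fun z => fired s n z + (s n == Some z))%N) => [|z _]; last first.
  by rewrite /fired big_ord_recr.
rewrite big_split /= addnA -IH; case e: (s n) => [x|]; last first.
  by rewrite (_ : (None == Some y) = false) // addn0 big1 // addn0.
have := leg n x e; rewrite /unstable /topple.
have -> : (\sum_(z <- nbrs y) (Some x == Some z) = adj x y)%N.
  rewrite adj_sym adj_nbrs -(count_uniq_mem x (nbrs_uniq y)) -sum1_count [RHS]big_mkcond /=.
  apply: eq_bigr => z _; rewrite (_ : (Some x == Some z) = (z == x)); first by case: eqP.
  by rewrite eq_sym.
rewrite (_ : (Some x == Some y) = (y == x)); last by rewrite eq_sym.
by case: (eqVneq y x) => [->|_] /=; rewrite ?adj_irr; lia.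
Qed.

Lemma fired_mono s n m x : (n <= m)%N -> (fired s n x <= fired s m x)%N.
Proof.
move=> nm; rewrite /fired (big_ord_widen m (fun k => (s k == Some x) : nat) nm) big_mkcond.
by apply: leq_sum => k _; case: ifP.
Qed.

(* Least action: an exhaustive sequence topples every site at least as often as
   any finite legal sequence. *)
Lemma exhaustive_ge s l : exhaustive adj eta s -> legal adj eta l ->
  exists n, forall x, (count_mem x l <= fired s n x)%N.
Proof.
move=> ex; elim: l => [|x l IH] /=; first by exists 0%N.
move=> /andP[/IH[n hn] le].
have [lt|ge] := ltnP (count_mem x l) (fired s n x).
  by exists n => y; case: eqP => [<-|_]; [rewrite add1n | apply: hn].
have eqx : fired s n x = count_mem x l by apply/eqP; rewrite eqn_leq ge hn.
have uns : unstable (after adj s eta n) x.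
  have := after_fired n ex x; rewrite eqx.
  have : (count (fun y => adj y x) l <= \sum_(z <- nbrs x) fired s n z)%N.
    rewrite (eq_count (a2 := fun y => y \in nbrs x)) => [|y]; last by rewrite adj_sym adj_nbrs.
    by rewrite count_nbrs ?nbrs_uniq //; apply: leq_sum => z _; apply: hn.
  move: le; rewrite /unstable; move: (count_mem x l) (count (fun y => adj y x) l) => b c.
  by move: (after _ _ _ _ _) (\sum_(z <- _) _)%N (eta x) => a d e; lia.
have [_ _ /(_ n x uns)[m nm em]] := ex.
exists m.+1 => y; have h := leq_trans (hn y) (fired_mono s y nm).
rewrite /fired big_ord_recr /= -/(fired s m y) em; case: (eqVneq x y) h => [<-|_] h; last first.
  by rewrite add0n (leq_trans h) ?leq_addr.
by rewrite eqxx addnC leq_add.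
Qed.

(* Every site is scanned infinitely often. *)
Definition scan (j : nat) : site := odflt origin (unpickle (logn 2 j)).

Lemma scan_all x n : exists2 j, (n <= j)%N & scan j = x.
Proof.
exists (2 ^ pickle x * n.*2.+1)%N.
  apply: leq_trans (leq_pmull _ _); first by rewrite -addnn; lia.
  by rewrite expn_gt0.
rewrite /scan lognM ?expn_gt0 // pfactorK // lognE /= dvdn2 /= odd_double /= addn0.
by rewrite pickleK.
Qed.

Definition next_uns (cp : sandpile site * nat) : option nat :=
  match pselect (exists j, (cp.2 <= j)%N && unstable cp.1 (scan j)) with
  | left h => Some (ex_minn h)
  | right _ => None
  end.

Definition scan_step cp : sandpile site * nat :=
  if next_uns cp is Some j then (topple adj (scan j) cp.1, j.+1) else cp.

Definition scan_state n := iter n scan_step (eta, 0%N).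

Definition scan_seq n : option site := omap scan (next_uns (scan_state n)).

Lemma scan_after n : after adj scan_seq eta n = (scan_state n).1.
Proof.
elim: n => //= n ->; rewrite /scan_seq /scan_step; case: (next_uns _) => //=.
Qed.

Lemma next_unsP cp : if next_uns cp is Some j then
    [/\ (cp.2 <= j)%N, unstable cp.1 (scan j) &
      forall i, (cp.2 <= i)%N -> unstable cp.1 (scan i) -> (j <= i)%N]
  else forall x, ~~ unstable cp.1 x.
Proof.
rewrite /next_uns; case: pselect => [h|h].
  case: ex_minnP => j /andP[h1 h2] h3; split=> // i i1 i2; apply: h3.
  by rewrite i1.
move=> x; apply/negP => ux; apply: h; have [j hj e] := scan_all x cp.2.
by exists j; rewrite hj e.
Qed.

(** An unstable site stays unstable until it topples, and the scanning position increases without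
    jumping over a position whose site is unstable; so the site is toppled at the latest when its
    position [J] comes up. *)
Lemma scan_exhaustive : exhaustive adj eta scan_seq.
Proof.
split=> [n|n x|n x].
- rewrite /scan_seq; case e: (next_uns (scan_state n)) => [j|] //= _.
  by rewrite -/(scan_state n) /scan_step e e.
- rewrite scan_after /scan_seq; have := next_unsP (scan_state n).
  by case: (next_uns _) => //= j [_ h _] [<-].
rewrite scan_after => ux; have [J hJ eJ] := scan_all x (scan_state n).2.
have [d] := ubnP (J - (scan_state n).2)%N; elim: d n ux hJ => // d IH n ux hJ hd.
have := next_unsP (scan_state n); case e: (next_uns _) => [j|]; last first.
  by move=> /(_ x); rewrite ux.
move=> [h1 h2 h3]; have jJ : (j <= J)%N by apply: h3; rewrite ?eJ.
have [jx|jx] := eqVneq (scan j) x; first by exists n => //; rewrite /scan_seq e /= jx.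
have jJ' : (j < J)%N by rewrite ltn_neqAle jJ andbT; apply: contraNneq jx => ->; rewrite eJ.
have st : scan_state n.+1 = (topple adj (scan j) (scan_state n).1, j.+1).
  by rewrite /scan_state iterS -/(scan_state n) /scan_step e.
have [|||m nm em] := IH n.+1; rewrite ?st //=.
- rewrite /unstable /topple eq_sym (negbTE jx); apply: leq_trans ux _; exact: leq_addr.
- by lia.
by exists m => //; apply: ltnW.
Qed.

End Exhaustive.

Lemma counting_ge (R : realType) (P : pred nat) n :
  ((\sum_(k < n) P k)%N%:R%:E <= counting [set k | P k]%classic :> \bar R)%E.
Proof.
rewrite /counting; case: asboolP => [fin|_]; last exact: leey.
rewrite lee_fin ler_nat -(big_mkord xpredT (fun k => P k : nat)).
have -> : (\sum_(0 <= k < n) P k)%N = size [seq k <- iota 0 n | P k].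
  by rewrite size_filter -sum1_count [RHS]big_mkcond /index_iota subn0; apply: eq_bigr => k _; case: (P k).
apply: uniq_leq_size; first by rewrite filter_uniq // iota_uniq.
by move=> k; rewrite mem_filter => /andP[Pk _]; rewrite in_fset_set // mem_setE.
Qed.

(** The default value of [N] is excluded by exhibiting [scan_seq]; for any exhaustive sequence least
    action gives the bound. *)
Lemma N_ge (R : realType) rho k (eta : config) : can_topple rho k eta ->
  (k.+1%:R%:E <= N R eta)%E.
Proof.
move=> [l [ll _ kl]]; rewrite /N; case: xgetP => [n -> [s ex ->]|none].
  have [m hm] := exhaustive_ge ex ll.
  have -> : [set j | s j = Some origin]%classic = [set j | s j == Some origin]%classic.
    by apply/seteqP; split => j /= /eqP.
  apply: le_trans _ (counting_ge R (fun j => s j == Some origin) m).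
  rewrite lee_fin ler_nat; exact: leq_trans kl (hm origin).
exfalso; apply: none; exists (scan_seq (add_particle origin (fun z => nat_of_ord (eta z)))).
  exact: scan_exhaustive.
by [].
Qed.

Lemma N_ge0 (R : realType) (eta : config) : (0 <= N R eta)%E.
Proof.
rewrite /N; case: xgetP => [n -> [s ex ->]|none] //.
Qed.

Lemma cylinder_can_topple rho k : cylinder (can_topple rho k).
Proof.
exists (box rho) => eta xi e [l [ll lr lk]]; exists l; split=> //.
rewrite -(@eq_legal _ _ (add_particle origin (fun z => nat_of_ord (eta z)))) // => z zl.
by rewrite /add_particle e // mem_boxE; exact: (allP lr).
Qed.

Lemma sum_can_topple_le_N (R : realType) rho K (eta : config) :
  ((\sum_(k < K) `[< can_topple rho k eta >])%N%:R%:E <= N R eta)%E.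
Proof.
elim: K => [|K IH]; first by rewrite big_ord0 N_ge0.
rewrite big_ord_recr /=; case: asboolP => [/(@N_ge R) h|_]; last by rewrite addn0.
apply: le_trans _ h; rewrite lee_fin ler_nat addn1 ltnS.
by rewrite -[leqRHS](card_ord K) -sum1_card; apply: leq_sum => k _; case: asboolP.
Qed.

(** * Passage to the infinite-volume limit *)

Lemma measurable_cylinder (E : set config) : cylinder E ->
  measurable (E : set configM).
Proof. by move=> cE; apply: sub_sigma_algebra. Qed.

(* Unlike [ge0_le_integral], this does not require measurability: the integral of
   a nonnegative function is a supremum over the simple functions below it. *)
Lemma le_integralT (R : realType) d (T : measurableType d)
    (mu : {measure set T -> \bar R}) (f g : T -> \bar R) :
  (forall x, 0 <= f x)%E -> (forall x, f x <= g x)%E ->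
  (\int[mu]_x f x <= \int[mu]_x g x)%E.
Proof.
move=> f0 fg; have g0 x : (0 <= g x)%E by exact: le_trans (f0 x) (fg x).
rewrite !ge0_integralTE //; apply: ereal_sup_le => _ [h hf <-].
by exists h => // x; exact: le_trans (hf x) (fg x).
Qed.

Lemma sum_measure_le_integral (R : realType) d (T : measurableType d)
    (mu : {measure set T -> \bar R}) (f : T -> \bar R) K (E : 'I_K -> set T) :
  (forall k, measurable (E k)) ->
  (forall x, (\sum_(k < K) \1_(E k) x)%:E <= f x)%E ->
  (\sum_(k < K) mu (E k) <= \int[mu]_x f x)%E.
Proof.
move=> mE Ef.
have -> : (\sum_(k < K) mu (E k) = \int[mu]_x (\sum_(k < K) \1_(E k) x)%:E)%E.
  under [RHS]eq_integral do rewrite -sumEFin.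
  rewrite ge0_integral_sum //=.
    by apply: eq_bigr => k _; rewrite integral_indic // classical_sets.setIT.
  by move=> k; apply/measurable_EFinP; exact/measurable_indic/mE.
by apply: le_integralT => // x; rewrite lee_fin sumr_ge0.
Qed.

From mathcomp Require Import classical_sets.

Theorem theorem1p9 (R : realType) (nu : probability configM R)
    (hnu : sandpile_measure nu) :
  (\int[nu]_(eta in setT) N R eta = +oo)%E.
Proof.
apply/eqyP => M M0; have [rho [K hK]] := prV_can_topple M0.
case: hnu => nuL st cv.
have Ec k := cylinder_can_topple rho k.
have sub := @sum_measure_le_integral R _ configM nu (N R) K
  (fun k => can_topple rho k).
apply: (le_trans _ (sub _ _)).
(* Only [K] cylinder events are involved, so the bound by [M], uniform in [L >= rho], passes to the
   limit. *)
- have lim : ((\sum_(k < K) prV (nuL L) (can_topple rho k))%R%:E @[L --> \oo] -->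
      (\sum_(k < K) nu (can_topple rho k))%E)%classic.
    under eq_cvg do rewrite -sumEFin.
    apply: cvg_nnesum => k _; last exact: cv.
    by near=> L; rewrite lee_fin sumr_ge0 // => eta _; have [+ _ _] := st L; apply.
  apply: cvge_to_ge lim _; near=> L; rewrite lee_fin hK //.
  by near: L; exact: nbhs_infty_ge.
- by move=> k; apply: measurable_cylinder.
move=> eta; apply: le_trans (sum_can_topple_le_N R rho K eta).
by rewrite lee_fin natr_sum ler_sum.
Unshelve. all: by end_near.
Qed.
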